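(* Let $n\ge1$, let $0\le\alpha\le\frac{37-\sqrt{505}}{72}$, and let $f=(f_1,\dots,f_n)':D^n\to\mathbb{C}^n$ be a normalized almost starlike mapping of order $\alpha$ on the unit polydisk $D^n$. Suppose that $$\frac{D^2f_k(0)(z^2)}{2!}=a_kz_k^2,\qquad \frac{D^3f_k(0)(z^3)}{3!}=b_kz_k^3,\qquad k=1,\dots,n,\ z\in D^n,$$ where $a_k=\frac{1}{2!}\frac{\partial^2f_k(0)}{\partial z_k^2}$ and $b_k=\frac{1}{3!}\frac{\partial^3f_k(0)}{\partial z_k^3}$. Then $$\frac{\|D^4f(0)(z^4)\|}{4!}\le\frac{(1-\alpha)(3-4\alpha)(4-6\alpha)}{3}\|z\|^4\qquad\text{for all } z\in D^n .$$ This estimate is sharp: for each $n$ and $\alpha$ the constant $\frac{(1-\alpha)(3-4\alpha)(4-6\alpha)}{3}$ cannot be replaced by a smaller one valid for all such $f$ and all $z\in D^n$.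
   Context: $\mathbb{C}^n$ carries the norm $\|z\|=\max_{1\le k\le n}|z_k|$, and $D^n=\{z\in\mathbb{C}^n:\|z\|<1\}$ is its open unit ball. For $x\ne0$, $T(x)=\{T_x\in(\mathbb{C}^n)^*:\|T_x\|=1,\ T_x(x)=\|x\|\}$. For a holomorphic map $f$ on $D^n$, $D^mf(x)$ is the $m$-th Fréchet derivative at $x$ (a symmetric $m$-linear map), $D^mf(x)(y^m)=D^mf(x)(y,\dots,y)$, and $D^mf_k$ denotes the derivative of the $k$-th component. $f:D^n\to\mathbb{C}^n$ is normalized if $f(0)=0$, $Df(0)=I$, and locally biholomorphic if $Df(x)$ is invertible for each $x\in D^n$. A normalized locally biholomorphic mapping $f:D^n\to\mathbb{C}^n$ is almost starlike of order $\alpha$ if $\mathrm{Re}\{T_x[(Df(x))^{-1}f(x)]\}\ge\alpha\|x\|$ for all $x\in D^n\setminus\{0\}$ and all $T_x\in T(x)$. *)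

(* Defs.v *)
From HB Require Import structures.
From mathcomp Require Import all_boot all_order all_algebra.
From mathcomp Require Import complex.
From mathcomp Require Import boolp classical_sets reals topology normedtype derive.
Set Implicit Arguments.
Unset Strict Implicit.
Unset Printing Implicit Defensive.
Import Order.TTheory GRing.Theory Num.Theory.
Import numFieldNormedType.Exports.
Local Open Scope classical_set_scope.
Local Open Scope ring_scope.
Local Open Scope complex_scope.

(** The complex numbers over [R : realType]. The name makes the topology and the
    norm that the library attaches to every numeric field apply to [R[i]];
    those instances do not unify with the type [R[i]] itself. *)
Definition CC (R : realType) : numClosedFieldType := R[i].

(** C^n is ['rV[CC R]_n]. The library norm of a row vector is the maximum of the
    moduli of its entries. Norms are elements of [CC R] with zero imaginary
    part, and [x <= y] in [CC R] means that [y - x] is a nonnegative real. *)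

Definition polydisk (R : realType) (n : nat) : set 'rV[CC R]_n :=
  [set z | `|z| < 1].

(** [frechet f [:: u_1; ...; u_m] x] is D^m f(x)(u_1, ..., u_m): the
    (m+1)-st derivative is the differential at [x] of the m-th derivative,
    everything being evaluated on vectors. *)
Fixpoint frechet (K : numFieldType) (V W : normedModType K) (f : V -> W)
    (us : seq V) (x : V) : W :=
  if us is u :: us' then 'd (frechet f us') x u else f x.

Definition frechet_pow (K : numFieldType) (V W : normedModType K) (f : V -> W)
    (m : nat) (x y : V) : W := frechet f (nseq m y) x.

Section Mappings.
Variables (R : realType) (n : nat).
Local Notation C := (CC R).
Implicit Types (f : 'rV[C]_n -> 'rV[C]_n) (x : 'rV[C]_n).

Definition component f (k : 'I_n) : 'rV[C]_n -> C := fun z => f z 0 k.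

(** The m-th iterated partial derivative of [f_k] in the variable [z_k]. *)
Definition pure_partial f (k : 'I_n) (m : nat) x : C :=
  iter m (fun g : 'rV[C]_n -> C => 'D_(delta_mx 0 k) g) (component f k) x.

(** A linear functional on C^n is automatically continuous, so the supremum
    below is that of a nonempty bounded set of real numbers. *)
Definition dual_norm (T : {linear 'rV[C]_n -> C}) : R :=
  sup [set complex.Re `|T x| | x in [set x | `|x| <= 1]].

Definition support_functional x (T : {linear 'rV[C]_n -> C}) : Prop :=
  dual_norm T = 1 /\ T x = `|x|.

Definition holomorphic f : Prop :=
  forall x, polydisk x -> differentiable f x.

Definition normalized f : Prop :=
  f 0 = 0 /\ forall v, 'd f 0 v = v.

Definition locally_biholomorphic f : Prop :=
  holomorphic f /\ forall x, polydisk x -> 'J f x \in unitmx.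

(** Row-vector convention: [Df(x) v] is [v *m 'J f x], hence
    [(Df(x))^-1 w] is [w *m invmx ('J f x)]. *)
Definition almost_starlike (alpha : R) f : Prop :=
  [/\ normalized f, locally_biholomorphic f &
      forall x (T : {linear 'rV[C]_n -> C}),
        polydisk x -> x != 0 -> support_functional x T ->
        alpha * complex.Re `|x| <= complex.Re (T (f x *m invmx ('J f x)))].

Definition pure_low_order_terms f : Prop :=
  forall (k : 'I_n) (z : 'rV[C]_n), polydisk z ->
    let a := pure_partial f k 2 0 / 2`!%:R in
    let b := pure_partial f k 3 0 / 3`!%:R in
    frechet_pow (component f k) 2 0 z / 2`!%:R = a * z 0 k ^+ 2 /\
    frechet_pow (component f k) 3 0 z / 3`!%:R = b * z 0 k ^+ 3.

End Mappings.

(* Main.v *)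
(* Write g(x) = (Df(x))^-1 f(x).  On a line x = t z with |z_k| = |z| = 1 the function
   p(t) = g_k(t z) / (t z_k) satisfies p(0) = 1 and Re p >= alpha, so
   (p - 1) / (p + 1 - 2 alpha) = w1 t + w2 t^2 + w3 t^3 + ... is a Schwarz function.
   Comparing the homogeneous terms of Df(x) g(x) = f(x), the fourth order term of f_k is
     -(2 (1 - alpha) / 3) (w3 + mu w1 w2 + nu w1^3),
   with mu = 7 alpha - 5 and nu = (3 - 4 alpha) (2 - 3 alpha).  The estimates
   |w2|, |w3| <= 1 - |w1|^2 bound the last factor by nu as soon as
   3 nu >= 2 (|mu| + 1), which is the hypothesis on alpha.  The maximum principle in z_k
   removes the restriction |z_k| = |z|.  Equality holds for the map whose components are
   z_k (1 + g z_k)^(-(1 + g) / g), g = 1 - 2 alpha.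

   The Taylor expansions rest on Cauchy's formula, obtained from Goursat's bisection
   argument for a function that is merely complex differentiable.  Coefficient estimates
   come from means over the unit circle; |w_k| <= 1 - |w_0|^2 follows from Bessel's
   inequality applied to phi (a + b x^k) for a well-chosen b. *)

Require Import Defs.
From mathcomp Require Import all_boot all_order all_algebra.
From mathcomp Require Import complex.
From mathcomp Require Import boolp classical_sets reals topology normedtype derive.
From HB Require Import structures.
From mathcomp Require Import ring lra.
From mathcomp Require Import functions ereal landau sequences.
From mathcomp Require Import measure lebesgue_measure lebesgue_integral ftc trigo exp.
Set Implicit Arguments.
Unset Strict Implicit.
Unset Printing Implicit Defensive.
Import Order.TTheory GRing.Theory Num.Theory.
Import numFieldNormedType.Exports.
Local Open Scope classical_set_scope.
Local Open Scope ring_scope.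
Local Open Scope complex_scope.

(** * Complex numbers over a real type *)

(** The pure second and third order terms reduce the problem to one variable. Once they are removed
    from f_k, the rest r starts at order four, so Dr(x) is O(|x|^3); as g(x) - x is O(|x|^2), the
    product Dr(x) g(x) agrees with Dr(x) x up to O(|x|^5). All coordinates of g other than g_k thus
    disappear from the fourth order comparison, although they couple in f.

    Two kinds of estimates are kept apart. Integrals are bounded through their real and imaginary
    parts, which costs a factor 2; these bounds serve only for differentiability and orders of
    vanishing. The constants that decide sharpness come from means of nonnegative functions and from
    the maximum principle, where no factor is lost.

    Complex differentiability is given pointwise, with no continuity of the derivative, and ['d] has
    a value even where it means nothing. Each iterated derivative in the statement must therefore be
    shown to exist, and its values are reached through uniqueness of expansions along complex lines.

    The extremal map is the case where the Schwarz function is t itself: w1 = 1, w2 = w3 = 0. *)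

Section Complex.
Variable R : realType.
Local Notation C := (CC R).
Implicit Types (z w : C) (x y : R).

(* [R[i]] and [CC R] carry different instances: the coordinates and the embedding of
   the reals are redeclared on [CC R] so that rewriting finds them. *)
Definition cre z : R := complex.Re z.
Definition cim z : R := complex.Im z.
Definition ofr x : C := x%:C.
Definition mkc x y : C := x +i* y.

Lemma cplx_eq z w : cre z = cre w -> cim z = cim w -> z = w.
Proof. by case: z w => [a b] [c d]; rewrite /cre /cim /= => -> ->. Qed.

Lemma cre_mk x y : cre (mkc x y) = x. Proof. by []. Qed.
Lemma cim_mk x y : cim (mkc x y) = y. Proof. by []. Qed.
Lemma creD z w : cre (z + w) = cre z + cre w. Proof. by case: z w => [a b] [c d]. Qed.
Lemma cimD z w : cim (z + w) = cim z + cim w. Proof. by case: z w => [a b] [c d]. Qed.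
Lemma creN z : cre (- z) = - cre z. Proof. by case: z => [a b]. Qed.
Lemma cimN z : cim (- z) = - cim z. Proof. by case: z => [a b]. Qed.
Lemma creM z w : cre (z * w) = cre z * cre w - cim z * cim w. Proof. by case: z w => [a b] [c d]. Qed.
Lemma cimM z w : cim (z * w) = cre z * cim w + cim z * cre w. Proof. by case: z w => [a b] [c d]. Qed.
Lemma cre0 : cre 0 = 0. Proof. by []. Qed.
Lemma cim0 : cim 0 = 0. Proof. by []. Qed.
Lemma cre1 : cre 1 = 1. Proof. by []. Qed.
Lemma cim1 : cim 1 = 0. Proof. by []. Qed.
Lemma cre_ofr x : cre (ofr x) = x. Proof. by []. Qed.
Lemma cim_ofr x : cim (ofr x) = 0. Proof. by []. Qed.
Lemma creB z w : cre (z - w) = cre z - cre w. Proof. by rewrite creD creN. Qed.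
Lemma cimB z w : cim (z - w) = cim z - cim w. Proof. by rewrite cimD cimN. Qed.
Definition reimE := (creB, cimB, creD, cimD, creN, cimN, creM, cimM, cre0, cim0, cre1, cim1, cre_ofr, cim_ofr, cre_mk, cim_mk).

Lemma ofrD x y : ofr (x + y) = ofr x + ofr y.
Proof. by apply: cplx_eq; rewrite !reimE //; ring. Qed.
Lemma ofrM x y : ofr (x * y) = ofr x * ofr y.
Proof. by apply: cplx_eq; rewrite !reimE; ring. Qed.
Lemma ofrN x : ofr (- x) = - ofr x.
Proof. by apply: cplx_eq; rewrite !reimE //; ring. Qed.
Lemma ofrB x y : ofr (x - y) = ofr x - ofr y.
Proof. by rewrite ofrD ofrN. Qed.
Lemma ofr0 : ofr 0 = 0. Proof. by []. Qed.
Lemma ofr1 : ofr 1 = 1. Proof. by []. Qed.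
Lemma ofr_inj : injective ofr. Proof. by move=> x y [->]. Qed.
Lemma ofr_eq0 x : (ofr x == 0) = (x == 0).
Proof. by apply/eqP/eqP => [/ofr_inj|->]. Qed.
Lemma ofrV x : ofr (x^-1) = (ofr x)^-1.
Proof.
have [->|x0] := eqVneq x 0; first by rewrite invr0 ofr0 invr0.
by apply: (mulIf (x := ofr x)); rewrite ?ofr_eq0 // -ofrM !mulVf ?ofr_eq0 ?ofr1.
Qed.
Lemma ofrX x n : ofr (x ^+ n) = ofr x ^+ n.
Proof. by elim: n => [//|n IH]; rewrite !exprS ofrM IH. Qed.
Lemma ofr_nat n : ofr n%:R = n%:R.
Proof. by elim: n => [//|n IH]; rewrite -!natr1 ofrD IH ofr1. Qed.
Lemma ler_ofr x y : (ofr x <= ofr y) = (x <= y). Proof. exact: lecR. Qed.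
Lemma ltr_ofr x y : (ofr x < ofr y) = (x < y). Proof. exact: ltcR. Qed.

Section Nrm.
Variable V : normedModType C.
Implicit Types u v : V.
Definition nrm v : R := complex.Re `|v|.

Lemma nrmE v : `|v| = ofr (nrm v).
Proof. by rewrite /ofr /nrm; have /complex_realP[k ->] := normr_real v. Qed.
Lemma nrm_ge0 v : 0 <= nrm v.
Proof. by rewrite -ler_ofr -nrmE normr_ge0. Qed.
Lemma nrm_eq0 v : (nrm v == 0) = (v == 0).
Proof. by rewrite -ofr_eq0 -nrmE normr_eq0. Qed.
Lemma nrm0 : nrm (0 : V) = 0. Proof. by apply/eqP; rewrite nrm_eq0. Qed.
Lemma nrm_gt0 v : (0 < nrm v) = (v != 0).
Proof. by rewrite lt_neqAle nrm_ge0 andbT eq_sym nrm_eq0. Qed.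
Lemma nrmD u v : nrm (u + v) <= nrm u + nrm v.
Proof. by rewrite -ler_ofr ofrD -!nrmE ler_normD. Qed.
Lemma nrmN v : nrm (- v) = nrm v. Proof. by rewrite /nrm normrN. Qed.
Lemma nrmB u v : nrm (u - v) <= nrm u + nrm v.
Proof. by rewrite -(nrmN v) nrmD. Qed.
Lemma nrm_sub u v : nrm (u - v) = nrm (v - u).
Proof. by rewrite /nrm distrC. Qed.
Lemma lt_nrm v x : (`|v| < ofr x) = (nrm v < x).
Proof. by rewrite nrmE ltr_ofr. Qed.
Lemma le_nrm v x : (`|v| <= ofr x) = (nrm v <= x).
Proof. by rewrite nrmE ler_ofr. Qed.
End Nrm.
Local Notation cmod := (@nrm (numFieldNormedType.ClosedField_sort__canonical__normed_module_NormedModule C)).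

Lemma nrmZ (V : normedModType C) z (v : V) : nrm (z *: v) = cmod z * nrm v.
Proof. by apply: ofr_inj; rewrite ofrM -!nrmE normrZ. Qed.

Lemma pos_ofr (e : C) : 0 < e -> exists2 x : R, 0 < x & e = ofr x.
Proof.
move=> e0; exists (complex.Re e); last first.
  by apply: cplx_eq => //; rewrite reimE /cim; move: e0; rewrite ltcE => /andP[/eqP -> _].
by move: e0; rewrite ltcE => /andP[].
Qed.

Lemma nrm1 : cmod 1 = 1. Proof. by rewrite /nrm normr1. Qed.
Lemma nrmM z w : cmod (z * w) = cmod z * cmod w.
Proof. by apply: ofr_inj; rewrite ofrM -!nrmE normrM. Qed.
Lemma nrmV z : cmod (z^-1) = (cmod z)^-1.
Proof. by apply: ofr_inj; rewrite ofrV -!nrmE normfV. Qed.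
Lemma nrmX z n : cmod (z ^+ n) = cmod z ^+ n.
Proof. by elim: n => [|n IH]; rewrite ?nrm1 // !exprS nrmM IH. Qed.
Lemma nrm_ofr x : cmod (ofr x) = `|x|.
Proof.
by rewrite /nrm /ofr normc_def /= expr0n /= addr0 sqrtr_sqr.
Qed.
Lemma nrmsq z : cmod z ^+ 2 = cre z ^+ 2 + cim z ^+ 2.
Proof.
apply: ofr_inj; rewrite ofrX -nrmE; have := add_Re2_Im2 z; exact/esym.
Qed.
Lemma cre_le z : `|cre z| <= cmod z.
Proof. by rewrite -ler_ofr -nrmE; exact: normc_ge_Re. Qed.
Lemma cim_le z : `|cim z| <= cmod z.
Proof.
rewrite -(@ler_pXn2r _ 2) ?nnegrE ?nrm_ge0 // nrmsq -normrX ger0_norm ?sqr_ge0 //.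
by rewrite lerDr sqr_ge0.
Qed.
Lemma nrm_le z : cmod z <= `|cre z| + `|cim z|.
Proof.
rewrite -(@ler_pXn2r _ 2) ?nnegrE ?nrm_ge0 ?addr_ge0 // nrmsq sqrrD -!normrX.
rewrite !(ger0_norm (sqr_ge0 _)).
have : 0 <= `|cre z| * `|cim z| by rewrite mulr_ge0.
by lra.
Qed.

End Complex.

(* A cast [nrm (z : CC R)] would hide equal terms from [lra]. *)
Notation cmod := (@nrm _ (numFieldNormedType.ClosedField_sort__canonical__normed_module_NormedModule (CC _))).

(** * Differentiability with epsilon and delta *)

Section Diff.
Variable R : realType.
Local Notation C := (CC R).

Lemma near_nrm (V : normedModType C) (x : V) (P : set V) :
  nbhs x P <-> exists2 d : R, 0 < d & forall y, nrm (y - x) < d -> P y.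
Proof.
split.
  move=> /nbhs_ballP[e /= e0]; have [d d0 ->] := pos_ofr e0 => H.
  exists d => // y yd; apply: H; rewrite -ball_normE /= distrC lt_nrm //.
move=> [d d0 H]; apply/nbhs_ballP; exists (ofr d) => /=; first by rewrite -ofr0 ltr_ofr.
by move=> y; rewrite -ball_normE /= distrC lt_nrm => /H.
Qed.

Lemma continuous_nrm (V W : normedModType C) (f : V -> W) x :
  {for x, continuous f} <-> forall e : R, 0 < e -> exists2 d, 0 < d &
    forall y, nrm (y - x) < d -> nrm (f y - f x) < e.
Proof.
split.
  move=> fc e e0; have := fc (fun w => nrm (w - f x) < e) => /(_ _)/near_nrm.
  by apply; apply/near_nrm; exists e.
move=> H P /near_nrm[e e0 eP]; apply/near_nrm; have [d d0 dH] := H e e0.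
by exists d => // y /dH /eP.
Qed.

Lemma diff_eps (V W : normedModType C) (f : V -> W) x : differentiable f x ->
  forall e : R, 0 < e -> exists2 d, 0 < d &
    forall h, nrm h < d -> nrm (f (x + h) - f x - 'd f x h) <= e * nrm h.
Proof.
move=> /diff_locally /eqaddoP H e e0.
have /H /near_nrm[d d0 dH] : 0 < ofr e by rewrite -ofr0 ltr_ofr.
exists d => // h hd; have := dH h; rewrite subr0 => /(_ hd) /=.
rewrite nrmE [`|h|]nrmE -ofrM ler_ofr.
rewrite -[X in nrm X <= _ -> _]/(f (h + x) - (f x + 'd f x h)).
by rewrite (addrC h) opprD addrA.
Qed.

Lemma linear_bounded (V W : normedModType C) (L : {linear V -> W}) :
  continuous L -> exists2 K : R, 0 < K & forall h, nrm (L h) <= K * nrm h.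
Proof.
move=> /linear_lipschitz[k k0 H]; have [K K0 E] := pos_ofr k0.
by exists K => // h; rewrite -ler_ofr ofrM -!nrmE -E.
Qed.

Lemma diff_bounded (V W : normedModType C) (f : V -> W) x : differentiable f x ->
  exists2 K : R, 0 < K & forall h, nrm ('d f x h) <= K * nrm h.
Proof. by move=> fx; apply: linear_bounded; exact: diff_continuous. Qed.

(** ['d] is an abstract choice, so a derivative is identified by uniqueness: the explicit candidate
    [L], continuous because of the bound [K], satisfies the defining expansion. *)
Lemma eps_diff (V W : normedModType C) (f : V -> W) x (L : V -> W) (K : R) :
  linear L -> (forall h, nrm (L h) <= K * nrm h) ->
  (forall e : R, 0 < e -> exists2 d, 0 < d &
    forall h, nrm h < d -> nrm (f (x + h) - f x - L h) <= e * nrm h) ->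
  differentiable f x /\ 'd f x = L :> (V -> W).
Proof.
move=> Llin LK H; pose LM := GRing.isLinear.Build C V W *:%R L Llin.
pose L' : {linear V -> W} := HB.pack L LM.
have Lc : continuous L'.
  move=> y; apply/continuous_nrm => e e0; exists (e / (1 + `|K|)).
    by rewrite divr_gt0 // ltr_pwDl.
  move=> z zy; rewrite -[L z - L y](linearB L'); apply: le_lt_trans (LK _) _.
  have K1 : 0 < 1 + `|K| by rewrite ltr_pwDl.
  rewrite ltr_pdivlMr // in zy; apply: le_lt_trans zy.
  rewrite mulrC ler_wpM2l ?nrm_ge0 //.
  by rewrite (le_trans (ler_norm K)) // lerDr.
have E : f \o shift x = cst (f x) + L' +o_ 0 id.
  apply/eqaddoP => c c0; have [e e0 ->] := pos_ofr c0.
  have [d d0 dH] := H e e0; apply/near_nrm; exists d => // h; rewrite subr0 => hd.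
  rewrite /= [`|h|]nrmE nrmE -ofrM ler_ofr.
  rewrite -[X in nrm X <= _]/(f (h + x) - (f x + L h)).
  by have := dH h hd; rewrite (addrC x) opprD addrA.
have dE := diff_unique Lc E; split=> //.
by apply/diff_locallyP; rewrite dE.
Qed.

Lemma diff_ball_eq (V W : normedModType C) (f g : V -> W) x (r : R) : 0 < r ->
  (forall y, nrm (y - x) < r -> f y = g y) -> differentiable g x ->
  differentiable f x /\ 'd f x = 'd g x :> (V -> W).
Proof.
move=> r0 fg gx; have [K _ KH] := diff_bounded gx.
apply: (eps_diff (linearP _) KH) => e e0; have [d d0 dH] := diff_eps gx e0.
exists (Num.min d r); first by rewrite lt_min d0.
move=> h; rewrite lt_min => /andP[hd hr].
by rewrite !fg ?dH // ?subrr ?nrm0 // addrAC subrr add0r.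
Qed.

Definition cder (phi : C -> C) (z a : C) :=
  forall e : R, 0 < e -> exists2 d, 0 < d &
    forall h, cmod h < d -> cmod (phi (z + h) - phi z - a * h) <= e * cmod h.

Lemma cder_diff (phi : C -> C) (z a : C) : cder phi z a ->
  differentiable phi z /\ (forall h, 'd phi z h = a * h).
Proof.
move=> H; have K (h : C) : cmod (a * h) <= cmod a * cmod h by rewrite nrmM.
have lin : linear ( *%R a : C -> C).
  by move=> c u v; rewrite mulrDr /GRing.scale /= mulrCA.
have [d1 d2] := eps_diff lin K H.
by split=> // h; rewrite d2.
Qed.

Lemma diff_cder (phi : C -> C) (z : C) : differentiable phi z -> cder phi z ('d phi z (1 : C)).
Proof.
move=> H e /(diff_eps H)[d d0 dH]; exists d => // h /dH.
by rewrite -[in 'd _ _ h](mulr1 h) -[h * 1]/(h *: 1) linearZ /= /GRing.scale /= (mulrC h).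
Qed.

Lemma is_derive_cder (phi : C -> C) (z a : C) : is_derive z (1 : C) phi a -> cder phi z a.
Proof.
case=> H <-; have dH : differentiable phi z by apply/derivable1_diffP.
by rewrite deriveE //; apply: diff_cder.
Qed.

Lemma cder_is_derive (phi : C -> C) z a : cder phi z a -> is_derive z (1 : C) phi a.
Proof.
move=> /cder_diff[H E]; apply: DeriveDef; first exact/derivable1_diffP.
by rewrite deriveE // E mulr1.
Qed.

Lemma cder_unique (phi : C -> C) z a b : cder phi z a -> cder phi z b -> a = b.
Proof. by move=> /cder_is_derive[_ <-] /cder_is_derive[_ <-]. Qed.

Lemma cder_cst c z : cder (fun=> c) z 0.
Proof. exact: is_derive_cder (is_derive_cst _ _ _). Qed.
Lemma cder_id z : cder id z 1.
Proof. exact: is_derive_cder (is_derive_id _ _). Qed.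
Lemma cderD phi psi z a b : cder phi z a -> cder psi z b ->
  cder (fun x => phi x + psi x) z (a + b).
Proof.
move=> /cder_is_derive H1 /cder_is_derive H2.
exact: is_derive_cder (is_deriveD H1 H2).
Qed.
Lemma cderN phi z a : cder phi z a -> cder (fun x => - phi x) z (- a).
Proof. by move=> /cder_is_derive H1; exact: is_derive_cder (is_deriveN H1). Qed.
Lemma cderB phi psi z a b : cder phi z a -> cder psi z b ->
  cder (fun x => phi x - psi x) z (a - b).
Proof. by move=> H1 /cderN H2; apply: cderD. Qed.
Lemma cderM phi psi z a b : cder phi z a -> cder psi z b ->
  cder (fun x => phi x * psi x) z (a * psi z + phi z * b).
Proof.
move=> /cder_is_derive H1 /cder_is_derive H2.
apply: is_derive_cder; apply: is_derive_eq (is_deriveM H1 H2) _.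
by rewrite /GRing.scale /= addrC mulrC (mulrC _ b) (mulrC b) .
Qed.
Lemma cder_comp phi psi z a b : cder phi z a -> cder psi (phi z) b ->
  cder (fun x => psi (phi x)) z (b * a).
Proof.
move=> H1 H2 e e0.
pose A := cmod a + 1; have A0 : 0 < A by rewrite ltr_wpDl ?nrm_ge0.
pose B := cmod b + 1; have B0 : 0 < B by rewrite ltr_wpDl ?nrm_ge0.
have [d2 d20 dH2] : exists2 d, 0 < d & forall h, cmod h < d ->
  cmod (psi (phi z + h) - psi (phi z) - b * h) <= e / 2 / A * cmod h.
  by apply: H2; rewrite !divr_gt0.
have [d1 d10 dH1] : exists2 d, 0 < d & forall h, cmod h < d ->
  cmod (phi (z + h) - phi z - a * h) <= Num.min 1 (e / 2 / B) * cmod h.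
  by apply: H1; rewrite lt_min ltr01 !divr_gt0.
exists (Num.min d1 (d2 / A)); first by rewrite lt_min d10 divr_gt0.
move=> h; rewrite lt_min ltr_pdivlMr // => /andP[/dH1 hd1 hd2].
set k := phi (z + h) - phi z in hd1.
have h0 := nrm_ge0 h.
have k1 : cmod k <= A * cmod h.
  rewrite -(subrK (a * h) k); apply: le_trans (nrmD _ _) _.
  rewrite nrmM /A mulrDl mul1r addrC lerD2l; apply: le_trans hd1 _.
  by rewrite -[leRHS]mul1r ler_wpM2r // ge_min lexx.
have /dH2 : cmod k < d2 by rewrite mulrC in hd2; exact: le_lt_trans hd2.
rewrite (_ : phi z + k = phi (z + h)); last by rewrite /k addrC subrK.
move=> hk; have -> : psi (phi (z + h)) - psi (phi z) - b * a * h =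
  (psi (phi (z + h)) - psi (phi z) - b * k) + b * (k - a * h) by ring.
apply: le_trans (nrmD _ _) _; rewrite [e]splitr mulrDl; apply: lerD.
  apply: le_trans hk _; rewrite -(mulrA (e / 2)) ler_wpM2l ?divr_ge0 ?(ltW e0) //.
  by rewrite ler_pdivrMl.
rewrite nrmM; apply: (@le_trans _ _ (B * (e / 2 / B * cmod h))).
  apply: ler_pM; rewrite ?nrm_ge0 ?lerDl //; apply: le_trans hd1 _.
  by rewrite ler_wpM2r // ge_min lexx orbT.
by rewrite mulrA mulrCA divff ?gt_eqF // mulr1.
Qed.
Lemma cderV phi z a : phi z != 0 -> cder phi z a ->
  cder (fun x => (phi x)^-1) z (- a / phi z ^+ 2).
Proof.
move=> p0 /cder_is_derive[d1 e1]; apply: is_derive_cder.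
split; first exact: derivableV.
by rewrite deriveV // e1 /GRing.scale /= mulNr mulNr mulrC.
Qed.
Lemma cderX phi z a n : cder phi z a -> cder (fun x => phi x ^+ n) z (a * (n%:R * phi z ^+ n.-1)).
Proof.
move=> H; elim: n => [|n IH].
  by rewrite mul0r mulr0; exact: cder_cst.
rewrite (_ : (fun _ => _) = (fun x => phi x * phi x ^+ n)); last by apply: funext => x; rewrite exprS.
have := cderM H IH.
suff -> : a * phi z ^+ n + phi z * (a * (n%:R * phi z ^+ n.-1)) =
   a * (n.+1%:R * phi z ^+ n.+1.-1) by [].
by case: n {IH} => [|n] /=; rewrite ?exprS -?[n.+2%:R]natr1; ring.
Qed.

Lemma cder_cont phi z a : cder phi z a -> {for z, continuous phi}.
Proof. by move=> /cder_diff[d _]; exact: differentiable_continuous. Qed.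

Lemma cder_near (phi psi : C -> C) z a (r : R) : 0 < r ->
  (forall y, cmod (y - z) < r -> phi y = psi y) -> cder psi z a -> cder phi z a.
Proof.
move=> r0 E H e e0; have [d d0 dH] := H e e0.
exists (Num.min d r); first by rewrite lt_min d0.
move=> h; rewrite lt_min => /andP[hd hr].
by rewrite !E ?dH // ?subrr ?nrm0 // addrAC subrr add0r.
Qed.

End Diff.

(** * Integrals over a real segment *)

Section Integral.
Variable R : realType.
Local Notation C := (CC R).

(* Primitives are taken on ]-1, 8[, an open set containing [0, 1] and [0, 2 pi]. *)
Lemma primitive_exists (f : R -> R) : continuous f ->
  exists P : R -> R, forall x : R, -1 < x < 8 -> is_derive x (1 : R) P (f x).
Proof.
move=> fc; pose P x := \int[@lebesgue_measure R]_(t in `[(-1), x]) f t.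
have fi : (@lebesgue_measure R).-integrable `[(-1), 8] (EFin \o f).
  apply: continuous_compact_integrable; first exact: segment_compact.
  exact: continuous_subspaceT.
exists P => x /andP[x1 x8].
have [dP P'] := continuous_FTC1_closed x8 fi x1 (fc x).
have P'' : derive P x (1 : R) = f x by rewrite -derive1E.
exact: (DeriveDef dP P'').
Qed.

(** Integrals below are differences of primitives, so their bounds come from the mean value
    theorem. *)
Lemma mvt_bounds (P f : R -> R) a b m M : -1 < a -> b < 8 -> a <= b ->
  (forall x : R, -1 < x < 8 -> is_derive x (1 : R) P (f x)) ->
  (forall x, a <= x <= b -> m <= f x <= M) ->
  m * (b - a) <= P b - P a <= M * (b - a).
Proof.
move=> a1 b8 ab dP H.
have [||c cab ->] := @MVT_segment R P f a b ab.
- move=> x; rewrite in_itv /= => /andP[ax xb]; apply: dP.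
  by rewrite (lt_trans a1 ax) (lt_trans xb b8).
- apply: continuous_in_subspaceT => x; rewrite inE /= in_itv /= => /andP[ax xb].
  have [dPx _] : is_derive x (1 : R) P (f x).
    by apply: dP; rewrite (lt_le_trans a1 ax) (le_lt_trans xb b8).
  by apply: differentiable_continuous; apply/derivable1_diffP.
have := H c; rewrite in_itv /= in cab; move=> /(_ cab) /andP[h1 h2].
by rewrite !ler_wpM2r ?subr_ge0.
Qed.

(** The norm of [R] takes its values in [R] and that of [C] in [C]; [cmod] puts both on the real
    scale. *)
Definition rcont (F : R -> C) := forall x (e : R), 0 < e ->
  exists2 d, 0 < d & forall y, `|y - x| < d -> cmod (F y - F x) < e.

Lemma rcont_real (g : R -> R) : (forall x (e : R), 0 < e ->
  exists2 d, 0 < d & forall y, `|y - x| < d -> `|g y - g x| < e) -> continuous g.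
Proof.
move=> H x; apply/cvgrPdist_lt => e /(H x)[d d0 dH].
apply/nbhs_ballP; exists d => //= y; rewrite /ball /= distrC => /dH.
by rewrite distrC.
Qed.

Lemma real_rcont (g : R -> R) : continuous g -> forall x (e : R), 0 < e ->
  exists2 d, 0 < d & forall y, `|y - x| < d -> `|g y - g x| < e.
Proof.
move=> gc x e e0; have /cvgrPdist_lt/(_ e e0) := gc x.
move=> /nbhs_ballP[d /= d0 H]; exists d => // y yd.
by rewrite distrC; apply: H; rewrite /ball /= distrC.
Qed.

Lemma rcont_re F : rcont F -> continuous (fun x => cre (F x)).
Proof.
move=> H; apply: rcont_real => x e /(H x)[d d0 dH]; exists d => // y /dH.
by apply: le_lt_trans; rewrite -creB cre_le.
Qed.
Lemma rcont_im F : rcont F -> continuous (fun x => cim (F x)).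
Proof.
move=> H; apply: rcont_real => x e /(H x)[d d0 dH]; exists d => // y /dH.
by apply: le_lt_trans; rewrite -cimB cim_le.
Qed.

Lemma rcont_mk F : continuous (fun x => cre (F x)) -> continuous (fun x => cim (F x)) -> rcont F.
Proof.
move=> /real_rcont H1 /real_rcont H2 x e e0.
have [d1 d10 dH1] : exists2 d, 0 < d & forall y, `|y - x| < d -> `|cre (F y) - cre (F x)| < e / 2.
  by apply: H1; rewrite divr_gt0.
have [d2 d20 dH2] : exists2 d, 0 < d & forall y, `|y - x| < d -> `|cim (F y) - cim (F x)| < e / 2.
  by apply: H2; rewrite divr_gt0.
exists (Num.min d1 d2); first by rewrite lt_min d10.
move=> y; rewrite lt_min => /andP[/dH1 h1 /dH2 h2].
apply: le_lt_trans (nrm_le _) _; rewrite creB cimB; lra.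
Qed.

Lemma rcont_cst c : rcont (fun=> c).
Proof. by apply: rcont_mk => x; exact: cst_continuous. Qed.
Lemma rcont_ofr g : continuous g -> rcont (fun x => ofr (g x)).
Proof. by move=> gc; apply: rcont_mk => //= x; exact: cst_continuous. Qed.
Lemma rcontD F G : rcont F -> rcont G -> rcont (fun x => F x + G x).
Proof.
move=> HF HG; apply: rcont_mk => x.
  under eq_fun do rewrite creD.
  exact: (cvgD (@rcont_re _ HF x) (@rcont_re _ HG x)).
under eq_fun do rewrite cimD.
exact: (cvgD (@rcont_im _ HF x) (@rcont_im _ HG x)).
Qed.
Lemma rcontM F G : rcont F -> rcont G -> rcont (fun x => F x * G x).
Proof.
move=> HF HG; apply: rcont_mk => x.
  under eq_fun do rewrite creM.
  exact: (cvgB (cvgM (@rcont_re _ HF x) (@rcont_re _ HG x)) (cvgM (@rcont_im _ HF x) (@rcont_im _ HG x))).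
under eq_fun do rewrite cimM.
exact: (cvgD (cvgM (@rcont_re _ HF x) (@rcont_im _ HG x)) (cvgM (@rcont_im _ HF x) (@rcont_re _ HG x))).
Qed.
Lemma rcontN F : rcont F -> rcont (fun x => - F x).
Proof.
move=> HF x e /(HF x)[d d0 dH]; exists d => // y /dH.
by rewrite -opprD nrmN.
Qed.
Lemma rcontB F G : rcont F -> rcont G -> rcont (fun x => F x - G x).
Proof. by move=> HF HG; apply: rcontD => //; apply: rcontN. Qed.
Lemma rcont_conj F : rcont F -> rcont (fun x => conjc (F x) : C).
Proof.
move=> HF; apply: rcont_mk => x.
  by rewrite (_ : (fun _ => _) = fun x => cre (F x)); [exact: (rcont_re HF)|apply: funext => y; case: (F y)].
rewrite (_ : (fun _ => _) = fun x => - cim (F x)).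
  exact: (cvgN (@rcont_im _ HF x)).
by apply: funext => y; case: (F y).
Qed.
Lemma rcont_comp (phi : C -> C) F : rcont F ->
  (forall x, {for F x, continuous phi}) -> rcont (fun x => phi (F x)).
Proof.
move=> HF pc x e e0; have /continuous_nrm/(_ e e0)[d1 d10 H1] := pc x.
have [d d0 H] := HF x d1 d10; exists d => // y /H /H1.
by apply.
Qed.
Lemma rcontV F : rcont F -> (forall x, F x != 0) -> rcont (fun x => (F x)^-1).
Proof.
move=> HF F0; apply: (@rcont_comp (fun z => z^-1) F HF) => x.
exact: inv_continuous.
Qed.
Lemma rcontX F n : rcont F -> rcont (fun x => F x ^+ n).
Proof.
move=> HF; elim: n => [|n IH]; first exact: rcont_cst.
rewrite (_ : (fun _ => _) = (fun x => F x * F x ^+ n)); first exact: rcontM.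
by apply: funext => x; rewrite exprS.
Qed.

Definition cprim (F P : R -> C) := forall x : R, -1 < x < 8 ->
  is_derive x (1 : R) (fun y => cre (P y)) (cre (F x)) /\
  is_derive x (1 : R) (fun y => cim (P y)) (cim (F x)).

Lemma cprim_exists F : rcont F -> exists P, cprim F P.
Proof.
move=> HF; have [P1 H1] := primitive_exists (rcont_re HF).
have [P2 H2] := primitive_exists (rcont_im HF).
exists (fun x => mkc (P1 x) (P2 x)) => x x18; split; [exact: H1|exact: H2].
Qed.

(* The choice of the primitive is irrelevant by [cprim_unique]. *)
Definition cint (F : R -> C) a b : C :=
  let P := xget (fun=> 0) (cprim F) in P b - P a.

(** The factor 2 is the price of bounding the real and imaginary parts separately. *)
Lemma cprim_bound F P a b M : cprim F P -> -1 < a -> b < 8 -> a <= b ->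
  (forall x, a <= x <= b -> cmod (F x) <= M) ->
  cmod (P b - P a) <= 2 * M * (b - a).
Proof.
move=> FP a1 b8 ab H; apply: le_trans (nrm_le _) _; rewrite creB cimB.
have /andP[h1 h2] := @mvt_bounds (fun x => cre (P x)) (fun x => cre (F x)) a b (- M) M a1 b8 ab
  (fun x h => (FP x h).1) (fun x h => etrans (esym (ler_norml _ _)) (le_trans (cre_le _) (H x h))).
have /andP[h3 h4] := @mvt_bounds (fun x => cim (P x)) (fun x => cim (F x)) a b (- M) M a1 b8 ab
  (fun x h => (FP x h).2) (fun x h => etrans (esym (ler_norml _ _)) (le_trans (cim_le _) (H x h))).
rewrite -mulrA mulr_natl mulr2n; apply: lerD; rewrite ler_norml -?mulNr; exact/andP.
Qed.

Lemma cprimB F G P Q : cprim F P -> cprim G Q -> cprim (fun x => F x - G x) (fun x => P x - Q x).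
Proof.
move=> FP GQ x x18; have [p1 p2] := FP x x18; have [q1 q2] := GQ x x18; split.
  rewrite creB (_ : (fun _ => _) = (fun x => cre (P x)) - (fun x => cre (Q x))); first exact: is_deriveB.
  by apply: funext => y; rewrite creB.
rewrite cimB (_ : (fun _ => _) = (fun x => cim (P x)) - (fun x => cim (Q x))); first exact: is_deriveB.
by apply: funext => y; rewrite cimB.
Qed.

Lemma cprim_unique F P Q a b : cprim F P -> cprim F Q -> -1 < a < 8 -> -1 < b < 8 ->
  P b - P a = Q b - Q a.
Proof.
move=> FP FQ; wlog ab : a b / a <= b.
  move=> W A B; have [/W|/ltW/W] := leP a b; first exact.
  by move=> /(_ B A) E; rewrite -(opprB (P a)) E opprB.
move=> /andP[a1 a8] /andP[b1 b8].
have := cprim_bound (M := 0) (cprimB FP FQ) a1 b8 ab.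
have H x : a <= x <= b -> cmod (F x - F x) <= 0 by move=> _; rewrite subrr nrm0.
move=> /(_ H); rewrite mulr0 mul0r => h.
have /eqP : cmod (P b - Q b - (P a - Q a)) = 0.
  by apply/eqP; rewrite eq_le h nrm_ge0.
rewrite nrm_eq0 => /eqP E; apply/eqP; rewrite -subr_eq0 -E; apply/eqP; ring.
Qed.

Lemma cintE F P a b : cprim F P -> -1 < a < 8 -> -1 < b < 8 -> cint F a b = P b - P a.
Proof.
move=> FP Ha Hb; rewrite /cint; apply: (cprim_unique _ FP Ha Hb).
exact: (xgetPex (fun=> 0) (ex_intro _ P FP)).
Qed.

Lemma cint_bound F a b M : rcont F -> -1 < a -> b < 8 -> a <= b ->
  (forall x, a <= x <= b -> cmod (F x) <= M) ->
  cmod (cint F a b) <= 2 * M * (b - a).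
Proof.
move=> /cprim_exists[P FP] a1 b8 ab H; rewrite (cintE FP); first exact: (cprim_bound FP).
  by rewrite a1 (le_lt_trans ab).
by rewrite b8 (lt_le_trans a1).
Qed.

Lemma cint_chasles F a b c : cint F a c = cint F a b + cint F b c.
Proof. by rewrite /cint; ring. Qed.

Lemma cintB F G a b : rcont F -> rcont G -> -1 < a < 8 -> -1 < b < 8 ->
  cint (fun x => F x - G x) a b = cint F a b - cint G a b.
Proof.
move=> /cprim_exists[P FP] /cprim_exists[Q GQ] Ha Hb.
by rewrite (cintE FP) // (cintE GQ) // (cintE (cprimB FP GQ)) //; ring.
Qed.

Lemma cprimZ c F P : cprim F P -> cprim (fun x => c * F x) (fun x => c * P x).
Proof.
move=> FP x x18; have [p1 p2] := FP x x18; split.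
  rewrite creM (_ : (fun _ => _) = cre c *: (fun x => cre (P x)) - cim c *: (fun x => cim (P x))).
    exact: is_deriveB.
  by apply: funext => y; rewrite creM.
rewrite cimM (_ : (fun _ => _) = cre c *: (fun x => cim (P x)) + cim c *: (fun x => cre (P x))).
  exact: is_deriveD.
by apply: funext => y; rewrite cimM.
Qed.

Lemma cintZ c F a b : rcont F -> -1 < a < 8 -> -1 < b < 8 ->
  cint (fun x => c * F x) a b = c * cint F a b.
Proof.
move=> /cprim_exists[P FP] Ha Hb.
by rewrite (cintE FP) // (cintE (cprimZ c FP)) // mulrBr.
Qed.

Lemma cintD F G a b : rcont F -> rcont G -> -1 < a < 8 -> -1 < b < 8 ->
  cint (fun x => F x + G x) a b = cint F a b + cint G a b.
Proof.
move=> HF HG Ha Hb; have HG' := rcontN HG.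
rewrite (_ : (fun x => F x + G x) = (fun x => F x - (-1) * G x)); last first.
  by apply: funext => x; ring.
rewrite cintB ?cintZ //; first by ring.
by apply: rcontM => //; exact: rcont_cst.
Qed.

Lemma cint_conj F a b : rcont F -> -1 < a < 8 -> -1 < b < 8 ->
  cint (fun x => conjc (F x) : C) a b = conjc (cint F a b) :> C.
Proof.
move=> /cprim_exists[P FP] Ha Hb.
rewrite (cintE FP) // (@cintE _ (fun x => conjc (P x))) //.
  by case: (P b) (P a) => [x y] [z t]; apply: cplx_eq; rewrite !reimE //= /cim /=; ring.
move=> x /FP [p1 p2]; split.
  rewrite (_ : (fun y => _) = (fun y => cre (P y))); last by apply: funext => y; case: (P y).
  by case: (F x) p1.
rewrite (_ : (fun y => _) = - (fun y => cim (P y))); last first.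
  by apply: funext => y; rewrite -[RHS]/(- cim (P y)); case: (P y).
rewrite (_ : cim _ = - cim (F x)); last by case: (F x).
exact: is_deriveN.
Qed.

Lemma cint_re_ge0 F a b : rcont F -> -1 < a -> b < 8 -> a <= b ->
  (forall x, 0 <= cre (F x)) -> 0 <= cre (cint F a b).
Proof.
move=> HF a1 b8 ab H; have [P FP] := cprim_exists HF.
have [M MH] : exists M, forall x, a <= x <= b -> cre (F x) <= M.
  have [c _ Hc] := @EVT_max R (fun x => cre (F x)) a b ab (continuous_subspaceT (rcont_re HF)).
  by exists (cre (F c)) => x xab; apply: Hc; rewrite in_itv.
rewrite (cintE FP) ?a1 ?b8 ?(le_lt_trans ab) ?(lt_le_trans a1) // creB.
have /andP[h _] := @mvt_bounds (fun x => cre (P x)) (fun x => cre (F x)) a b 0 M a1 b8 ab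
  (fun x h => (FP x h).1) (fun x h => introT andP (conj (H x) (MH x h))).
by rewrite mul0r in h.
Qed.

End Integral.

(** * Goursat's argument and Cauchy's formula *)

Section Cauchy.
Variable R : realType.
Local Notation C := (CC R).

Lemma exp2_gt (x : R) : exists n : nat, x < 2 ^+ n.
Proof.
pose n := Num.bound `|x|; exists n.
have h1 : x < n%:R by apply: le_lt_trans (ler_norm x) _; exact: archi_boundP.
apply: lt_trans h1 _; rewrite -natrX ltr_nat; exact: ltn_expl.
Qed.

(** Goursat's bisection for any additive function of rectangles. One of the four quarters keeps at
    least a fourth of the modulus; the nested quarters shrink to a point [(p, q)], where the local
    bound, quadratic in the half-perimeter, decays at the same rate [4 ^- n] but with an arbitrarily
    small factor [e]. *)
Lemma bisection (W : R -> R -> R -> R -> C) (a b c d : R) : a <= b -> c <= d ->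
  (forall x m y s t, a <= x -> x <= m -> m <= y -> y <= b -> c <= s -> s <= t -> t <= d ->
     W x y s t = W x m s t + W m y s t) ->
  (forall x y s m t, a <= x -> x <= y -> y <= b -> c <= s -> s <= m -> m <= t -> t <= d ->
     W x y s t = W x y s m + W x y m t) ->
  (forall p q, a <= p <= b -> c <= q <= d -> forall e : R, 0 < e -> exists2 dl, 0 < dl &
    forall x y s t, a <= x -> x <= p -> p <= y -> y <= b ->
      c <= s -> s <= q -> q <= t -> t <= d -> y - x < dl -> t - s < dl ->
      cmod (W x y s t) <= e * ((y - x) + (t - s)) ^+ 2) ->
  W a b c d = 0.
Proof.
move=> ab cd addx addy loc.
(* [q] holds the half-sides [h], [k] and the lower corner [u], [v] of a rectangle. All rectangles of
   one stage have the same sides, so only the corner of the next one has to be chosen. *)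
pose cond (q : R * R * (R * R)) := let: ((h, k), (u, v)) := q in
  [&& 0 <= h, 0 <= k, a <= u, u + 2 * h <= b, c <= v & v + 2 * k <= d].
pose good (q : R * R * (R * R)) (uv : R * R) := let: ((h, k), (u, v)) := q in
   [/\ u <= uv.1, uv.1 + h <= u + 2 * h, v <= uv.2, uv.2 + k <= v + 2 * k &
     cmod (W u (u + 2 * h) v (v + 2 * k)) <=
       4 * cmod (W uv.1 (uv.1 + h) uv.2 (uv.2 + k))].
have step q : exists uv : R * R, cond q -> good q uv.
  case: q => [[h k] [u v]]; rewrite /cond /good.
  (* [(0, 0)] is a default outside the admissible rectangles, which lets the choice function be
     total. *)
  case: (boolP [&& _, _, _, _, _ & _]) => [|_]; last by exists (0, 0).
  case/and5P => h0 k0 au ub /andP[cv vd].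
  set N := cmod (W u (u + 2 * h) v (v + 2 * k)).
  have [h1|h1] := leP N (4 * cmod (W u (u + h) v (v + k))).
    by exists (u, v) => _ /=; split => //; lra.
  have [h2|h2] := leP N (4 * cmod (W (u + h) (u + h + h) v (v + k))).
    by exists (u + h, v) => _ /=; split => //; lra.
  have [h3|h3] := leP N (4 * cmod (W u (u + h) (v + k) (v + k + k))).
    by exists (u, v + k) => _ /=; split => //; lra.
  have [h4|h4] := leP N (4 * cmod (W (u + h) (u + h + h) (v + k) (v + k + k))).
    by exists (u + h, v + k) => _ /=; split => //; lra.
  exfalso; move: h1 h2 h3 h4.
  have E : W u (u + 2 * h) v (v + 2 * k) =
     (W u (u + h) v (v + k) + W u (u + h) (v + k) (v + k + k)) +
     (W (u + h) (u + h + h) v (v + k) + W (u + h) (u + h + h) (v + k) (v + k + k)).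
    have eu : u + 2 * h = u + h + h by ring.
    have ev : v + 2 * k = v + k + k by ring.
    rewrite eu in ub *; rewrite ev in vd *.
    have i1 : u <= u + h by rewrite lerDl.
    have i2 : u + h <= u + h + h by rewrite lerDl.
    have i3 : v <= v + k by rewrite lerDl.
    have i4 : v + k <= v + k + k by rewrite lerDl.
    have i5 := le_trans au i1; have i6 := le_trans i2 ub.
    have i7 := le_trans i1 i2; have i8 := le_trans i3 i4.
    rewrite (addx u (u + h)) // (addy u (u + h) v (v + k)) //.
    by rewrite (addy (u + h) (u + h + h) v (v + k)).
  have := nrmD (W u (u + h) v (v + k) + W u (u + h) (v + k) (v + k + k))
    (W (u + h) (u + h + h) v (v + k) + W (u + h) (u + h + h) (v + k) (v + k + k)).
  have := nrmD (W u (u + h) v (v + k)) (W u (u + h) (v + k) (v + k + k)).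
  have := nrmD (W (u + h) (u + h + h) v (v + k)) (W (u + h) (u + h + h) (v + k) (v + k + k)).
  rewrite -E -/N; lra.
have [f fP] := boolp.choice step.
pose hx n := (b - a) / 2 ^+ n; pose hy n := (d - c) / 2 ^+ n.
have hxS n : hx n = 2 * hx n.+1.
  by rewrite /hx exprS invfM mulrCA [2 * _]mulrA mulfV ?mul1r // pnatr_eq0.
have hyS n : hy n = 2 * hy n.+1.
  by rewrite /hy exprS invfM mulrCA [2 * _]mulrA mulfV ?mul1r // pnatr_eq0.
have hx0 n : 0 <= hx n by rewrite divr_ge0 ?exprn_ge0 // subr_ge0.
have hy0 n : 0 <= hy n by rewrite divr_ge0 ?exprn_ge0 // subr_ge0.
pose s := fix s n := if n is n'.+1 then f ((hx n, hy n), s n') else (a, c).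
have sS n : s n.+1 = f ((hx n.+1, hy n.+1), s n) by [].
have inv n : [/\ a <= (s n).1, (s n).1 + hx n <= b, c <= (s n).2, (s n).2 + hy n <= d &
  cmod (W a b c d) <= 4 ^+ n * cmod (W (s n).1 ((s n).1 + hx n) (s n).2 ((s n).2 + hy n))] /\
  good ((hx n.+1, hy n.+1), s n) (s n.+1).
  have st m : [/\ a <= (s m).1, (s m).1 + hx m <= b, c <= (s m).2 & (s m).2 + hy m <= d] ->
     good ((hx m.+1, hy m.+1), s m) (s m.+1).
    move=> [h1 h2 h3 h4]; have := fP ((hx m.+1, hy m.+1), s m); rewrite -sS; apply.
    by move: h1 h2 h3 h4; rewrite hxS hyS; case: (s m) => u v /= -> -> -> ->; rewrite hx0 hy0.
  elim: n => [|n [[h1 h2 h3 h4 h5] h6]].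
    have E1 : a + hx 0%N = b by rewrite /hx expr0 divr1; ring.
    have E2 : c + hy 0%N = d by rewrite /hy expr0 divr1; ring.
    by split; [|apply: st]; split; rewrite /= ?E1 ?E2 ?expr0 ?mul1r.
  suff H : [/\ a <= (s n.+1).1, (s n.+1).1 + hx n.+1 <= b, c <= (s n.+1).2, (s n.+1).2 + hy n.+1 <= d &
    cmod (W a b c d) <= 4 ^+ n.+1 * cmod (W (s n.+1).1 ((s n.+1).1 + hx n.+1) (s n.+1).2 ((s n.+1).2 + hy n.+1))].
    by split => //; apply: st; case: H.
  move: h1 h2 h3 h4 h5 h6; rewrite hxS hyS; case: (s n) => u v /=; rewrite -/(s n.+1).
  move=> h1 h2 h3 h4 h5 [h6 h7 h8 h9 h10].
  split; [lra|lra|lra|lra|]; apply: le_trans h5 _.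
  by rewrite exprSr -mulrA ler_wpM2l // exprn_ge0.
have mono n m : (n <= m)%N -> [/\ (s n).1 <= (s m).1, (s m).1 + hx m <= (s n).1 + hx n,
   (s n).2 <= (s m).2 & (s m).2 + hy m <= (s n).2 + hy n].
  elim: m => [|m IH]; first by rewrite leqn0 => /eqP ->.
  rewrite leq_eqVlt => /predU1P[->//|/IH[h1 h2 h3 h4]].
  have [_] := inv m; move: h1 h2 h3 h4; rewrite (hxS m) (hyS m); case: (s m) => u v /=.
  by rewrite -/(s m.+1) => h1 h2 h3 h4 [h5 h6 h7 h8 _]; split; lra.
have cross n m : (s n).1 <= (s m).1 + hx m /\ (s n).2 <= (s m).2 + hy m.
  have [nm|/ltnW mn] := leqP n m.
    have [h1 _ h2 _] := mono n m nm; have := hx0 m; have := hy0 m; split; lra.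
  have [_ h1 _ h2] := mono m n mn; have := hx0 n; have := hy0 n; split; lra.
(* By [cross] every upper end bounds all lower ends, so the suprema of the lower corners lie in
   every rectangle. *)
pose p := sup [set (s n).1 | n in [set: nat]].
pose q := sup [set (s n).2 | n in [set: nat]].
have pn n : (s n).1 <= p <= (s n).1 + hx n.
  apply/andP; split.
    apply: ub_le_sup; [|by exists n].
    by exists ((s 0%N).1 + hx 0%N) => _ [m _ <-]; case: (cross m 0%N).
  apply: ge_sup; first by exists (s 0%N).1, 0%N.
  by move=> _ [m _ <-]; case: (cross m n).
have qn n : (s n).2 <= q <= (s n).2 + hy n.
  apply/andP; split.
    apply: ub_le_sup; [|by exists n].
    by exists ((s 0%N).2 + hy 0%N) => _ [m _ <-]; case: (cross m 0%N).
  apply: ge_sup; first by exists (s 0%N).2, 0%N.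
  by move=> _ [m _ <-]; case: (cross m n).
apply/eqP; rewrite -nrm_eq0 eq_le nrm_ge0 andbT leNgt; apply/negP => w0.
set w := nrm (W a b c d) in w0.
pose L := (b - a) + (d - c).
have L0 : 0 <= L by rewrite addr_ge0 ?subr_ge0.
have L1 : 0 < L ^+ 2 + 1 by rewrite ltr_wpDl ?sqr_ge0.
have pab : a <= p <= b.
  have [[h1 h2 _ _ _] _] := inv 0%N; have /andP[h3 h4] := pn 0%N; apply/andP; split; lra.
have qcd : c <= q <= d.
  have [[_ _ h1 h2 _] _] := inv 0%N; have /andP[h3 h4] := qn 0%N; apply/andP; split; lra.
(* With this [e] a late stage yields [w <= w / (L ^+ 2 + 1) * L ^+ 2], impossible for [0 < w]; the
   [+ 1] also covers [L = 0]. *)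
have [dl dl0 H] := loc p q pab qcd (w / (L ^+ 2 + 1)) (divr_gt0 w0 L1).
have [n nP] := exp2_gt (L / dl).
have P2 : 0 < 2 ^+ n :> R by rewrite exprn_gt0.
have Ln : L / 2 ^+ n < dl by rewrite ltr_pdivrMr // mulrC -ltr_pdivrMr.
have hxy : hx n + hy n = L / 2 ^+ n by rewrite /hx /hy -mulrDl.
have [[h1 h2 h3 h4 h5] _] := inv n; have /andP[h6 h7] := pn n; have /andP[h8 h9] := qn n.
have := H _ _ _ _ h1 h6 h7 h2 h3 h8 h9 h4.
rewrite ![_ + _ - (s n).1]addrAC !subrr ![_ + _ - (s n).2]addrAC !subrr !add0r.
have := hx0 n; have := hy0 n => hyn hxn.
rewrite hxy => /(_ ltac:(lra) ltac:(lra)) h10.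
have : w <= w / (L ^+ 2 + 1) * L ^+ 2.
  apply: le_trans h5 _; rewrite (_ : 4 = 2 ^+ 2); last by ring.
  apply: le_trans (ler_wpM2l _ h10) _; first by rewrite !exprn_ge0.
  rewrite exprAC le_eqVlt; apply/orP; left; apply/eqP.
  by field; rewrite !gt_eqF.
rewrite mulrAC ler_pdivlMr // ler_pM2l //; lra.
Qed.
End Cauchy.

(** * Cauchy's theorem by radial contraction of the unit circle towards a point *)

Section Cauchy.
Variable R : realType.
Local Notation C := (CC R).

Definition cis (t : R) : C := mkc (cos t) (sin t).
Definition imu : C := mkc 0 1.

Lemma nrm_cis t : cmod (cis t) = 1.
Proof.
apply/eqP; rewrite -(@eqrXn2 _ 2) ?nrm_ge0 // expr1n nrmsq !reimE.
by rewrite cos2Dsin2.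
Qed.
Lemma nrm_imu : cmod imu = 1.
Proof.
apply/eqP; rewrite -(@eqrXn2 _ 2) ?nrm_ge0 // expr1n nrmsq !reimE.
by rewrite expr0n add0r expr1n.
Qed.

Lemma rcont_cis : rcont cis.
Proof. by apply: rcont_mk; [exact: continuous_cos|exact: continuous_sin]. Qed.

Lemma cprim_cis : cprim (fun t => imu * cis t) cis.
Proof.
move=> x _; rewrite !reimE; split.
  by rewrite mul0r sub0r mul1r; exact: is_derive_cos.
by rewrite mul0r add0r mul1r; exact: is_derive_sin.
Qed.

Lemma cis0 : cis 0 = 1.
Proof. by apply: cplx_eq; rewrite !reimE ?cos0 ?sin0. Qed.
Lemma cis2pi : cis (2 * pi) = 1.
Proof. by rewrite mulr_natl; apply: cplx_eq; rewrite !reimE ?cos2pi ?sin2pi. Qed.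

Lemma pi2_window : (0 : R) <= 2 * @pi R < 8.
Proof. by have := @pihalf_lt2 R; have := @pi_ge0 R; move=> *; apply/andP; split; lra. Qed.

Lemma cis_lip s t : cmod (cis t - cis s) <= 2 * `|t - s|.
Proof.
have lip (f f' : R -> R) : (forall x : R, is_derive x (1 : R) f (f' x)) -> (forall x, `|f' x| <= 1) ->
   forall s t, `|f t - f s| <= `|t - s|.
  move=> df f1 u v; wlog uv : u v / u <= v.
    by move=> W; have [/W//|/ltW/W] := leP u v; rewrite distrC (distrC u).
  have [|c _ ->] := @MVT_segment R f f' u v uv (fun x _ => df x).
    apply: continuous_subspaceT => x; have [dx _] := df x.
    by apply: differentiable_continuous; apply/derivable1_diffP.
  by rewrite normrM ler_piMl.
apply: le_trans (nrm_le _) _; rewrite !reimE mulr_natl mulr2n; apply: lerD.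
  apply: (lip cos (fun x => - sin x) (@is_derive_cos R)) => x.
  by rewrite normrN sin_max.
exact: (lip sin cos (@is_derive_sin R) (@cos_max R)).
Qed.

Variable z : C.
Hypothesis z1 : cmod z < 1.

Lemma cis_sub_neq0 t : cis t - z != 0.
Proof. by apply/eqP => /eqP; rewrite subr_eq0 => /eqP E; move: z1; rewrite -E nrm_cis ltxx. Qed.

(* [phi(w) dw / (w - z)] pulled back along [w = z + t (e^(i th) - z)] is
   [phi(w) (kern(th) dth + dt / t)]; its circulation [bdry] vanishes on rectangles
   with [t >= eta > 0], so Goursat's argument meets no exceptional point. *)
Definition kern t : C := imu * cis t / (cis t - z).

Lemma rcont_kern : rcont kern.
Proof.
apply: rcontM; first by apply: rcontM; [exact: rcont_cst|exact: rcont_cis].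
apply: rcontV; last exact: cis_sub_neq0.
by apply: rcontB; [exact: rcont_cis|exact: rcont_cst].
Qed.

Lemma nrm_kern t : cmod (kern t) <= (1 - cmod z)^-1.
Proof.
rewrite /kern !nrmM nrm_imu nrm_cis !mul1r nrmV lef_pV2 ?posrE ?subr_gt0 ?nrm_gt0 ?cis_sub_neq0 //.
rewrite lerBlDr -(nrm_cis t) -{1}(subrK z (cis t)); exact: nrmD.
Qed.

Variable phi : C -> C.
Hypothesis dphi : forall x, cmod x <= 1 -> exists a, cder phi x a.

Section Eta.
Variable eta : R.
Hypothesis eta01 : 0 < eta < 1.

(** Truncation to [[eta, 1]] makes [hom] and [1 / t] continuous on the whole line, as [rcont]
    requires, without changing them on the rectangle of integration. *)
Definition clamp (t : R) := Num.max eta (Num.min t 1).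
Lemma clampP t : eta <= clamp t <= 1.
Proof.
by have /andP[_ /ltW e1] := eta01; rewrite /clamp le_max lexx /= ge_max e1 ge_min lexx orbT.
Qed.
Lemma clampE t : eta <= t <= 1 -> clamp t = t.
Proof. by move=> /andP[h1 h2]; rewrite /clamp (min_l h2) (max_r h1). Qed.
Lemma rcont_clamp : rcont (fun t => ofr (clamp t)).
Proof.
apply: rcont_ofr; apply: rcont_real => x e e0; exists e => // y.
apply: le_lt_trans; rewrite /clamp.
have lmax (a u v : R) : `|Num.max a u - Num.max a v| <= `|u - v|.
  have n1 := ler_norm (u - v); have n2 := ler_norm (v - u); rewrite distrC in n2.
  by case: (ltP a u) => ?; case: (ltP a v) => ?; rewrite ?subrr ?normr0 // ler_norml; apply/andP; split; lra.
have lmin (a u v : R) : `|Num.min u a - Num.min v a| <= `|u - v|.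
  have n1 := ler_norm (u - v); have n2 := ler_norm (v - u); rewrite distrC in n2.
  by case: (ltP u a) => ?; case: (ltP v a) => ?; rewrite ?subrr ?normr0 // ler_norml; apply/andP; split; lra.
exact: le_trans (lmax _ _ _) (lmin _ _ _).
Qed.

Definition hom t th : C := z + ofr (clamp t) * (cis th - z).

Lemma nrm_hom t th : cmod (hom t th) <= 1.
Proof.
have /andP[c1 c2] := clampP t; have /andP[e0 _] := eta01.
have -> : hom t th = ofr (1 - clamp t) * z + ofr (clamp t) * cis th.
  by rewrite /hom ofrB ofr1; ring.
apply: le_trans (nrmD _ _) _; rewrite !nrmM nrm_cis mulr1 !nrm_ofr !ger0_norm //; try lra.
have : (1 - clamp t) * cmod z <= (1 - clamp t) * 1 by rewrite ler_wpM2l ?(ltW z1) // subr_ge0.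
lra.
Qed.

Lemma phi_cont x : cmod x <= 1 -> {for x, continuous phi}.
Proof. by move=> /dphi[a]; exact: cder_cont. Qed.

Lemma rcont_hom1 t : rcont (fun th => phi (hom t th)).
Proof.
apply: rcont_comp => [|x]; last exact/phi_cont/nrm_hom.
apply: rcontD; first exact: rcont_cst.
apply: rcontM; first exact: rcont_cst.
by apply: rcontB; [exact: rcont_cis|exact: rcont_cst].
Qed.
Lemma rcont_hom2 th : rcont (fun t => phi (hom t th)).
Proof.
apply: rcont_comp => [|x]; last exact/phi_cont/nrm_hom.
apply: rcontD; first exact: rcont_cst.
by apply: rcontM; [exact: rcont_clamp|exact: rcont_cst].
Qed.
Lemma rcont_clampV : rcont (fun t => (ofr (clamp t))^-1).
Proof.
apply: rcontV; first exact: rcont_clamp.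
move=> x; rewrite ofr_eq0 gt_eqF //.
by have /andP[c1 c2] := clampP x; have /andP[e0 _] := eta01; lra.
Qed.

Definition side1 b a th := (phi (hom b th) - phi (hom a th)) * kern th.
Definition side2 d c t := (phi (hom t d) - phi (hom t c)) * (ofr (clamp t))^-1.
Lemma rcont_side1 b a : rcont (side1 b a).
Proof. by apply: rcontM; [apply: rcontB; exact: rcont_hom1|exact: rcont_kern]. Qed.
Lemma rcont_side2 d c : rcont (side2 d c).
Proof. by apply: rcontM; [apply: rcontB; exact: rcont_hom2|exact: rcont_clampV]. Qed.

Definition bdry a b c d := cint (side1 b a) c d - cint (side2 d c) a b.

(** Near [hom p q] the function [phi] is affine up to an error [rho]. The affine part contributes
    [B * (y - x) * (cis t - cis s)] to both integrals and cancels, because there the kernels have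
    explicit primitives; [rho] contributes an amount quadratic in the half-perimeter with a small
    factor. *)
Lemma bdry0 : bdry eta 1 0 (2 * pi) = 0.
Proof.
have /andP[e0 e1] := eta01; have /andP[p0 p8] := pi2_window.
apply: bisection => //; first exact: ltW.
- move=> x m y s t ax xm my yb cs st td; rewrite /bdry.
  have -> : side1 y x = fun th => side1 m x th + side1 y m th.
    by apply: funext => th; rewrite /side1; ring.
  rewrite cintD; [|exact: rcont_side1|exact: rcont_side1|lra|lra].
  by rewrite (cint_chasles _ x m y); ring.
- move=> x y s m t ax xy yb cs sm mt td; rewrite /bdry.
  have -> : side2 t s = fun u => side2 m s u + side2 t m u.
    by apply: funext => u; rewrite /side2; ring.
  rewrite cintD; [|exact: rcont_side2|exact: rcont_side2|lra|lra].
  by rewrite (cint_chasles _ s m t); ring.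
move=> p q pab qcd e e0'.
have [B dB] := dphi (nrm_hom p q).
pose K := (1 - cmod z)^-1; have K0 : 0 < K by rewrite invr_gt0 subr_gt0.
have ei : 0 < eta^-1 by rewrite invr_gt0.
have Ke : 0 < K + eta^-1 by exact: addr_gt0.
(* The two error integrals are at most [8 * e' * l ^+ 2 * K] and [8 * e' * l ^+ 2 * eta^-1], with
   sum [e * l ^+ 2]. The radius [dl / 4] below ensures [2 * l < dl], where [2 * l] bounds the
   displacement of [hom]. *)
pose e' := e / (8 * (K + eta^-1)).
have e'0 : 0 < e' by rewrite divr_gt0 // mulr_gt0.
have [dl dl0 H] := dB e' e'0.
exists (dl / 4); first by rewrite divr_gt0.
move=> x y s t ax xp py yb cs sq qt td yx ts.
set l := y - x + (t - s).
have l0 : 0 <= l by rewrite /l; lra.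
have cx : clamp x = x by apply: clampE; lra.
have cy : clamp y = y by apply: clampE; lra.
pose rho w := phi w - phi (hom p q) - B * (w - hom p q).
have rhoP u v : x <= u <= y -> s <= v <= t -> cmod (rho (hom u v)) <= e' * (2 * l).
  move=> /andP[xu uy] /andP[sv vt].
  have hl : cmod (hom u v - hom p q) <= 2 * l.
    have -> : hom u v - hom p q = ofr (u - p) * (cis v - z) + ofr p * (cis v - cis q).
      rewrite /hom !clampE ?ofrB; [ring|lra|lra].
    apply: le_trans (nrmD _ _) _; rewrite !nrmM !nrm_ofr.
    have h1 : cmod (cis v - z) <= 2.
      by apply: le_trans (nrmB _ _) _; rewrite nrm_cis; have := z1; lra.
    have h2 := cis_lip q v.
    have h3 : `|p| <= 1 by rewrite ler_norml; lra.
    have h4 : `|u - p| <= y - x by rewrite ler_norml; lra.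
    have h5 : `|v - q| <= t - s by rewrite ler_norml; lra.
    have h6 := ler_pM (normr_ge0 _) (nrm_ge0 _) h4 h1.
    have h7 := ler_pM (normr_ge0 _) (nrm_ge0 _) h3 h2.
    rewrite /l; lra.
  have := H (hom u v - hom p q).
  rewrite [hom p q + _]addrC subrK => H'; apply: le_trans (H' _) _.
    by apply: le_lt_trans hl _; rewrite /l; lra.
  by rewrite ler_wpM2l // ltW.
have sw : -1 < s < 8 by lra.
have tw : -1 < t < 8 by lra.
have xw : -1 < x < 8 by lra.
have yw : -1 < y < 8 by lra.
pose g1 th := (B * ofr (y - x)) * (imu * cis th).
have P1 : cprim g1 (fun th => (B * ofr (y - x)) * cis th) by apply: cprimZ; exact: cprim_cis.
have rg1 : rcont g1.
  apply: rcontM; first exact: rcont_cst.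
  by apply: rcontM; [exact: rcont_cst|exact: rcont_cis].
pose g2 (u : R) := (B * (cis t - cis s)).
have P2 : cprim g2 (fun u => (B * (cis t - cis s)) * ofr u).
  rewrite (_ : g2 = fun u => (B * (cis t - cis s)) * 1); last by apply: funext => u; rewrite /g2; ring.
  apply: cprimZ => u _; split; first exact: is_derive_id.
  exact: is_derive_cst.
have rg2 : rcont g2 by exact: rcont_cst.
have E1 : cint (side1 y x) s t = cint (fun th => side1 y x th - g1 th) s t
  + (B * ofr (y - x)) * (cis t - cis s).
  rewrite cintB //; last exact: rcont_side1.
  by rewrite (cintE P1) //; ring.
have E2 : cint (side2 t s) x y = cint (fun th => side2 t s th - g2 th) x y
  + (B * ofr (y - x)) * (cis t - cis s).
  rewrite cintB //; last exact: rcont_side2.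
  by rewrite (cintE P2) // ofrB; ring.
rewrite /bdry E1 E2.
set I1 := cint _ s t; set I2 := cint _ x y.
rewrite (_ : _ - _ = I1 - I2); last by ring.
have n1 : cmod I1 <= 2 * (e' * (4 * l) * K) * (t - s).
  apply: cint_bound; [by apply: rcontB => //; exact: rcont_side1|lra|lra|lra|].
  move=> v sv.
  have -> : side1 y x v - g1 v = (rho (hom y v) - rho (hom x v)) * kern v.
    rewrite /side1 /g1 /rho /kern /hom cy cx ofrB.
    by field; exact: cis_sub_neq0.
  rewrite nrmM; apply: ler_pM; rewrite ?nrm_ge0 //; last exact: nrm_kern.
  apply: le_trans (nrmB _ _) _.
  have h1 : cmod (rho (hom y v)) <= e' * (2 * l) by apply: rhoP => //; lra.
  have h2 : cmod (rho (hom x v)) <= e' * (2 * l) by apply: rhoP => //; lra.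
  by lra.
have n2 : cmod I2 <= 2 * (e' * (4 * l) * eta^-1) * (y - x).
  apply: cint_bound; [by apply: rcontB => //; exact: rcont_side2|lra|lra|lra|].
  move=> u xu.
  have cu : clamp u = u by apply: clampE; lra.
  have u0 : 0 < u by lra.
  have -> : side2 t s u - g2 u = (rho (hom u t) - rho (hom u s)) * (ofr u)^-1.
    rewrite /side2 /g2 /rho /hom !cu.
    by field; rewrite ofr_eq0 gt_eqF.
  rewrite nrmM; apply: ler_pM; rewrite ?nrm_ge0 //.
    apply: le_trans (nrmB _ _) _.
    have h1 : cmod (rho (hom u t)) <= e' * (2 * l) by apply: rhoP => //; lra.
    have h2 : cmod (rho (hom u s)) <= e' * (2 * l) by apply: rhoP => //; lra.
    by lra.
  rewrite nrmV nrm_ofr ger0_norm ?(ltW u0) // lef_pV2 ?posrE //; lra.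
apply: le_trans (nrmB _ _) _.
have el0 : 0 <= e' * (4 * l) by rewrite mulr_ge0 ?(ltW e'0) // mulr_ge0.
have n1' : cmod I1 <= 2 * (e' * (4 * l) * K) * l.
  apply: le_trans n1 _; rewrite ler_wpM2l //; last by rewrite /l; lra.
  by rewrite mulr_ge0 // mulr_ge0 // ltW.
have n2' : cmod I2 <= 2 * (e' * (4 * l) * eta^-1) * l.
  apply: le_trans n2 _; rewrite ler_wpM2l //; last by rewrite /l; lra.
  by rewrite mulr_ge0 // mulr_ge0 // ltW // invr_gt0.
apply: le_trans (lerD n1' n2') _.
rewrite le_eqVlt; apply/orP; left; apply/eqP; rewrite /e'.
by field; rewrite !gt_eqF //; have := mulr_gt0 K0 e0; lra.
Qed.

(** The sides [th = 0] and [th = 2 * pi] of the rectangle are mapped to the same segment, so [side2]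
    vanishes and only the outer and inner circles remain. *)
Lemma cauchy_eta : cint (fun th => (phi (cis th) - phi (z + ofr eta * (cis th - z))) * kern th) 0 (2 * pi) = 0.
Proof.
have := bdry0; rewrite /bdry.
have -> : side2 (2 * pi) 0 = fun t => 0 * 0.
  by apply: funext => t; rewrite /side2 /hom cis2pi cis0 subrr !mul0r.
have /andP[p0 p8] := pi2_window; have /andP[e0 e1] := eta01.
rewrite (cintZ 0 (rcont_cst 0)) ?mul0r ?subr0; [|lra|lra].
move=> <-; congr cint; apply: funext => th; rewrite /side1 /hom !clampE; [|lra|lra].
by rewrite ofr1 mul1r [z + (_ - z)]addrC subrK.
Qed.

End Eta.
(** Limit of [cauchy_eta] as [eta] tends to 0: the inner circle shrinks to [z], where continuity of
    [phi] suffices since [kern] is bounded independently of [eta]. *)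
Lemma cauchy0 : cint (fun th => (phi (cis th) - phi z) * kern th) 0 (2 * pi) = 0.
Proof.
have /andP[p0 p8] := pi2_window.
apply/eqP; rewrite -nrm_eq0 eq_le nrm_ge0 andbT; apply/ler_addgt0Pl => e e0.
rewrite addr0.
pose K := (1 - cmod z)^-1; have K0 : 0 < K by rewrite invr_gt0 subr_gt0.
have z1' := ltW z1.
have /continuous_nrm/(_ (e / (32 * K))) := phi_cont z1'.
case; first by rewrite divr_gt0 // mulr_gt0.
move=> d d0 H.
pose eta := Num.min (1 / 2) (d / 4).
have eta01 : 0 < eta < 1.
  by rewrite lt_min divr_gt0 //= divr_gt0 //= gt_min; apply/orP; left; lra.
have eta2 : eta <= 1 / 2 /\ eta <= d / 4 by rewrite !ge_min !lexx orbT.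
have dec th : hom eta eta th = z + ofr eta * (cis th - z).
  by rewrite /hom clampE //; lra.
have r1 : rcont (fun th => (phi (cis th) - phi z) * kern th).
  apply: rcontM; last exact: rcont_kern.
  apply: rcontB; last exact: rcont_cst.
  apply: rcont_comp; first exact: rcont_cis.
  by move=> x; apply: phi_cont; rewrite nrm_cis.
have r2 : rcont (fun th => (phi (cis th) - phi (z + ofr eta * (cis th - z))) * kern th).
  apply: rcontM; last exact: rcont_kern.
  apply: rcontB; first by apply: rcont_comp; [exact: rcont_cis|move=> x; apply: phi_cont; rewrite nrm_cis].
  have := @rcont_hom1 _ eta01 eta; congr rcont; apply: funext => th; by rewrite dec.
have := cintB r1 r2 (a := 0) (b := 2 * pi); rewrite cauchy_eta // subr0 => <-; [|lra|lra].
apply: le_trans (@cint_bound _ _ _ _ (e / (32 * K) * K) (rcontB r1 r2) _ _ _ _) _; [lra|lra|lra| |].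
  move=> th _.
  have -> : (phi (cis th) - phi z) * kern th - (phi (cis th) - phi (z + ofr eta * (cis th - z))) * kern th
     = (phi (z + ofr eta * (cis th - z)) - phi z) * kern th by ring.
  rewrite nrmM; apply: ler_pM; rewrite ?nrm_ge0 //; last exact: nrm_kern.
  apply: ltW; apply: H; rewrite addrC addKr nrmM nrm_ofr.
  have h1 : cmod (cis th - z) <= 2.
    by apply: le_trans (nrmB _ _) _; rewrite nrm_cis; have := z1; lra.
  have h2 : `|eta| <= d / 4 by rewrite ger0_norm; lra.
  have := ler_pM (normr_ge0 _) (nrm_ge0 _) h2 h1; lra.
rewrite (_ : e / (32 * K) * K = e / 32); last by field; rewrite gt_eqF.
have : e / 32 * (2 * pi - 0) <= e / 32 * 8 by rewrite ler_wpM2l ?divr_ge0 ?(ltW e0) //; lra.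
lra.
Qed.

End Cauchy.

(** * Means over the unit circle and Taylor coefficients *)

Section Mean.
Variable R : realType.
Local Notation C := (CC R).

Definition circ (F : C -> C) := rcont (fun t => F (cis t)).
Definition mean (F : C -> C) : C := (ofr (2 * pi))^-1 * cint (fun t => F (cis t)) 0 (2 * pi).

Lemma pi2_gt0 : 0 < 2 * pi :> R. Proof. by rewrite mulr_gt0 // pi_gt0. Qed.
Lemma pi2_neq0 : ofr (2 * pi) != 0 :> C.
Proof. by rewrite ofr_eq0 gt_eqF // pi2_gt0. Qed.
Lemma win0 : -1 < (0 : R) < 8. Proof. by apply/andP; split; lra. Qed.
Lemma win1 : -1 < 2 * @pi R < 8.
Proof. by have /andP[] := @pi2_window R => *; apply/andP; split; lra. Qed.

Lemma meanD F G : circ F -> circ G -> mean (fun x => F x + G x) = mean F + mean G.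
Proof. by move=> HF HG; rewrite /mean cintD ?win0 ?win1 // mulrDr. Qed.
Lemma meanB F G : circ F -> circ G -> mean (fun x => F x - G x) = mean F - mean G.
Proof. by move=> HF HG; rewrite /mean cintB ?win0 ?win1 // mulrBr. Qed.
Lemma meanZ c F : circ F -> mean (fun x => c * F x) = c * mean F.
Proof. by move=> HF; rewrite /mean cintZ ?win0 ?win1 // mulrCA. Qed.
Lemma mean_conj F : circ F -> mean (fun x => conjc (F x)) = conjc (mean F) :> C.
Proof.
move=> HF; rewrite /mean cint_conj ?win0 ?win1 //.
apply: cplx_eq; rewrite -ofrV; case: (cint _ _ _) => a b; rewrite !reimE /cre /cim /=; ring.
Qed.
Lemma eq_mean F G : (forall x, cmod x = 1 -> F x = G x) -> mean F = mean G.
Proof.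
move=> H; rewrite /mean; congr (_ * cint _ _ _); apply: funext => t.
by apply: H; exact: nrm_cis.
Qed.
Lemma mean_bound F M : circ F -> (forall x, cmod x = 1 -> cmod (F x) <= M) -> cmod (mean F) <= 2 * M.
Proof.
move=> HF H; rewrite /mean nrmM nrmV nrm_ofr ger0_norm ?(ltW pi2_gt0) //.
rewrite ler_pdivrMl ?pi2_gt0 //.
have /andP[p0 p8] := @pi2_window R.
have h : cmod (cint (fun t => F (cis t)) 0 (2 * pi)) <= 2 * M * (2 * pi - 0).
  apply: cint_bound; [exact: HF|lra|exact: p8|exact: p0|].
  by move=> t _; apply: H; exact: nrm_cis.
by rewrite subr0 [leRHS]mulrC in h.
Qed.
Lemma mean_ge0 F : circ F -> (forall x, cmod x = 1 -> 0 <= cre (F x)) -> 0 <= cre (mean F).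
Proof.
move=> HF H; rewrite /mean -ofrV creM cre_ofr cim_ofr mul0r subr0.
have /andP[p0 p8] := @pi2_window R.
rewrite mulr_ge0 ?invr_ge0 //; apply: cint_re_ge0; [exact: HF|lra|exact: p8|exact: p0|].
by move=> t; apply: H; exact: nrm_cis.
Qed.

Lemma circ_cst c : circ (fun=> c). Proof. exact: rcont_cst. Qed.
Lemma circ_id : circ id. Proof. exact: rcont_cis. Qed.
Lemma circD F G : circ F -> circ G -> circ (fun x => F x + G x).
Proof. exact: rcontD. Qed.
Lemma circB F G : circ F -> circ G -> circ (fun x => F x - G x).
Proof. exact: rcontB. Qed.
Lemma circM F G : circ F -> circ G -> circ (fun x => F x * G x).
Proof. exact: rcontM. Qed.
Lemma circX F n : circ F -> circ (fun x => F x ^+ n).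
Proof. exact: rcontX. Qed.
Lemma circ_conj F : circ F -> circ (fun x => conjc (F x) : C).
Proof. exact: rcont_conj. Qed.
Lemma circV F : circ F -> (forall x, cmod x = 1 -> F x != 0) -> circ (fun x => (F x)^-1).
Proof. by move=> HF H; apply: rcontV => // t; apply: H; exact: nrm_cis. Qed.
Lemma circ_inv : circ (fun x => x^-1).
Proof. by apply: circV; [exact: circ_id|move=> x x1; rewrite -nrm_gt0 x1 ltr01]. Qed.

(** Differentiability is asked at every point of the closed disc, as a function on the plane, so
    boundary values involve no limit. A function on the open disc is first restricted to a smaller
    radius and rescaled. *)
Definition hdisc (phi : C -> C) := forall x, cmod x <= 1 -> exists a, cder phi x a.

Lemma hdisc_circ phi : hdisc phi -> circ phi.
Proof.
move=> H; apply: rcont_comp; first exact: rcont_cis.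
by move=> t; have [|a] := H (cis t); [rewrite nrm_cis|exact: cder_cont].
Qed.

Lemma hdiscM phi psi : hdisc phi -> hdisc psi -> hdisc (fun x => phi x * psi x).
Proof. by move=> H1 H2 x x1; have [a Ha] := H1 x x1; have [b Hb] := H2 x x1; eexists; exact: cderM Ha Hb. Qed.
Lemma hdiscD phi psi : hdisc phi -> hdisc psi -> hdisc (fun x => phi x + psi x).
Proof. by move=> H1 H2 x x1; have [a Ha] := H1 x x1; have [b Hb] := H2 x x1; eexists; exact: cderD Ha Hb. Qed.
Lemma hdisc_cst c : hdisc (fun=> c).
Proof. by move=> x _; eexists; exact: cder_cst. Qed.
Lemma hdisc_id : hdisc id.
Proof. by move=> x _; eexists; exact: cder_id. Qed.
Lemma hdiscX phi n : hdisc phi -> hdisc (fun x => phi x ^+ n).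
Proof. by move=> H1 x x1; have [a Ha] := H1 x x1; eexists; exact: cderX Ha. Qed.

Lemma circ_cauchy (z : C) : cmod z < 1 -> circ (fun x => x / (x - z)).
Proof.
move=> z1; apply: circM; first exact: circ_id.
apply: circV; first by apply: circB; [exact: circ_id|exact: circ_cst].
by move=> x x1; rewrite subr_eq0; apply: contraTN z1 => /eqP <-; rewrite x1 ltxx.
Qed.

(** The mean of the kernel is left unevaluated here. For [z = 0] the kernel is the constant 1, which
    gives the mean value property; [mean_kernel] then obtains the other values by conjugation. *)
Lemma mean_cauchy_sub phi z : hdisc phi -> cmod z < 1 ->
  mean (fun x => phi x * (x / (x - z))) = phi z * mean (fun x => x / (x - z)).
Proof.
move=> H z1; apply/eqP; rewrite -subr_eq0 -meanZ; last exact: circ_cauchy.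
rewrite -meanB; last 2 first.
- by apply: circM; [exact: hdisc_circ|exact: circ_cauchy].
- by apply: circM; [exact: circ_cst|exact: circ_cauchy].
have := cauchy0 z1 H.
rewrite (_ : (fun _ => _) = (fun th => imu R * ((phi (cis th) - phi z) * (cis th / (cis th - z))))).
  rewrite cintZ ?win0 ?win1 //; last first.
    apply: (@circM (fun x => phi x - phi z) (fun x => x / (x - z))); last exact: circ_cauchy.
    by apply: circB; [exact: hdisc_circ|exact: circ_cst].
  move=> /eqP; rewrite mulf_eq0 => /predU1P[|/eqP E].
    by move=> /eqP; rewrite -nrm_eq0 nrm_imu oner_eq0.
  rewrite /mean (_ : (fun t => _) = (fun th => (phi (cis th) - phi z) * (cis th / (cis th - z)))).
    by rewrite E mulr0.
  by apply: funext => t; ring.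
by apply: funext => t; rewrite /kern; ring.
Qed.

Lemma mean_cst c : mean (fun=> c) = c.
Proof.
have P2 : cprim (fun t => c) (fun t : R => c * ofr t).
  rewrite (_ : (fun t => c) = fun t => c * 1); last by apply: funext => t; rewrite mulr1.
  by apply: cprimZ => u _; split; [exact: is_derive_id|exact: is_derive_cst].
rewrite /mean (cintE P2) ?win0 ?win1 // ofr0 mulr0 subr0.
by rewrite mulrCA mulVf ?mulr1 // pi2_neq0.
Qed.

Lemma mean_val0 phi : hdisc phi -> mean phi = phi 0.
Proof.
move=> H; have := @mean_cauchy_sub phi 0 H; rewrite nrm0 => /(_ ltr01).
rewrite (@eq_mean _ phi); last first.
  by move=> x x1; rewrite subr0 divff ?mulr1 // -nrm_gt0 x1 ltr01.
rewrite (@eq_mean (fun x => x / _) (fun=> 1)) ?mean_cst ?mulr1 //.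
by move=> x x1; rewrite subr0 divff // -nrm_gt0 x1 ltr01.
Qed.

Lemma conj_circ (x : C) : cmod x = 1 -> conjc x = x^-1 :> C.
Proof.
move=> x1; have x0 : x != 0 by rewrite -nrm_gt0 x1 ltr01.
apply: (mulfI x0); rewrite divff //; apply: cplx_eq; move: (nrmsq x); rewrite x1 expr1n.
  by case: x {x0 x1} => a b; rewrite !reimE /cre /cim /= => ->; ring.
by move=> _; case: x {x0 x1} => a b; rewrite !reimE /cre /cim /=; ring.
Qed.

Lemma conjM (a b : C) : conjc (a * b) = conjc a * conjc b :> C.
Proof. by case: a b => [a1 a2] [b1 b2]; apply: cplx_eq; rewrite !reimE /cre /cim /=; ring. Qed.
Lemma conjB (a b : C) : conjc (a - b) = conjc a - conjc b :> C.
Proof. by case: a b => [a1 a2] [b1 b2]; apply: cplx_eq; rewrite !reimE /cre /cim /=; ring. Qed.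
Lemma conjD (a b : C) : conjc (a + b) = conjc a + conjc b :> C.
Proof. by case: a b => [a1 a2] [b1 b2]; apply: cplx_eq; rewrite !reimE /cre /cim /=; ring. Qed.
Lemma conjK (a : C) : conjc (conjc a) = a :> C.
Proof. by case: a => a b; apply: cplx_eq; rewrite /cre /cim /=; ring. Qed.
Lemma nrm_conj (a : C) : cmod (conjc a) = cmod a.
Proof.
apply/eqP; rewrite -(@eqrXn2 _ 2) ?nrm_ge0 // !nrmsq.
by case: a => a b; rewrite /cre /cim /= sqrrN.
Qed.
Lemma conj_sq (a : C) : a * conjc a = ofr (cmod a ^+ 2).
Proof. by rewrite nrmsq; case: a => a b; apply: cplx_eq; rewrite !reimE /cre /cim /=; ring. Qed.
Lemma conj1 : conjc (1 : C) = 1 :> C.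
Proof. by apply: cplx_eq; rewrite !reimE /cre /cim /= ?oppr0. Qed.
Lemma conjV (a : C) : conjc (a^-1) = (conjc a)^-1 :> C.
Proof.
have [->|a0] := eqVneq a 0.
  by rewrite invr0 (_ : conjc 0 = 0 :> C) ?invr0 //; apply: cplx_eq; rewrite /cre /cim /= ?oppr0.
have c0 : (conjc a : C) != 0 by rewrite -nrm_gt0 nrm_conj nrm_gt0.
by apply: (mulfI c0); rewrite -conjM !divff // conj1.
Qed.
Lemma conjX (a : C) n : conjc (a ^+ n) = conjc a ^+ n :> C.
Proof. by elim: n => [|n IH]; rewrite ?expr0 ?conj1 // !exprS conjM IH. Qed.

(* On the circle the conjugate of the kernel is [1 / (1 - conj(z) x)], which is
   holomorphic in the disc. *)
Lemma mean_kernel z : cmod z < 1 -> mean (fun x => x / (x - z)) = 1.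
Proof.
move=> z1; have z1' : cmod (conjc z) < 1 by rewrite nrm_conj.
have nz x : cmod x <= 1 -> 1 - conjc z * x != 0 :> C.
  move=> x1; rewrite subr_eq0; apply/eqP => E.
  have := nrm1 R; rewrite E nrmM => E1.
  have := ler_pM (nrm_ge0 _) (nrm_ge0 _) (lexx (cmod (conjc z))) x1.
  by rewrite E1 mulr1 leNgt z1'.
have H : hdisc (fun x => (1 - conjc z * x)^-1).
  move=> x x1; eexists; apply: cderV; first exact: nz.
  by apply: cderB; [exact: cder_cst|apply: cderM; [exact: cder_cst|exact: cder_id]].
rewrite -[LHS]conjK -mean_conj; last exact: circ_cauchy.
rewrite (@eq_mean _ (fun x => (1 - conjc z * x)^-1)).
  by rewrite mean_val0 // mulr0 subr0 invr1 conj1.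
move=> x x1; have x0 : x != 0 by rewrite -nrm_gt0 x1 ltr01.
rewrite conjM conjV conjB conj_circ // -invfM; congr (_^-1).
by rewrite mulrBr divff // mulrC.
Qed.

Lemma mean_cauchy phi z : hdisc phi -> cmod z < 1 ->
  mean (fun x => phi x * (x / (x - z))) = phi z.
Proof. by move=> H z1; rewrite mean_cauchy_sub // mean_kernel // mulr1. Qed.

Definition coef phi j := mean (fun x => phi x * x^-1 ^+ j).

Lemma circ_coef phi j : circ phi -> circ (fun x => phi x * x^-1 ^+ j).
Proof. by move=> H; apply: circM => //; apply: circX; exact: circ_inv. Qed.

Lemma coef_bound phi M j : circ phi -> (forall x, cmod x = 1 -> cmod (phi x) <= M) ->
  cmod (coef phi j) <= 2 * M.
Proof.
move=> H HM; apply: mean_bound; first exact: circ_coef.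
by move=> x x1; rewrite nrmM nrmX nrmV x1 invr1 expr1n mulr1; exact: HM.
Qed.

(** Each use of [x / (x - z) = 1 + z * x^-1 * (x / (x - z))] under the mean splits off one
    coefficient, so the remainder is exact and no series is summed. *)
Lemma taylor_rem phi z m : hdisc phi -> cmod z < 1 ->
  phi z - \sum_(j < m) coef phi j * z ^+ j =
  z ^+ m * mean (fun x => (phi x * x^-1 ^+ m) * (x / (x - z))).
Proof.
move=> H z1; elim: m => [|m IH].
  rewrite big_ord0 subr0 expr0 mul1r -{1}(mean_cauchy H z1).
  by apply: eq_mean => x _; rewrite expr0 mulr1.
rewrite big_ord_recr /= opprD addrA IH.
rewrite (@eq_mean _ (fun x => phi x * x^-1 ^+ m + z * ((phi x * x^-1 ^+ m.+1) * (x / (x - z))))).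
  rewrite meanD; last 2 first.
  - exact/circ_coef/hdisc_circ.
  - apply: circM; first exact: circ_cst.
    by apply: circM; [exact/circ_coef/hdisc_circ|exact: circ_cauchy].
  rewrite meanZ; last by apply: circM; [exact/circ_coef/hdisc_circ|exact: circ_cauchy].
  by rewrite exprSr /coef; ring.
move=> x x1; have x0 : x != 0 by rewrite -nrm_gt0 x1 ltr01.
have xz : x - z != 0.
  by rewrite subr_eq0; apply: contraTN z1 => /eqP <-; rewrite x1 ltxx.
by rewrite exprS; field; rewrite xz x0.
Qed.

Lemma taylor_disc phi z m M : hdisc phi -> cmod z < 1 -> (forall x, cmod x = 1 -> cmod (phi x) <= M) ->
  cmod (phi z - \sum_(j < m) coef phi j * z ^+ j) <= 2 * M * cmod z ^+ m / (1 - cmod z).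
Proof.
move=> H z1 HM; rewrite taylor_rem // nrmM nrmX.
rewrite (_ : 2 * M * cmod z ^+ m / (1 - cmod z) = cmod z ^+ m * (2 * (M * (1 - cmod z)^-1))); last by ring.
apply: ler_wpM2l; first by rewrite exprn_ge0 ?nrm_ge0.
apply: mean_bound; first by apply: circM; [exact/circ_coef/hdisc_circ|exact: circ_cauchy].
move=> x x1; have xz : x - z != 0.
  by rewrite subr_eq0; apply: contraTN z1 => /eqP <-; rewrite x1 ltxx.
rewrite !nrmM nrmX !nrmV x1 invr1 expr1n mulr1 mul1r; apply: ler_pM; rewrite ?nrm_ge0 ?invr_ge0 ?nrm_ge0 ?HM //.
rewrite lef_pV2 ?posrE ?subr_gt0 ?nrm_gt0 //.
by rewrite lerBlDr -x1 -{1}(subrK z x); exact: nrmD.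
Qed.

Lemma mean_inv k : (0 < k)%N -> mean (fun x => x^-1 ^+ k) = 0.
Proof.
move=> k0; rewrite (@eq_mean _ (fun x => conjc (x ^+ k))); last first.
  by move=> x x1; rewrite conjX conj_circ.
rewrite mean_conj; last exact/circX/circ_id.
rewrite mean_val0; last exact/hdiscX/hdisc_id.
by rewrite expr0n eqn0Ngt k0; apply: cplx_eq; rewrite /cre /cim /= ?oppr0.
Qed.

(* The mean of the square of [F - c_0 - c_k x^k]; Bessel's inequality is its positivity. *)
Lemma mean_sq F k : circ F -> (0 < k)%N ->
  let G x := F x - coef F 0 - coef F k * x ^+ k in
  mean (fun x => G x * conjc (G x)) = mean (fun x => F x * conjc (F x)) -
    ofr (cmod (coef F 0) ^+ 2) - ofr (cmod (coef F k) ^+ 2).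
Proof.
move=> HF k0 G; set c0 := coef F 0; set ck := coef F k.
pose U x := (conjc c0 : C) * (F x * x^-1 ^+ 0) + (conjc ck : C) * (F x * x^-1 ^+ k) - (c0 * conjc ck) * x^-1 ^+ k.
have cF j : circ (fun x => F x * x^-1 ^+ j) by exact: circ_coef.
have cx : circ (fun x => x^-1 ^+ k) by exact/circX/circ_inv.
have cU : circ U.
  by apply: circB; [apply: circD|]; apply: circM => //; exact: circ_cst.
have cU1 : circ (fun x => (conjc c0 : C) * (F x * x^-1 ^+ 0)) by apply: circM => //; exact: circ_cst.
have cU2 : circ (fun x => (conjc ck : C) * (F x * x^-1 ^+ k)) by apply: circM => //; exact: circ_cst.
have cU3 : circ (fun x => (c0 * conjc ck) * x^-1 ^+ k) by apply: circM => //; exact: circ_cst.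
have mU : mean U = ofr (cmod c0 ^+ 2) + ofr (cmod ck ^+ 2).
  rewrite meanB ?meanD //; last exact: circD.
  by rewrite !meanZ // mean_inv // mulr0 subr0 -!conj_sq /c0 /ck /coef; ring.
rewrite (@eq_mean _ (fun x => F x * conjc (F x) - (U x + conjc (U x)) + (ofr (cmod c0 ^+ 2) + ofr (cmod ck ^+ 2)))).
  have cFF : circ (fun x => F x * conjc (F x)) by apply: circM => //; exact: circ_conj.
  have cT : circ (fun x => U x + conjc (U x)) by apply: circD => //; exact: circ_conj.
  rewrite meanD; [|exact: circB|exact: circ_cst].
  rewrite (meanB cFF cT) (meanD cU (circ_conj cU)) (mean_conj cU) mean_cst mU.
  have -> : conjc (ofr (cmod c0 ^+ 2) + ofr (cmod ck ^+ 2)) = ofr (cmod c0 ^+ 2) + ofr (cmod ck ^+ 2) :> C.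
    by apply: cplx_eq; rewrite /cre /cim /= ?addr0 ?oppr0.
  by ring.
move=> x x1; have x0 : x != 0 by rewrite -nrm_gt0 x1 ltr01.
rewrite /G /U -/c0 -/ck; generalize c0 ck (F x) => d0 dk f.
rewrite -!conj_sq !(conjB, conjD, conjM, conjX, conjK, conjV) (conj_circ x1) invrK expr0 mulr1.
rewrite exprVn; have xk : x ^+ k != 0 by rewrite expf_neq0.
by field.
Qed.

(** For the majorant [a + b * x ^+ k] itself the mean square is exactly [|a|^2 + |b|^2]; the
    comparison on the circle passes to mean squares, and two coefficients of [phi] are bounded by
    its mean square. *)
Lemma bessel phi a b k : hdisc phi -> (0 < k)%N ->
  (forall x, cmod x = 1 -> cmod (phi x) <= cmod (a + b * x ^+ k)) ->
  cmod (coef phi 0) ^+ 2 + cmod (coef phi k) ^+ 2 <= cmod a ^+ 2 + cmod b ^+ 2.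
Proof.
move=> H k0 HM; pose P x := a + b * x ^+ k.
have hP : hdisc P.
  by apply: hdiscD; [exact: hdisc_cst|apply: hdiscM; [exact: hdisc_cst|exact/hdiscX/hdisc_id]].
have cP := hdisc_circ hP; have cF := hdisc_circ H.
have cx : circ (fun x => x^-1 ^+ k) by exact/circX/circ_inv.
have cP0 : coef P 0 = a.
  rewrite /coef (@eq_mean _ P); last by move=> x _; rewrite expr0 mulr1.
  by rewrite mean_val0 // /P expr0n eqn0Ngt k0 mulr0 addr0.
have cPk : coef P k = b.
  rewrite /coef (@eq_mean _ (fun x => a * x^-1 ^+ k + b)).
    rewrite meanD ?mean_cst ?meanZ ?mean_inv ?mulr0 ?add0r //; last exact: circ_cst.
    by apply: circM => //; exact: circ_cst.
  move=> x x1; have x0 : x != 0 by rewrite -nrm_gt0 x1 ltr01.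
  by rewrite /P mulrDl -mulrA -exprMn divff // expr1n mulr1.
have ccnj F : circ F -> circ (fun x => F x * conjc (F x)).
  by move=> cF'; apply: circM => //; exact: circ_conj.
have h1 : 0 <= cre (mean (fun x => phi x * conjc (phi x)) -
    ofr (cmod (coef phi 0) ^+ 2) - ofr (cmod (coef phi k) ^+ 2)).
  rewrite -mean_sq //; apply: mean_ge0.
    apply: ccnj; apply: circB; first by apply: circB => //; exact: circ_cst.
    by apply: circM; [exact: circ_cst|exact/circX/circ_id].
  by move=> x _; rewrite conj_sq cre_ofr sqr_ge0.
have h2 : mean (fun x => P x * conjc (P x)) = ofr (cmod a ^+ 2) + ofr (cmod b ^+ 2).
  have := mean_sq cP k0; rewrite cP0 cPk /=.
  rewrite (@eq_mean _ (fun=> 0)) ?mean_cst; last by move=> x _; rewrite /P; ring.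
  by move=> /esym/eqP; rewrite -addrA -opprD subr_eq0 => /eqP.
have h3 : 0 <= cre (mean (fun x => P x * conjc (P x) - phi x * conjc (phi x))).
  apply: mean_ge0; first by apply: circB; exact: ccnj.
  move=> x x1; rewrite !conj_sq creB !cre_ofr subr_ge0.
  by rewrite ler_pXn2r ?nnegrE ?nrm_ge0 // HM.
rewrite meanB ?h2 in h3; [|exact: ccnj..].
move: h1 h3; rewrite !creB creD !cre_ofr; lra.
Qed.

(* Bessel's inequality for [phi * (a + b x^k)], with [b = a c_k conj(c_0) / (1 - |c_0|^2)]. *)
Lemma coef_schwarz phi k : hdisc phi -> (0 < k)%N -> (forall x, cmod x = 1 -> cmod (phi x) <= 1) ->
  cmod (coef phi k) <= 1 - cmod (coef phi 0) ^+ 2.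
Proof.
move=> H k0 HM; have cF := hdisc_circ H.
set c := coef phi 0; set w := coef phi k; set t := cmod c; set s := 1 - t ^+ 2.
have key (a b : C) : cmod (a * c) ^+ 2 + cmod (a * w + b * c) ^+ 2 <= cmod a ^+ 2 + cmod b ^+ 2.
  pose P x := a + b * x ^+ k.
  have hP : hdisc P.
    by apply: hdiscD; [exact: hdisc_cst|apply: hdiscM; [exact: hdisc_cst|exact/hdiscX/hdisc_id]].
  have hx : hdisc (fun x => x ^+ k) by exact/hdiscX/hdisc_id.
  have e1 : coef (fun x => phi x * P x) 0 = a * c.
    rewrite /c /coef (@eq_mean _ (fun x => phi x * P x)); last by move=> x _; rewrite expr0 mulr1.
    rewrite (@eq_mean (fun x => phi x * x^-1 ^+ 0) phi); last by move=> x _; rewrite expr0 mulr1.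
    rewrite !mean_val0 //; last exact: hdiscM.
    by rewrite /P expr0n eqn0Ngt k0 mulr0 addr0 mulrC.
  have e2 : coef (fun x => phi x * P x) k = a * w + b * c.
    rewrite /w /c /coef (@eq_mean _ (fun x => a * (phi x * x^-1 ^+ k) + b * (phi x * x^-1 ^+ 0))).
      have q j : circ (fun x => phi x * x^-1 ^+ j) by exact: circ_coef.
      by rewrite meanD ?meanZ //; apply: circM => //; exact: circ_cst.
    move=> x x1; have x0 : x != 0 by rewrite -nrm_gt0 x1 ltr01.
    rewrite /P expr0 exprVn; have xk : x ^+ k != 0 by rewrite expf_neq0.
    by field.
  rewrite -e1 -e2; apply: (@bessel (fun x => phi x * P x)) => //; first exact: hdiscM.
  by move=> x x1; rewrite nrmM ler_piMl ?nrm_ge0 ?HM.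
have t0 : 0 <= t by exact: nrm_ge0.
have := key 1 0; rewrite !mul1r mul0r addr0 nrm1 nrm0 expr1n expr0n /= addr0 -/t => k1.
clearbody c w.
(* For [s <= 0] the instance [a = 1], [b = 0] of [key] already forces [w = 0]; the choice of [b] in
   the other case divides by [s]. *)
have [s0|s0] := ltP 0 s; last first.
  have : cmod w ^+ 2 <= 0 by move: s0; rewrite /s; lra.
  move=> w2; have /eqP : cmod w ^+ 2 = 0 by apply/eqP; rewrite eq_le w2 sqr_ge0.
  rewrite expf_eq0 /= => /eqP ->; rewrite /s; have := sqr_ge0 (cmod w); lra.
have := key 1 (ofr s^-1 * (w * conjc c)).
rewrite !mul1r nrm1 expr1n -/t.
have -> : w + ofr s^-1 * (w * conjc c) * c = ofr s^-1 * w.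
  have e0 : conjc c * c = ofr (t ^+ 2) :> C by rewrite mulrC conj_sq.
  have -> : w + ofr s^-1 * (w * conjc c) * c = w + ofr s^-1 * (w * (conjc c * c)) by ring.
  rewrite e0.
  have e : 1 + t ^+ 2 * s^-1 = s^-1.
    by rewrite /s; field; rewrite gt_eqF.
  have -> : w + ofr s^-1 * (w * ofr (t ^+ 2)) = w * ofr (1 + t ^+ 2 * s^-1).
    by rewrite ofrD ofr1 ofrM; ring.
  by rewrite e mulrC.
rewrite !nrmM nrm_conj -/t nrm_ofr ger0_norm ?invr_ge0 ?(ltW s0) // => k2.
have k3 : cmod w ^+ 2 * (s^-1 ^+ 2 * s) <= s.
  move: k2; move: (s^-1) => i; rewrite !exprMn.
  have es : s = 1 - t ^+ 2 by [].
  move: es; clearbody s => ->; lra.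
rewrite (_ : s^-1 ^+ 2 * s = s^-1) in k3; last by field; rewrite gt_eqF.
rewrite ler_pdivrMr // in k3.
by rewrite -(@ler_pXn2r _ 2) ?nnegrE ?nrm_ge0 ?(ltW s0) // expr2.
Qed.

Lemma bernoulli (h : R) n : 0 <= h -> 1 + n%:R * h <= (1 + h) ^+ n.
Proof.
move=> h0; elim: n => [|n IH]; first by rewrite mul0r addr0 expr0.
rewrite exprS; apply: le_trans (ler_wpM2l _ IH); last by rewrite addr_ge0.
have : 0 <= n%:R * h * h by rewrite !mulr_ge0.
by rewrite -natr1; lra.
Qed.

(* [taylor_disc] for [m = 0] loses a factor [2 / (1 - |z|)], which disappears when it
   is applied to large powers of [phi]. *)
Lemma max_modulus phi z M : hdisc phi -> cmod z <= 1 -> (forall x, cmod x = 1 -> cmod (phi x) <= M) ->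
  cmod (phi z) <= M.
Proof.
move=> H; rewrite le_eqVlt => /predU1P[z1 HM|z1 HM]; first exact: HM.
have K0 : 0 < 2 / (1 - cmod z) by rewrite divr_gt0 // subr_gt0.
have M0 : 0 <= M.
  by apply: le_trans (HM 1 _); rewrite ?nrm_ge0 ?nrm1.
have pw n : cmod (phi z) ^+ n <= 2 / (1 - cmod z) * M ^+ n.
  rewrite -nrmX; have := @taylor_disc _ z 0%N (M ^+ n) (hdiscX n H) z1.
  rewrite big_ord0 subr0 expr0 mulr1 mulrAC; apply.
  by move=> x x1; rewrite nrmX; apply: lerXn2r; rewrite ?nnegrE ?nrm_ge0 // HM.
rewrite leNgt; apply/negP => lt.
have [M00|Mp] := eqVneq M 0.
  by have := pw 1%N; rewrite M00 !expr1 mulr0 leNgt -M00 lt.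
have {}Mp : 0 < M by rewrite lt_neqAle eq_sym Mp.
pose h := cmod (phi z) / M - 1.
have h0 : 0 < h by rewrite subr_gt0 ltr_pdivlMr // mul1r.
have E : cmod (phi z) = (1 + h) * M by rewrite /h addrC subrK divfK // gt_eqF.
pose n := Num.bound (2 / (1 - cmod z) / h).
have := pw n; rewrite E exprMn ler_pM2r ?exprn_gt0 // => le1.
have := le_trans (bernoulli n (ltW h0)) le1.
have : 2 / (1 - cmod z) / h < n%:R by apply: archi_boundP; rewrite ltW // divr_gt0.
by rewrite ltr_pdivrMr //; lra.
Qed.

End Mean.

(** * Expansions at the origin *)

Section BigO.
Variable R : realType.
Local Notation C := (CC R).

Implicit Types phi psi : C -> C.

(** The origin is excluded, so the relation ignores the value there; where that value matters, as in
    [bigo2_cder] and [bigo_deriv], it is a separate hypothesis. *)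
Definition bigo (m : nat) (phi : C -> C) := exists2 K : R, 0 <= K &
  exists2 d : R, 0 < d & forall t : C, t != 0 -> cmod t < d -> cmod (phi t) <= K * cmod t ^+ m.

Lemma bigo_intro m phi (K d : R) : 0 < d ->
  (forall t, t != 0 -> cmod t < d -> cmod (phi t) <= K * cmod t ^+ m) -> bigo m phi.
Proof.
move=> d0 H; exists (Num.max K 0); first by rewrite le_max lexx orbT.
exists d => // t t0 td; apply: le_trans (H t t0 td) _.
by rewrite ler_wpM2r ?exprn_ge0 ?nrm_ge0 // le_max lexx.
Qed.

Lemma bigoD m phi psi : bigo m phi -> bigo m psi -> bigo m (fun t => phi t + psi t).
Proof.
move=> [K K0 [d d0 H]] [K' K0' [d' d0' H']].
apply: (@bigo_intro _ _ (K + K') (Num.min d d')); first by rewrite lt_min d0.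
move=> t t0; rewrite lt_min => /andP[td td']; apply: le_trans (nrmD _ _) _.
by rewrite mulrDl lerD ?H ?H'.
Qed.

Lemma bigoM m n phi psi : bigo m phi -> bigo n psi -> bigo (m + n) (fun t => phi t * psi t).
Proof.
move=> [K K0 [d d0 H]] [K' K0' [d' d0' H']].
apply: (@bigo_intro _ _ (K * K') (Num.min d d')); first by rewrite lt_min d0.
move=> t t0; rewrite lt_min => /andP[td td']; rewrite nrmM exprD mulrACA.
by rewrite ler_pM ?nrm_ge0 ?H ?H'.
Qed.

Lemma bigo_cst c : bigo 0 (fun=> c).
Proof. by apply: (@bigo_intro _ _ (cmod c) 1) => // t _ _; rewrite expr0 mulr1. Qed.
Lemma bigoX m : bigo m (fun t => t ^+ m).
Proof. by apply: (@bigo_intro _ _ 1 1) => // t _ _; rewrite nrmX mul1r. Qed.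

Lemma bigoMl m c phi : bigo m phi -> bigo m (fun t => c * phi t).
Proof. by move=> H; exact: (bigoM (bigo_cst c) H). Qed.
Lemma bigoN m phi : bigo m phi -> bigo m (fun t => - phi t).
Proof. by move=> H; rewrite (_ : (fun _ => _) = fun t => -1 * phi t); [exact: bigoMl|apply: funext => t; rewrite mulN1r]. Qed.
Lemma bigoB m phi psi : bigo m phi -> bigo m psi -> bigo m (fun t => phi t - psi t).
Proof. by move=> H1 H2; apply: bigoD => //; exact: bigoN. Qed.

Lemma bigo_le m n phi : (n <= m)%N -> bigo m phi -> bigo n phi.
Proof.
move=> nm [K K0 [d d0 H]].
apply: (@bigo_intro _ _ K (Num.min d 1)); first by rewrite lt_min d0 ltr01.
move=> t t0; rewrite lt_min => /andP[td t1]; apply: le_trans (H t t0 td) _.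
by rewrite ler_wpM2l // ler_wiXn2l // ?nrm_ge0 // ltW.
Qed.

Lemma bigo_eq m phi psi (d : R) : 0 < d -> (forall t, t != 0 -> cmod t < d -> phi t = psi t) ->
  bigo m psi -> bigo m phi.
Proof.
move=> d0 E [K K0 [d' d0' H]].
apply: (@bigo_intro _ _ K (Num.min d d')); first by rewrite lt_min d0.
by move=> t t0; rewrite lt_min => /andP[td td']; rewrite E // H.
Qed.

Lemma bigo_ext m phi psi : (forall t, phi t = psi t) -> bigo m psi -> bigo m phi.
Proof. by move=> E; apply: (@bigo_eq _ _ _ 1). Qed.

Lemma bigo_scale m phi c : c != 0 -> bigo m phi -> bigo m (fun t => phi (c * t)).
Proof.
move=> c0 [K K0 [d d0 H]]; have cp : 0 < cmod c by rewrite nrm_gt0.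
apply: (@bigo_intro _ _ (K * cmod c ^+ m) (d / cmod c)); first by rewrite divr_gt0.
move=> t t0; rewrite ltr_pdivlMr // mulrC => td.
by rewrite -mulrA -exprMn -nrmM H ?mulf_neq0 // nrmM.
Qed.

Lemma bigo1_cst0 c : bigo 1 (fun=> c) -> c = 0.
Proof.
move=> [K K0 [d d0 H]]; apply/eqP; rewrite -nrm_eq0 eq_le nrm_ge0 andbT.
apply/ler_addgt0Pl => e e0; rewrite addr0.
pose t := Num.min (d / 2) (e / (K + 1)).
have K1 : 0 < K + 1 by rewrite ltr_wpDl.
have t0 : 0 < t by rewrite lt_min !divr_gt0.
have [t1 t2] : t <= d / 2 /\ t <= e / (K + 1) by rewrite !ge_min !lexx orbT.
have nt : cmod (ofr t) = t by rewrite nrm_ofr ger0_norm // ltW.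
have := H (ofr t); rewrite nt expr1 ofr_eq0 gt_eqF // => /(_ isT).
have td : t < d by lra.
move=> /(_ td) h; apply: le_trans h _.
rewrite ler_pdivlMr // in t2; apply: le_trans t2.
by rewrite mulrDr mulr1 mulrC lerDl ltW.
Qed.

Lemma bigo_uniq m (c : nat -> C) : bigo m (fun t => \sum_(j < m) c j * t ^+ j) ->
  forall j, (j < m)%N -> c j = 0.
Proof.
elim: m c => [//|m IH] c H.
have H1 : bigo 1 (fun t => \sum_(j < m) c j.+1 * t ^+ j.+1).
  suff : forall k, bigo 1 (fun t => \sum_(j < k) c j.+1 * t ^+ j.+1) by exact.
  elim=> [|k IHk].
    by apply: (@bigo_intro _ _ 0 1) => // t _ _; rewrite big_ord0 nrm0 mul0r.
  apply: bigo_ext (bigoD IHk (bigoMl (c k.+1) (bigo_le (n := 1) _ (bigoX k.+1)))) => // t.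
  by rewrite big_ord_recr.
have c0 : c 0%N = 0.
  apply: bigo1_cst0; apply: bigo_ext (bigoB (bigo_le (n := 1) _ H) H1) => // t.
  by rewrite big_ord_recl /= mulr1; ring.
have {IH} := IH (fun j => c j.+1) => IH; case=> [//|j] jm; apply: IH => //.
have [K K0 [d d0 HH]] := H; apply: (@bigo_intro _ _ K d) => // t t0 td.
have tp : 0 < cmod t by rewrite nrm_gt0.
have := HH t t0 td; rewrite big_ord_recl /= c0 mul0r add0r.
rewrite (_ : \sum_(i < m) c (bump 0 i) * t ^+ bump 0 i = t * \sum_(i < m) c i.+1 * t ^+ i); last first.
  by rewrite mulr_sumr; apply: eq_bigr => i _; rewrite /bump /= add1n exprS; ring.
by rewrite nrmM exprS mulrCA ler_pM2l.
Qed.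

Lemma cder_bigo1 phi a : cder phi 0 a -> bigo 1 (fun t => phi t - phi 0).
Proof.
move=> /(_ 1 ltr01)[d d0 H]; apply: (@bigo_intro _ _ (cmod a + 1) d) => // t t0 td.
have := H t td; rewrite add0r mul1r => h.
have -> : phi t - phi 0 = (phi t - phi 0 - a * t) + a * t by ring.
by apply: le_trans (nrmD _ _) _; rewrite nrmM expr1; lra.
Qed.

Lemma cder_bigo0 phi a : cder phi 0 a -> bigo 0 phi.
Proof.
move=> /cder_bigo1 H; apply: bigo_ext (bigoD (bigo_le (n := 0) _ H) (bigo_cst (phi 0))) => // t.
by rewrite subrK.
Qed.

Lemma bigo2_cder phi a b : bigo 2 (fun t => phi t - (a + b * t)) -> phi 0 = a -> cder phi 0 b.
Proof.
move=> [K K0 [d d0 H]] p0 e e0; have K1 : 0 < K + 1 by rewrite ltr_wpDl.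
exists (Num.min d (e / (K + 1))); first by rewrite lt_min d0 divr_gt0.
move=> h; rewrite lt_min => /andP[hd he]; rewrite add0r.
have [->|h0] := eqVneq h 0; first by rewrite mulr0 subrr subr0 !nrm0 mulr0.
have := H h h0 hd; rewrite p0 opprD addrA => h1; apply: le_trans h1 _.
rewrite expr2 mulrA ler_wpM2r ?nrm_ge0 //.
rewrite ltr_pdivlMr // in he; have := nrm_ge0 h; lra.
Qed.

Lemma inv_bigo0 phi a : cder phi 0 a -> phi 0 != 0 -> bigo 0 (fun t => (phi t)^-1).
Proof. by move=> H p0; exact: (cder_bigo0 (cderV p0 H)). Qed.

Lemma hdisc_scale phi (r : R) (a : C) : (forall t, cmod (t - a) <= r -> exists b, cder phi t b) -> 0 <= r ->
  hdisc (fun t => phi (a + ofr r * t)).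
Proof.
move=> H r0 x x1; have [|b Hb] := H (a + ofr r * x).
  by rewrite addrC addKr nrmM nrm_ofr ger0_norm // ler_piMr.
eexists; apply: (@cder_comp _ (fun t => a + ofr r * t) phi) Hb.
by apply: cderD; [exact: cder_cst|apply: cderM; [exact: cder_cst|exact: cder_id]].
Qed.

Lemma coef0E phi : hdisc phi -> coef phi 0 = phi 0.
Proof.
by move=> H; rewrite /coef (@eq_mean _ _ phi) ?mean_val0 // => x _; rewrite expr0 mulr1.
Qed.

Lemma taylor_bigo phi m M : hdisc phi -> (forall x, cmod x = 1 -> cmod (phi x) <= M) ->
  bigo m (fun t => phi t - \sum_(j < m) coef phi j * t ^+ j).
Proof.
move=> H HM; apply: (@bigo_intro _ _ (4 * M) (1 / 2)) => // t _ t1.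
have M0 : 0 <= M by apply: le_trans (HM 1 _); rewrite ?nrm_ge0 ?nrm1.
apply: le_trans (taylor_disc m H _ HM) _; first by lra.
rewrite ler_pdivrMr; last by lra.
have : 0 <= M * cmod t ^+ m by rewrite mulr_ge0 // exprn_ge0 ?nrm_ge0.
set q := M * cmod t ^+ m => q0.
rewrite -!mulrA (_ : M * (cmod t ^+ m * (1 - cmod t)) = q * (1 - cmod t)); last by rewrite /q; ring.
have : q * (1 / 2) <= q * (1 - cmod t) by rewrite ler_wpM2l //; lra.
rewrite /q; lra.
Qed.

Lemma coef1E phi a M : hdisc phi -> (forall x, cmod x = 1 -> cmod (phi x) <= M) ->
  cder phi 0 a -> coef phi 1 = a.
Proof.
move=> H HM Ha; apply: cder_unique Ha; apply: (bigo2_cder (a := coef phi 0)); last by rewrite coef0E.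
apply: bigo_ext (taylor_bigo 2 H HM) => t.
by rewrite !big_ord_recr big_ord0 /= expr0 expr1; ring.
Qed.

Lemma local_bound phi (d : R) : 0 < d -> {for (0 : C), continuous phi} ->
  exists2 r : R, 0 < r < d & forall t, cmod t <= r -> cmod (phi t) <= cmod (phi 0) + 1.
Proof.
move=> d0 /continuous_nrm/(_ 1 ltr01)[e e0 H].
exists (Num.min d e / 2).
  have : 0 < Num.min d e by rewrite lt_min d0.
  have : Num.min d e <= d by rewrite ge_min lexx.
  by move=> *; apply/andP; split; lra.
move=> t th; have := H t; rewrite subr0.
have : Num.min d e <= e by rewrite ge_min lexx orbT.
have : 0 < Num.min d e by rewrite lt_min d0.
move=> h1 h2 /(_ _)h3; have {}h3 := h3 (ltac:(lra)).
rewrite -(subrK (phi 0) (phi t)); apply: le_trans (nrmD _ _) _; lra.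
Qed.

Lemma expansion phi (d : R) m : 0 < d -> (forall t, cmod t < d -> exists b, cder phi t b) ->
  exists c : nat -> C, bigo m (fun t => phi t - \sum_(j < m) c j * t ^+ j).
Proof.
move=> d0 H; have [|a0 Ha0] := H 0; first by rewrite nrm0.
have [r /andP[r0 rd] HM] := local_bound d0 (cder_cont Ha0).
have H1 : hdisc (fun t => phi (0 + ofr r * t)).
  apply: hdisc_scale => [t|]; last exact: ltW.
  by rewrite subr0 => tr; apply: H; exact: le_lt_trans rd.
have HM1 x : cmod x = 1 -> cmod (phi (0 + ofr r * x)) <= cmod (phi 0) + 1.
  by move=> x1; apply: HM; rewrite add0r nrmM nrm_ofr x1 mulr1 ger0_norm // ltW.
exists (fun j => coef (fun t => phi (0 + ofr r * t)) j * (ofr r)^-1 ^+ j).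
have rn : ofr r != 0 by rewrite ofr_eq0 gt_eqF.
apply: bigo_ext (bigo_scale (c := (ofr r)^-1) _ (taylor_bigo m H1 HM1)); last by rewrite invr_eq0.
move=> t; rewrite add0r mulrA divff // mul1r; congr (_ - _); apply: eq_bigr => j _.
by rewrite -mulrA -exprMn.
Qed.

Lemma cauchy_deriv phi t a (r M : R) : 0 < r -> (forall s, cmod (s - t) <= r -> exists b, cder phi s b) ->
  (forall s, cmod (s - t) <= r -> cmod (phi s) <= M) -> cder phi t a -> cmod a <= 2 * M / r.
Proof.
move=> r0 H HM Ha; have H1 := hdisc_scale H (ltW r0).
have HM1 x : cmod x = 1 -> cmod (phi (t + ofr r * x)) <= M.
  by move=> x1; apply: HM; rewrite addrC addKr nrmM nrm_ofr x1 mulr1 ger0_norm // ltW.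
have d1 : cder (fun x => phi (t + ofr r * x)) 0 (a * ofr r).
  apply: (@cder_comp _ (fun x => t + ofr r * x) phi); last by rewrite mulr0 addr0.
  have := cderD (cder_cst t 0) (cderM (cder_cst (ofr r) 0) (@cder_id R 0)).
  by rewrite mul0r add0r add0r mulr1.
have := coef_bound 1 (hdisc_circ H1) HM1.
by rewrite (coef1E H1 HM1 d1) nrmM nrm_ofr ger0_norm ?(ltW r0) // ler_pdivlMr.
Qed.

(** Cauchy's estimate on the disc of centre [t] and radius [|t|], where [|s| <= 2 |t|], loses
    exactly one order. The origin lies on the boundary of that disc, hence the hypothesis on
    [phi 0]. Expansions may thus be differentiated term by term. *)
Lemma bigo_deriv m phi dphi (d : R) : 0 < d -> (forall t, cmod t < d -> cder phi t (dphi t)) ->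
  bigo m.+1 phi -> phi 0 = 0 -> bigo m dphi.
Proof.
move=> d0 H [K K0 [e e0 HK]] p0.
have de : 0 < Num.min d e by rewrite lt_min d0.
apply: (@bigo_intro _ _ (2 * (K * 2 ^+ m.+1)) (Num.min d e / 2)); first by rewrite divr_gt0.
move=> t t0 td; have tp : 0 < cmod t by rewrite nrm_gt0.
have td' : 2 * cmod t < d /\ 2 * cmod t < e.
  by split; [have : Num.min d e <= d by rewrite ge_min lexx|have : Num.min d e <= e by rewrite ge_min lexx orbT]; lra.
have sub s : cmod (s - t) <= cmod t -> cmod s <= 2 * cmod t.
  move=> h; rewrite -(subrK t s); apply: le_trans (nrmD _ _) _; lra.
have := @cauchy_deriv phi t (dphi t) (cmod t) (K * (2 * cmod t) ^+ m.+1) tp.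
move=> /(_ _ _ _) h; apply: le_trans (h _ _ _) _.
- by move=> s /sub s2; exists (dphi s); apply: H; case: td'; lra.
- move=> s /sub s2; have [->|s0] := eqVneq s 0.
    by rewrite p0 nrm0 mulr_ge0 // exprn_ge0 // mulr_ge0 // ltW.
  apply: le_trans (HK s s0 _) _; first by case: td'; lra.
  by rewrite ler_wpM2l // lerXn2r ?nnegrE ?nrm_ge0 // mulr_ge0 // ltW.
- by apply: H; case: td'; lra.
rewrite exprMn (exprSr (cmod t)) le_eqVlt; apply/orP; left; apply/eqP.
by field; rewrite gt_eqF.
Qed.

(** [expansion] supplies unnamed coefficients. By induction on [m], the differentiated expansion
    must agree with that of [phi 1], and uniqueness identifies all coefficients but the constant
    one. *)
Lemma taylor_seq (phi : nat -> C -> C) (d : R) m : 0 < d ->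
  (forall j t, cmod t < d -> cder (phi j) t (phi j.+1 t)) ->
  bigo m (fun t => phi 0%N t - \sum_(j < m) (phi j 0 / j`!%:R) * t ^+ j).
Proof.
move=> d0; elim: m phi => [|m IH] phi H.
  have := H 0%N 0; rewrite nrm0 => /(_ d0)/cder_bigo0; apply: bigo_ext => t.
  by rewrite big_ord0 subr0.
have [c Hc] := @expansion (phi 0%N) d m.+1 d0 (fun t td => ex_intro _ _ (H 0%N t td)).
have c0 : c 0%N = phi 0%N 0.
  apply/esym/eqP; rewrite -subr_eq0; apply/eqP; apply: bigo1_cst0.
  have h1 := H 0%N 0; rewrite nrm0 in h1; have {}h1 := cder_bigo1 (h1 d0).
  have h2 : bigo 1 (fun t => \sum_(j < m) c j.+1 * t ^+ j.+1).
    elim: (m) => [|k IHk]; first by apply: (@bigo_intro _ _ 0 1) => // t _ _; rewrite big_ord0 nrm0 mul0r.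
    apply: bigo_ext (bigoD IHk (bigoMl (c k.+1) (bigo_le (n := 1) _ (bigoX k.+1)))) => // t.
    by rewrite big_ord_recr.
  have h3 := bigoD (bigoB (bigo_le (n := 1) (ltn0Sn m) Hc) h1) h2.
  apply: bigo_ext h3 => t; rewrite big_ord_recl /= expr0 mulr1.
  rewrite (eq_bigr (fun i : 'I_m => c i.+1 * t ^+ i.+1)); first by ring.
  by move=> i _; rewrite /bump /= add1n.
have H1 := IH (fun j => phi j.+1) (fun j t td => H j.+1 t td).
have H2 : bigo m (fun t => phi 1%N t - \sum_(j < m) (j.+1%:R * c j.+1) * t ^+ j).
  apply: (@bigo_deriv m (fun t => phi 0%N t - \sum_(j < m.+1) c j * t ^+ j) _ d d0) Hc _; last first.
    rewrite big_ord_recl /= expr0 mulr1 big1; last by move=> i _; rewrite expr0n /= mulr0.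
    by rewrite c0 addr0 subrr.
  move=> t td; apply: cderB; first exact: H.
  elim: (m) => [|k IHk].
    rewrite big_ord0 (_ : (fun _ => _) = fun=> c 0%N); first exact: cder_cst.
    by apply: funext => x; rewrite big_ord_recr big_ord0 /= add0r expr0 mulr1.
  rewrite big_ord_recr /=.
  rewrite (_ : (fun t0 => _) = (fun x => \sum_(j < k.+1) c j * x ^+ j + c k.+1 * x ^+ k.+1)); last first.
    by apply: funext => x; rewrite big_ord_recr.
  apply: cderD => //; have := cderM (cder_cst (c k.+1) t) (cderX k.+1 (@cder_id R t)).
  by rewrite mul0r add0r mul1r /= mulrCA mulrA.
have H3 := bigo_uniq (m := m) (c := fun j => j.+1%:R * c j.+1 - phi j.+1 0 / j`!%:R).
have {}H3 : forall j, (j < m)%N -> j.+1%:R * c j.+1 - phi j.+1 0 / j`!%:R = 0.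
  apply: H3; apply: bigo_ext (bigoB H1 H2) => t.
  rewrite opprB addrC addrA subrK -sumrB; apply: eq_bigr => j _; by rewrite mulrBl.
apply: bigo_ext Hc => t; congr (_ - _); apply: eq_bigr => j _; congr (_ * _).
case: j => [[|j] /= jm]; first by rewrite c0 divr1.
have /eqP := H3 j jm; rewrite subr_eq0 => /eqP E.
rewrite factS natrM; have f0 : j`!%:R != 0 :> C by rewrite pnatr_eq0 -lt0n fact_gt0.
have j0 : j.+1%:R != 0 :> C by rewrite pnatr_eq0.
by apply: (mulfI j0); rewrite E mulrCA invfM (mulVKf j0).
Qed.

End BigO.

(** * Holomorphic functions on normed spaces *)

Section Several.
Variable R : realType.
Local Notation C := (CC R).
Variable E : normedModType C.
Implicit Types (F : E -> C) (x u v h : E).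

Lemma line_cder F x v t : differentiable F (x + t *: v) ->
  cder (fun s => F (x + s *: v)) t ('d F (x + t *: v) v).
Proof.
move=> dF e e0; have v1 : 0 < nrm v + 1 by rewrite ltr_wpDl ?nrm_ge0.
have [d d0 H] := diff_eps dF (divr_gt0 e0 v1).
exists (d / (nrm v + 1)); first exact: divr_gt0.
move=> h; rewrite ltr_pdivlMr // => hd.
have hv : nrm (h *: v) < d.
  by rewrite nrmZ; apply: le_lt_trans hd; rewrite ler_wpM2l ?nrm_ge0 // lerDl.
have := H _ hv; rewrite linearZ /= -(addrA x) -scalerDl.
rewrite -[X in cmod (_ - X) <= _ -> _]/(h * 'd F (x + t *: v) v) (mulrC h) => h1.
apply: le_trans h1 _; rewrite nrmZ mulrAC ler_pdivrMr //.
rewrite -mulrA ler_wpM2l ?(ltW e0) // ler_wpM2l ?nrm_ge0 // lerDl //.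
Qed.

Section Disc.
Variables (F : E -> C) (x h : E) (r M : R).
Hypothesis r0 : 0 < r.
Hypothesis dF : forall y, nrm (y - x) <= r -> differentiable F y.
Hypothesis MF : forall y, nrm (y - x) <= r -> cmod (F y) <= M.
Hypothesis h0 : h != 0.

Let phi t := F (x + t *: (ofr (r / nrm h) *: h)).
Let np : 0 < nrm h. Proof. by rewrite nrm_gt0. Qed.

Lemma disc_pt t : cmod t <= 1 -> nrm (x + t *: (ofr (r / nrm h) *: h) - x) <= r.
Proof.
move=> t1; rewrite addrC addKr !nrmZ nrm_ofr ger0_norm ?divr_ge0 ?(ltW r0) ?nrm_ge0 //.
by rewrite divfK ?gt_eqF // ler_piMl // ltW.
Qed.

Lemma disc_hdisc : hdisc phi.
Proof. by move=> t t1; eexists; apply: line_cder; apply: dF; exact: disc_pt. Qed.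

Lemma disc_bound t : cmod t = 1 -> cmod (phi t) <= M.
Proof. by move=> t1; apply: MF; apply: disc_pt; rewrite t1. Qed.

Lemma disc_coef1 : coef phi 1 = ofr (r / nrm h) * 'd F x h.
Proof.
apply: (coef1E disc_hdisc disc_bound).
have := @line_cder F x (ofr (r / nrm h) *: h) 0.
rewrite scale0r addr0 => /(_ (dF _)); rewrite subrr nrm0 => /(_ (ltW r0)).
by rewrite linearZ.
Qed.

Lemma cauchy_est0 : cmod ('d F x h) <= 2 * M / r * nrm h.
Proof.
have := coef_bound 1 (hdisc_circ disc_hdisc) disc_bound.
rewrite disc_coef1 nrmM nrm_ofr ger0_norm ?divr_ge0 ?(ltW r0) ?nrm_ge0 // mulrAC.
rewrite ler_pdivrMr // mulrC -ler_pdivlMr // => H; apply: le_trans H _.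
by rewrite le_eqVlt mulrAC eqxx.
Qed.

Lemma taylor2_est0 : nrm h <= r / 2 ->
  cmod (F (x + h) - F x - 'd F x h) <= 4 * M / r ^+ 2 * nrm h ^+ 2.
Proof.
move=> hr; pose t := ofr (nrm h / r).
have nt : cmod t = nrm h / r by rewrite nrm_ofr ger0_norm // divr_ge0 ?nrm_ge0 // ltW.
have t2 : cmod t <= 1 / 2 by rewrite nt ler_pdivrMr //; have := hr; lra.
have t1 : cmod t < 1 by lra.
have := taylor_disc 2 disc_hdisc t1 disc_bound.
rewrite !big_ord_recr big_ord0 /= add0r expr0 mulr1 expr1 disc_coef1.
rewrite (coef0E disc_hdisc) {1 2}/phi scale0r addr0 scalerA -ofrM.
rewrite (_ : nrm h / r * (r / nrm h) = 1); last by field; rewrite !gt_eqF.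
rewrite ofr1 scale1r mulrAC -ofrM (_ : r / nrm h * (nrm h / r) = 1); last by field; rewrite !gt_eqF.
rewrite ofr1 mul1r opprD addrA => H; apply: le_trans H _.
rewrite nt in t2 *; rewrite exprMn ler_pdivrMr; last by lra.
have M0 : 0 <= M by apply: le_trans (MF (y := x) _); rewrite ?nrm_ge0 // subrr nrm0 ltW.
have q0 : 0 <= M * (nrm h ^+ 2 * r^-1 ^+ 2) by rewrite mulr_ge0 // mulr_ge0 ?exprn_ge0 ?nrm_ge0 // invr_ge0 ltW.
have : M * (nrm h ^+ 2 * r^-1 ^+ 2) * (1 / 2) <= M * (nrm h ^+ 2 * r^-1 ^+ 2) * (1 - nrm h / r).
  by rewrite ler_wpM2l //; lra.
rewrite exprVn; lra.
Qed.
End Disc.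

Lemma cauchy_est F x h (r M : R) : 0 < r -> (forall y, nrm (y - x) <= r -> differentiable F y) ->
  (forall y, nrm (y - x) <= r -> cmod (F y) <= M) -> cmod ('d F x h) <= 2 * M / r * nrm h.
Proof.
move=> r0 dF MF; have [->|h0] := eqVneq h 0; last exact: cauchy_est0.
by rewrite linear0 !nrm0 mulr0.
Qed.

Lemma taylor2_est F x h (r M : R) : 0 < r -> (forall y, nrm (y - x) <= r -> differentiable F y) ->
  (forall y, nrm (y - x) <= r -> cmod (F y) <= M) -> nrm h <= r / 2 ->
  cmod (F (x + h) - F x - 'd F x h) <= 4 * M / r ^+ 2 * nrm h ^+ 2.
Proof.
move=> r0 dF MF; have [->|h0] := eqVneq h 0; last exact: taylor2_est0.
by rewrite linear0 addr0 subrr subr0 !nrm0 expr0n mulr0.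
Qed.

(* The derivative of [y |-> 'd F y u] at [x] is the mean over the unit circle of
   [t^-1 * 'd F (x + t u) h]. *)
Lemma diff_dir_small F x u (r M : R) : 0 < r ->
  (forall y, nrm (y - x) <= 4 * r -> differentiable F y) ->
  (forall y, nrm (y - x) <= 4 * r -> cmod (F y) <= M) -> nrm u <= r ->
  differentiable (fun y => 'd F y u) x.
Proof.
move=> r0 dF MF ur.
have M0 : 0 <= M by apply: le_trans (MF x _); rewrite ?nrm_ge0 // subrr nrm0 mulr_ge0 // ltW.
have near1 y z : nrm (y - x) <= 2 * r -> nrm (z - y) <= r -> nrm (z - x) <= 4 * r.
  move=> h1 h2; rewrite -(subrK y z) -addrA; apply: le_trans (nrmD _ _) _; lra.
have dF1 y : nrm (y - x) <= 2 * r -> forall z, nrm (z - y) <= r -> differentiable F z.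
  by move=> h1 z /(near1 _ _ h1); exact: dF.
have MF1 y : nrm (y - x) <= 2 * r -> forall z, nrm (z - y) <= r -> cmod (F z) <= M.
  by move=> h1 z /(near1 _ _ h1); exact: MF.
have pt t : cmod t <= 1 -> nrm (t *: u) <= r.
  by move=> t1; rewrite nrmZ -[r]mul1r ler_pM ?nrm_ge0.
have ptx t y : cmod t <= 1 -> nrm (y - x) <= r -> nrm (y + t *: u - x) <= 2 * r.
  by move=> /pt t1 yx; rewrite addrAC; apply: le_trans (nrmD _ _) _; lra.
(* The derivative is a limit of difference quotients of [F], uniformly on the circle by
   [taylor2_est], and these quotients are continuous; this is where its continuity comes from. *)
have Dcirc h : circ (fun t => 'd F (x + t *: u) h).
  pose A := 4 * M / r ^+ 2 * nrm h ^+ 2.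
  have A0 : 0 <= A by rewrite /A !mulr_ge0 ?exprn_ge0 ?nrm_ge0 // invr_ge0 exprn_ge0 // ltW.
  move=> th e e0.
  pose s := Num.min (r / 2 / (nrm h + 1)) (e / (8 * (A + 1))).
  have h1 : 0 < nrm h + 1 by rewrite ltr_wpDl ?nrm_ge0.
  have A1 : 0 < A + 1 by rewrite ltr_wpDl.
  have s0 : 0 < s by rewrite lt_min !divr_gt0 // mulr_gt0.
  have [s1 s2] : s <= r / 2 / (nrm h + 1) /\ s <= e / (8 * (A + 1)) by rewrite !ge_min !lexx orbT.
  rewrite ler_pdivlMr // in s1; rewrite ler_pdivlMr // in s2; last by rewrite mulr_gt0.
  have sh : nrm (ofr s *: h) <= r / 2.
    rewrite nrmZ nrm_ofr ger0_norm ?(ltW s0) //; apply: le_trans s1.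
    by rewrite ler_wpM2l ?(ltW s0) // lerDl.
  have est y : nrm (y - x) <= 2 * r -> cmod (F (y + ofr s *: h) - F y - ofr s * 'd F y h) <= A * s ^+ 2.
    move=> yx; have := taylor2_est r0 (dF1 y yx) (MF1 y yx) sh.
    rewrite linearZ -[X in cmod (_ - X) <= _]/(ofr s * 'd F y h) => H; apply: le_trans H _.
    by rewrite nrmZ nrm_ofr ger0_norm ?(ltW s0) // exprMn /A le_eqVlt; apply/orP; left; apply/eqP; ring.
  pose y0 := x + cis th *: u.
  have y0x : nrm (y0 - x) <= 2 * r by apply: ptx; rewrite ?nrm_cis // subrr nrm0 ltW.
  have c1 : {for y0, continuous F} by apply: differentiable_continuous; apply: (dF1 y0) => //; rewrite subrr nrm0 ltW.
  have c2 : {for y0 + ofr s *: h, continuous F}.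
    by apply: differentiable_continuous; apply: (dF1 y0) => //; rewrite addrC addKr; lra.
  have es : 0 < e * s / 8 by rewrite divr_gt0 // mulr_gt0.
  have /continuous_nrm/(_ _ es)[d1 d10 H1] := c1.
  have /continuous_nrm/(_ _ es)[d2 d20 H2] := c2.
  pose d := Num.min d1 d2.
  have d0 : 0 < d by rewrite lt_min d10.
  have u1 : 0 < nrm u + 1 by rewrite ltr_wpDl ?nrm_ge0.
  have [dl dl0 Hc] := @rcont_cis R th (d / (nrm u + 1)) (divr_gt0 d0 u1).
  exists dl => // th' /Hc; rewrite ltr_pdivlMr // => cc.
  pose y1 := x + cis th' *: u; rewrite -/y0 -/y1.
  have y1x : nrm (y1 - x) <= 2 * r by apply: ptx; rewrite ?nrm_cis // subrr nrm0 ltW.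
  have y10 : nrm (y1 - y0) < d.
    rewrite /y1 /y0 opprD addrACA subrr add0r -scalerBl nrmZ; apply: le_lt_trans cc.
    by rewrite ler_wpM2l ?nrm_ge0 // lerDl.
  have [y1d1 y1d2] : nrm (y1 - y0) < d1 /\ nrm (y1 - y0) < d2.
    by move: y10; rewrite lt_min => /andP.
  have e1 := est _ y0x; have e2 := est _ y1x.
  have e3 := H1 _ y1d1.
  have e4 : cmod (F (y1 + ofr s *: h) - F (y0 + ofr s *: h)) < e * s / 8.
    by apply: H2; rewrite opprD addrACA subrr addr0.
  have key : cmod (ofr s * ('d F y1 h - 'd F y0 h)) <= A * s ^+ 2 + A * s ^+ 2 + e * s / 8 + e * s / 8.
    have -> : ofr s * ('d F y1 h - 'd F y0 h) =
      - (F (y1 + ofr s *: h) - F y1 - ofr s * 'd F y1 h) + (F (y0 + ofr s *: h) - F y0 - ofr s * 'd F y0 h)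
      + ((F (y1 + ofr s *: h) - F (y0 + ofr s *: h)) - (F y1 - F y0)) by ring.
    apply: le_trans (nrmD _ _) _; apply: le_trans (lerD (nrmD _ _) (nrmB _ _)) _.
    rewrite nrmN; lra.
  rewrite nrmM nrm_ofr ger0_norm ?(ltW s0) // in key.
  rewrite -(ltr_pM2l s0); apply: le_lt_trans key _.
  have : A * s ^+ 2 <= (A + 1) * s * s by rewrite -mulrA -expr2 ler_wpM2r ?exprn_ge0 ?(ltW s0) // lerDl.
  have : (A + 1) * s * s <= e / 8 * s by rewrite ler_wpM2r ?(ltW s0) //; lra.
  have : 0 < e * s by rewrite mulr_gt0.
  lra.
have Fcirc y : nrm (y - x) <= r -> circ (fun t => F (y + t *: u)).
  move=> yx; apply: rcont_comp; first exact: rcont_cis.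
  move=> th; apply: (@cder_cont _ _ _ _ (@line_cder F y u (cis th) _)).
  by apply: dF; have := @ptx (cis th) y; rewrite nrm_cis => /(_ (lexx _) yx); lra.
have cinv := @circ_inv R.
pose L h := mean (fun t => 'd F (x + t *: u) h * t^-1).
have Llin : linear L.
  move=> a h k; rewrite /L (@eq_mean _ _ (fun t => a * ('d F (x + t *: u) h * t^-1) + 'd F (x + t *: u) k * t^-1)).
    rewrite meanD ?meanZ //; try by apply: circM.
    by apply: circM; [exact: circ_cst|apply: circM].
  by move=> t _; rewrite linearP -[X in X + _]/(a * _) mulrDl mulrA.
have Lb h : cmod (L h) <= 4 * M / r * nrm h.
  have : cmod (L h) <= 2 * (2 * M / r * nrm h).
    apply: mean_bound; first by apply: circM.
    move=> t t1; rewrite nrmM nrmV t1 invr1 mulr1.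
    have tx : nrm (x + t *: u - x) <= 2 * r by apply: ptx; rewrite ?t1 // subrr nrm0 ltW.
    exact: (cauchy_est h r0 (dF1 _ tx) (MF1 _ tx)).
  by move=> H; apply: le_trans H _; rewrite le_eqVlt; apply/orP; left; apply/eqP; ring.
have G1 y : nrm (y - x) <= r -> 'd F y u = mean (fun t => F (y + t *: u) * t^-1).
  move=> yx; pose f t := F (y + t *: u).
  have fh : hdisc f.
    move=> t t1; eexists; apply: line_cder; apply: dF.
    by have := ptx t y t1 yx; lra.
  have fM t : cmod t = 1 -> cmod (f t) <= M.
    by move=> t1; apply: MF; have := @ptx t y; rewrite t1 => /(_ (lexx _) yx); lra.
  rewrite -(@coef1E _ f ('d F y u) M fh fM).
    by apply: eq_mean => t _; rewrite expr1.
  have := @line_cder F y u 0; rewrite scale0r addr0; apply; apply: dF; lra.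
have [] // := @eps_diff _ _ _ (fun y => 'd F y u) x L (4 * M / r) Llin Lb.
move=> e e0; pose A := 8 * M / r ^+ 2.
have A0 : 0 <= A by rewrite /A !mulr_ge0 // invr_ge0 exprn_ge0 // ltW.
have A1 : 0 < A + 1 by rewrite ltr_wpDl.
exists (Num.min (r / 2) (e / (A + 1))); first by rewrite lt_min !divr_gt0.
move=> h; rewrite lt_min => /andP[hr]; rewrite ltr_pdivlMr // => he.
have xx : nrm (x - x) <= r by rewrite subrr nrm0 ltW.
have xh : nrm (x + h - x) <= r by rewrite addrC addKr; lra.
rewrite (G1 _ xh) (G1 _ xx) /L -!meanB; last 4 first.
- by apply: circB; apply: circM => //; exact: Fcirc.
- by apply: circM.
- by apply: circM => //; exact: Fcirc.
- by apply: circM => //; exact: Fcirc.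
apply: (@le_trans _ _ (2 * (4 * M / r ^+ 2 * nrm h ^+ 2))).
  apply: mean_bound.
    apply: circB; last exact: circM.
    by apply: circB; apply: circM => //; exact: Fcirc.
  move=> t t1; rewrite -!mulrBl nrmM nrmV t1 invr1 mulr1 (addrAC x h).
  have tx : nrm (x + t *: u - x) <= 2 * r by apply: ptx; rewrite ?t1.
  exact: (taylor2_est r0 (dF1 _ tx) (MF1 _ tx) (ltW hr)).
have -> : 2 * (4 * M / r ^+ 2 * nrm h ^+ 2) = A * nrm h * nrm h by rewrite /A; ring.
rewrite ler_wpM2r ?nrm_ge0 //; have := nrm_ge0 h; lra.
Qed.

(** Linearity in [u] reduces to a short vector, and continuity of [F] at [x] supplies the bound on a
    small ball that [diff_dir_small] asks for. *)
Lemma diff_dir F x u (d : R) : 0 < d -> (forall y, nrm (y - x) < d -> differentiable F y) ->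
  differentiable (fun y => 'd F y u) x.
Proof.
move=> d0 dF; have dx : differentiable F x by apply: dF; rewrite subrr nrm0.
have /continuous_nrm/(_ 1 ltr01)[e e0 He] := differentiable_continuous dx.
pose r := Num.min d e / 8.
have m0 : 0 < Num.min d e by rewrite lt_min d0.
have md : Num.min d e <= d by rewrite ge_min lexx.
have me : Num.min d e <= e by rewrite ge_min lexx orbT.
have r0 : 0 < r by rewrite divr_gt0.
have u1 : 0 < nrm u + 1 by rewrite ltr_wpDl ?nrm_ge0.
pose s := r / (nrm u + 1); have s0 : 0 < s by rewrite divr_gt0.
have su : nrm (ofr s *: u) <= r.
  rewrite nrmZ nrm_ofr ger0_norm ?(ltW s0) // /s mulrAC ler_pdivrMr //.
  by rewrite ler_wpM2l ?(ltW r0) // lerDl.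
have := @diff_dir_small F x _ r (cmod (F x) + 1) r0 _ _ su.
move=> /(_ _ _)H; have {}H : differentiable (fun y => 'd F y (ofr s *: u)) x.
  apply: H => y yx; first by apply: dF; rewrite /r in yx; lra.
  have h : cmod (F y - F x) < 1 by apply: He; rewrite /r in yx; lra.
  rewrite -(subrK (F x) (F y)); apply: le_trans (nrmD _ _) _; lra.
have s1 : ofr s != 0 by rewrite ofr_eq0 gt_eqF.
rewrite (_ : (fun y => 'd F y u) = (ofr s)^-1 *: (fun y => 'd F y (ofr s *: u))).
  exact: differentiableZ.
apply: funext => y; rewrite -[RHS]/((ofr s)^-1 *: ('d F y (ofr s *: u))).
by rewrite linearZ /= scalerA mulVf // scale1r.
Qed.

End Several.

(** * Iterated Frechet derivatives and homogeneous Taylor terms *)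

Section Frechet.
Variable R : realType.
Local Notation C := (CC R).
Variable E : normedModType C.
Implicit Types (F : E -> C) (x z u v h : E).

(** This gives [frechet] its meaning: it applies ['d] repeatedly, and ['d] is a derivative only
    where differentiability is known. *)
Lemma frechet_diff F (r : R) : (forall x, nrm x < r -> differentiable F x) ->
  forall us x, nrm x < r -> differentiable (frechet F us) x.
Proof.
move=> dF; elim=> [|u us IH] x xr /=; first exact: dF.
apply: (@diff_dir _ _ (frechet F us) x u (r - nrm x)); first by rewrite subr_gt0.
move=> y yx; apply: IH; rewrite -(subrK x y); apply: le_lt_trans (nrmD _ _) _; lra.
Qed.

Definition htaylor F (j : nat) z : C := frechet_pow F j 0 z / j`!%:R.

Lemma htaylor_deg0 F z : htaylor F 0 z = F 0.
Proof. by rewrite /htaylor /frechet_pow -[frechet _ _ _]/(F 0) divr1. Qed.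

Lemma htaylor_at0 F j : htaylor F j.+1 0 = 0.
Proof.
rewrite /htaylor /frechet_pow -[frechet _ _ _]/('d (frechet F (nseq j (0 : E))) (0 : E) (0 : E)).
by rewrite linear0 mul0r.
Qed.

Lemma taylor_line F (r : R) z m : 0 < r -> (forall x, nrm x < r -> differentiable F x) ->
  bigo m (fun t => F (t *: z) - \sum_(j < m) htaylor F j z * t ^+ j).
Proof.
move=> r0 dF; have z1 : 0 < nrm z + 1 by rewrite ltr_wpDl ?nrm_ge0.
pose phi j t := frechet F (nseq j z) (t *: z).
have H j t : cmod t < r / (nrm z + 1) -> cder (phi j) t (phi j.+1 t).
  rewrite ltr_pdivlMr // => tz.
  have tr : nrm (0 + t *: z) < r.
    rewrite add0r nrmZ; apply: le_lt_trans tz.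
    by rewrite ler_wpM2l ?nrm_ge0 // lerDl.
  have := line_cder (frechet_diff dF (nseq j z) tr).
  rewrite (_ : (fun s => _) = phi j); first by rewrite add0r.
  by apply: funext => s; rewrite /phi add0r.
have := taylor_seq m (divr_gt0 r0 z1) H; apply: bigo_ext => t.
congr (_ - _); apply: eq_bigr => j _.
by rewrite /htaylor /frechet_pow /phi scale0r.
Qed.

Lemma taylor_line_uniq F (r : R) z m (c : nat -> C) : 0 < r -> (forall x, nrm x < r -> differentiable F x) ->
  bigo m (fun t => F (t *: z) - \sum_(j < m) c j * t ^+ j) ->
  forall j, (j < m)%N -> htaylor F j z = c j.
Proof.
move=> r0 dF H j jm; apply/eqP; rewrite -subr_eq0; apply/eqP.
apply: (@bigo_uniq _ m (fun j => htaylor F j z - c j)) => //.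
apply: bigo_ext (bigoB H (taylor_line z m r0 dF)) => t.
rewrite opprB addrC addrA subrK -sumrB; apply: eq_bigr => i _; by rewrite mulrBl.
Qed.

(** Homogeneity is read off from uniqueness of the expansion along the line through [z],
    reparametrised by [c * t]. For [c = 0] the line collapses and the values at 0 are used. *)
Lemma htaylor_hom F (r : R) j c z : 0 < r -> (forall x, nrm x < r -> differentiable F x) ->
  htaylor F j (c *: z) = c ^+ j * htaylor F j z.
Proof.
move=> r0 dF; have [->|c0] := eqVneq c 0.
  rewrite scale0r; case: j => [|j]; first by rewrite !htaylor_deg0 expr0 mul1r.
  by rewrite htaylor_at0 expr0n mul0r.
apply: (@taylor_line_uniq F r _ j.+1 (fun i => c ^+ i * htaylor F i z) r0 dF) => //.
apply: bigo_ext (bigo_scale c0 (taylor_line z j.+1 r0 dF)) => t.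
rewrite scalerA (mulrC t); congr (_ - _); apply: eq_bigr => i _.
by rewrite exprMn; ring.
Qed.

Lemma local_bound_ball F (r : R) : 0 < r -> (forall x, nrm x < r -> differentiable F x) ->
  exists2 s : R, 0 < s < r & forall x, nrm x <= s -> cmod (F x) <= cmod (F 0) + 1.
Proof.
move=> r0 dF; have /continuous_nrm/(_ 1 ltr01)[e e0 H] : {for (0 : E), continuous F}.
  by apply: differentiable_continuous; apply: dF; rewrite nrm0.
have m0 : 0 < Num.min r e by rewrite lt_min r0.
have md : Num.min r e <= r by rewrite ge_min lexx.
have me : Num.min r e <= e by rewrite ge_min lexx orbT.
exists (Num.min r e / 2); first by apply/andP; split; lra.
move=> x xs; have h : cmod (F x - F 0) < 1 by apply: H; rewrite subr0; lra.
rewrite -(subrK (F 0) (F x)); apply: le_trans (nrmD _ _) _; lra.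
Qed.

(** The remainder on each line is controlled by the bound of [F] on one ball, so the constant is the
    same in all directions. Differentiation across a line needs this uniformity, which [taylor_line]
    does not give. *)
Lemma taylor_unif F (r : R) m : 0 < r -> (forall x, nrm x < r -> differentiable F x) ->
  exists K : R, exists2 d : R, 0 < d < r & forall x, nrm x < d ->
    cmod (F x - \sum_(j < m) htaylor F j x) <= K * nrm x ^+ m.
Proof.
move=> r0 dF; have [s /andP[s0 sr] MF] := local_bound_ball r0 dF.
set M := cmod (F 0) + 1 in MF.
have M0 : 0 <= M by rewrite addr_ge0 ?nrm_ge0.
exists (4 * M / s ^+ m), (s / 2); first by apply/andP; split; lra.
move=> x xs; have [->|x0] := eqVneq x 0.
  case: m => [|m].
    rewrite big_ord0 subr0 expr0 divr1 mulr1; apply: le_trans (MF 0 _) _; first by rewrite nrm0 ltW.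
    lra.
  rewrite big_ord_recl big1 ?addr0; last by move=> i _; exact: htaylor_at0.
  by rewrite htaylor_deg0 subrr !nrm0 expr0n mulr0.
have np : 0 < nrm x by rewrite nrm_gt0.
have nz : nrm x != 0 by rewrite gt_eqF.
pose v := ofr (s / nrm x) *: x.
have nv : nrm v = s by rewrite nrmZ nrm_ofr ger0_norm ?divfK // divr_ge0 ?ltW.
pose phi t := F (t *: v).
have hd : hdisc phi.
  move=> t t1; exists ('d F (0 + t *: v) v).
  rewrite (_ : phi = fun t => F (0 + t *: v)); last by apply: funext => y; rewrite add0r.
  apply: line_cder; apply: dF; rewrite add0r nrmZ nv; apply: le_lt_trans sr.
  by rewrite ler_piMl // ltW.
have hM t : cmod t = 1 -> cmod (phi t) <= M.
  by move=> t1; apply: MF; rewrite nrmZ nv t1 mul1r.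
have cE j : coef phi j = htaylor F j v.
  apply/esym; apply: (@taylor_line_uniq F r v j.+1 (coef phi) r0 dF) => //.
  exact: taylor_bigo hd hM.
pose t := ofr (nrm x / s).
have nt : cmod t = nrm x / s by rewrite nrm_ofr ger0_norm // divr_ge0 // ltW.
have t2 : cmod t <= 1 / 2 by rewrite nt ler_pdivrMr //; lra.
have t1 : cmod t < 1 by lra.
have tv : t *: v = x.
  by rewrite /t /v scalerA -ofrM (_ : _ / _ * _ = 1) ?scale1r //; field; rewrite nz gt_eqF.
have := taylor_disc m hd t1 hM; rewrite {1}/phi tv.
rewrite (eq_bigr (fun j : 'I_m => htaylor F j x)); last first.
  by move=> j _; rewrite cE mulrC -(htaylor_hom _ _ _ r0 dF) tv.
move=> h; apply: le_trans h _; rewrite ler_pdivrMr ?subr_gt0 //.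
rewrite nt in t2 *; rewrite exprMn exprVn.
set q := nrm x ^+ m; set w := (s ^+ m)^-1.
have q0 : 0 <= M * (q * w) by rewrite !mulr_ge0 ?exprn_ge0 ?nrm_ge0 // invr_ge0 exprn_ge0 // ltW.
have : M * (q * w) * (1 / 2) <= M * (q * w) * (1 - nrm x / s) by rewrite ler_wpM2l //; lra.
lra.
Qed.

Lemma deriv_bigO (G : E -> C) m (K d : R) : 0 <= K ->
  (forall x, nrm x < d -> differentiable G x) -> (forall x, nrm x < d -> cmod (G x) <= K * nrm x ^+ m.+1) ->
  forall x h, x != 0 -> nrm x < d / 2 -> cmod ('d G x h) <= 2 ^+ m.+2 * K * nrm x ^+ m * nrm h.
Proof.
move=> K0 dG MG x h x0 xd; have np : 0 < nrm x by rewrite nrm_gt0.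
have sub y : nrm (y - x) <= nrm x -> nrm y <= 2 * nrm x.
  by move=> H; rewrite -(subrK x y); apply: le_trans (nrmD _ _) _; lra.
have := @cauchy_est _ _ G x h (nrm x) (K * (2 * nrm x) ^+ m.+1) np.
move=> /(_ _ _)H; apply: le_trans (H _ _) _.
- by move=> y /sub y2; apply: dG; lra.
- move=> y /sub y2; apply: le_trans (MG y _) _; first by lra.
  by rewrite ler_wpM2l // lerXn2r ?nnegrE ?nrm_ge0 // mulr_ge0 // ltW.
rewrite exprMn (exprSr (nrm x)) [2 ^+ m.+2]exprS le_eqVlt; apply/orP; left; apply/eqP.
by field; rewrite gt_eqF.
Qed.

End Frechet.

(** * Coordinates of row vectors under the maximum norm *)

Section Rows.
Variable R : realType.
Local Notation C := (CC R).

Lemma nrm_entry n (v : 'rV[C]_n) k : cmod (v 0 k) <= nrm v.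
Proof.
rewrite -ler_ofr -!nrmE; change (`|v 0 k| <= mx_norm v).
rewrite mx_normE -[leLHS]nngE num_le.
exact: (@le_bigmax _ _ _ (0%:nng : {nonneg C}) (fun i : 'I_1 * 'I_n => `|v i.1 i.2|%:nng) (0, k)).
Qed.

Lemma nrm_rowP n (v : 'rV[C]_n) : (0 < n)%N -> exists k, nrm v = cmod (v 0 k).
Proof.
move=> n0; have [v0|v0] := eqVneq v 0.
  by exists (Ordinal n0); rewrite v0 mxE !nrm0.
have : mx_norm v != 0 by change (`|v| != 0); rewrite normr_eq0.
move=> /mx_norm_neq0[[i k] /= E]; exists k; rewrite (ord1 i) in E.
by apply: ofr_inj; rewrite -!nrmE -E.
Qed.

Lemma nrm_row_le n (v : 'rV[C]_n) (M : R) : 0 <= M -> (forall k, cmod (v 0 k) <= M) -> nrm v <= M.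
Proof.
move=> M0 H; case: n v H => [|n] v H; first by rewrite (thinmx0 v) nrm0.
by have [k ->] := nrm_rowP v (ltn0Sn n).
Qed.

Variable E : normedModType C.

Lemma entry_diff n (f : E -> 'rV[C]_n) x k : differentiable f x ->
  differentiable (fun y => f y 0 k : C) x /\ forall h, 'd (fun y => f y 0 k : C) x h = 'd f x h 0 k.
Proof.
move=> df; have [K _ KH] := diff_bounded df.
have lin : linear (fun h => 'd f x h 0 k : C).
  by move=> a u v; rewrite linearP !mxE.
have Lb h : cmod ('d f x h 0 k) <= K * nrm h by exact: le_trans (nrm_entry _ _) (KH h).
have [|d1 d2] := @eps_diff _ _ _ (fun y => f y 0 k : C) x _ K lin Lb; last first.
  by split=> // h; rewrite d2.
move=> e e0; have [d d0 H] := diff_eps df e0; exists d => // h /H.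
apply: le_trans; have := nrm_entry (f (x + h) - f x - 'd f x h) k.
by rewrite !mxE.
Qed.

Lemma row_diff n (f : E -> 'rV[C]_n) x : (forall k, differentiable (fun y => f y 0 k : C) x) ->
  differentiable f x.
Proof.
move=> H; rewrite (_ : f = \sum_(k < n) (fun y => (f y 0 k) *: (delta_mx 0 k : 'rV[C]_n))).
  by apply: differentiable_sum => k; exact: differentiableZl.
apply: funext => y; rewrite fct_sumE [LHS]row_sum_delta; apply: eq_bigr => k _.
by [].
Qed.

(** The holomorphic theory above is for scalar functions. Both claims go through one induction: the
    entries of the next derivative are computed from differentiability of the current one, and then
    give its differentiability back. *)
Lemma frechet_entry n (f : E -> 'rV[C]_n) (r : R) : (forall x, nrm x < r -> differentiable f x) ->
  forall us x, nrm x < r -> differentiable (frechet f us) x /\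
   forall k, frechet f us x 0 k = frechet (fun y => f y 0 k : C) us x.
Proof.
move=> df; have dfk k x : nrm x < r -> differentiable (fun y => f y 0 k : C) x.
  by move=> xr; case: (entry_diff k (df x xr)).
elim=> [|u us IH] x xr; first by split; [exact: df|].
have dE y k : nrm y < r -> frechet f (u :: us) y 0 k = frechet (fun y => f y 0 k : C) (u :: us) y.
  move=> yr /=; have [d1 _] := IH y yr; have [_ <-] := entry_diff k d1.
  have [] := @diff_ball_eq _ _ _ (fun y => frechet f us y 0 k : C) (frechet (fun y => f y 0 k : C) us) y (r - nrm y).
  - by rewrite subr_gt0.
  - move=> z zy; apply: (IH z _).2; rewrite -(subrK y z); apply: le_lt_trans (nrmD _ _) _; lra.
  - exact: (frechet_diff (dfk k)).
  by move=> _ dE; exact: (congr1 (fun g => g u) dE).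
split=> [|k]; last exact: dE.
apply: row_diff => k.
have [] // := @diff_ball_eq _ _ _ (fun y => frechet f (u :: us) y 0 k : C) (frechet (fun y => f y 0 k : C) (u :: us)) x (r - nrm x).
- by rewrite subr_gt0.
- move=> z zy; apply: dE; rewrite -(subrK x z); apply: le_lt_trans (nrmD _ _) _; lra.
exact: (frechet_diff (dfk k) (u :: us)).
Qed.

End Rows.

(** * The fourth coefficient in one variable *)

Section OneVar.
Variable R : realType.
Local Notation C := (CC R).

(* [(37 - sqrt 505) / 72] is the smaller root of [36 al^2 - 37 al + 6]. *)
Lemma alpha_bounds (al : R) : al <= (37 - Num.sqrt 505) / 72 ->
  al <= 15 / 72 /\ 0 <= 36 * al ^+ 2 - 37 * al + 6.
Proof.
move=> H; have s2 : Num.sqrt 505 ^+ 2 = 505 :> R by apply: sqr_sqrtr; exact: ler0n.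
have s0 : 0 <= Num.sqrt 505 :> R by exact: sqrtr_ge0.
have s22 : 22 <= Num.sqrt 505 :> R.
  rewrite -(@ler_pXn2r _ 2) ?nnegrE // s2; lra.
split; first by lra.
have h : Num.sqrt 505 <= 37 - 72 * al by lra.
have : Num.sqrt 505 ^+ 2 <= (37 - 72 * al) ^+ 2 by rewrite ler_pXn2r ?nnegrE //; lra.
rewrite s2; nra.
Qed.

(** With [3 * nu] replaced by [2 * (m + 1)], three times the difference of the sides factors as
    [(1 - t) ^+ 2 * (2 * m - 1 + (m - 2) * t)]. Equality holds at [t = 1], and the hypothesis on
    [nu] is the first-order condition there; this is where the bound on alpha originates. *)
Lemma real_ineq (m nu t : R) : 2 <= m -> 2 * (m + 1) <= 3 * nu -> 0 <= t <= 1 ->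
  (1 - t ^+ 2) + m * t * (1 - t ^+ 2) + nu * t ^+ 3 <= nu.
Proof.
move=> m2 mnu /andP[t0 t1].
have q0 : 0 <= 1 - t ^+ 3.
  have : 0 <= (1 - t) * (1 + t + t ^+ 2) by rewrite mulr_ge0 ?subr_ge0 // !addr_ge0 ?exprn_ge0.
  by nra.
have h1 : 2 * (m + 1) * (1 - t ^+ 3) <= 3 * nu * (1 - t ^+ 3) by rewrite ler_wpM2r.
have h2 : 0 <= (1 - t) ^+ 2 * (2 * m - 1 + (m - 2) * t).
  by rewrite mulr_ge0 ?sqr_ge0 // addr_ge0 ?mulr_ge0 //; lra.
nra.
Qed.

(** The function [t * phi t] is the Schwarz function. On the circle of radius [r] it yields
    [|r * phi| <= 1], so [coef_schwarz] applies to [r * phi (r * t)]; then [r] tends to 1. *)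
Lemma schwarz_coefs (phi : C -> C) (w0 w1 w2 : C) :
  (forall t, cmod t < 1 -> exists b, cder phi t b) ->
  (forall t, t != 0 -> cmod t < 1 -> cmod t * cmod (phi t) <= 1) ->
  bigo 3 (fun t => phi t - (w0 + w1 * t + w2 * t ^+ 2)) ->
  cmod w1 <= 1 - cmod w0 ^+ 2 /\ cmod w2 <= 1 - cmod w0 ^+ 2.
Proof.
move=> hphi bphi ephi.
have main (r : R) : 0 < r < 1 -> r ^+ 2 * cmod w1 <= 1 - r ^+ 2 * cmod w0 ^+ 2 /\ r ^+ 3 * cmod w2 <= 1 - r ^+ 2 * cmod w0 ^+ 2.
  move=> /andP[r0 r1]; pose psi t := ofr r * phi (0 + ofr r * t).
  have rn : ofr r != 0 by rewrite ofr_eq0 gt_eqF.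
  have nr : cmod (ofr r) = r by rewrite nrm_ofr ger0_norm // ltW.
  have hd : hdisc psi.
    apply: hdiscM; first exact: hdisc_cst.
    apply: hdisc_scale; last exact: ltW.
    by move=> t; rewrite subr0 => tr; apply: hphi; exact: le_lt_trans r1.
  have hb t : cmod t = 1 -> cmod (psi t) <= 1.
    move=> t1; have t0 : t != 0 by rewrite -nrm_gt0 t1.
    have -> : cmod (psi t) = cmod (ofr r * t) * cmod (phi (ofr r * t)).
      by rewrite /psi add0r !nrmM t1 mulr1.
    apply: bphi.
      by rewrite mulf_neq0.
    by rewrite nrmM t1 nr mulr1.
  pose c (j : nat) : C := nth 0 [:: ofr r * w0; ofr (r ^+ 2) * w1; ofr (r ^+ 3) * w2] j.
  have cE j : (j < 3)%N -> coef psi j = c j.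
    move=> j3; apply/eqP; rewrite -subr_eq0; apply/eqP.
    apply: (@bigo_uniq _ 3 (fun j => coef psi j - c j)) => //.
    apply: bigo_ext (bigoB (bigoMl (ofr r) (bigo_scale rn ephi)) (taylor_bigo 3 hd hb)) => t.
    rewrite !big_ord_recr !big_ord0 /=.
    have -> : psi t = ofr r * phi (ofr r * t) by rewrite /psi add0r.
    rewrite /c /=; generalize (coef psi 0) (coef psi 1) (coef psi 2) => d0 d1 d2.
    rewrite !ofrX; ring.
  have := coef_schwarz hd (k := 1) isT hb; rewrite !cE // /c /=.
  have := coef_schwarz hd (k := 2) isT hb; rewrite !cE // /c /=.
  rewrite !nrmM !nrm_ofr !ger0_norm ?exprn_ge0 ?(ltW r0) // exprMn.
  by move=> h1 h2.
have lim (a b : R) : 0 <= a -> 0 <= b -> (forall r : R, 0 < r < 1 -> r ^+ 3 * a <= 1 - r ^+ 2 * b) -> a <= 1 - b.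
  move=> a0 b0 H; rewrite -subr_ge0; apply/negP => /negP; rewrite -ltNge => lt.
  have s1 : 1 < a + b by lra.
  pose q := 1 - (a + b - 1) / (4 * (a + b)).
  have sp : 0 < 4 * (a + b) by lra.
  (* Here [e * (a + b)] is a quarter of the supposed excess [a + b - 1]. As [1 - 3 * e] bounds both
     powers of [1 - e] from below, a quarter of the excess remains as a contradiction. *)
  pose e := (a + b - 1) / (4 * (a + b)).
  have e0 : 0 < e by rewrite divr_gt0 //; lra.
  have ee : e * (4 * (a + b)) = a + b - 1 by rewrite divfK // gt_eqF.
  have e1 : e < 1 / 4 by rewrite ltr_pdivrMr //; lra.
  have := H (1 - e); have -> : 0 < 1 - e < 1 by apply/andP; split; lra.
  move=> /(_ isT) h.
  have p3 : 1 - 3 * e <= (1 - e) ^+ 3.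
    rewrite -subr_ge0 (_ : _ - _ = e ^+ 2 * (3 - e)); last by ring.
    by rewrite mulr_ge0 ?sqr_ge0 //; lra.
  have p2 : 1 - 3 * e <= (1 - e) ^+ 2.
    rewrite -subr_ge0 (_ : _ - _ = e * (1 + e)); last by ring.
    by rewrite mulr_ge0 //; lra.
  have h1 : (1 - 3 * e) * a <= (1 - e) ^+ 3 * a by rewrite ler_wpM2r.
  have h2 : (1 - 3 * e) * b <= (1 - e) ^+ 2 * b by rewrite ler_wpM2r.
  lra.
have w00 := nrm_ge0 w0; have w10 := nrm_ge0 w1; have w20 := nrm_ge0 w2.
split; apply: lim; rewrite ?sqr_ge0 // => r r01; have [h1 h2] := main r r01 => //.
have /andP[r0 r1] := r01.
apply: le_trans h1; rewrite ler_wpM2r // exprSr ler_piMr ?sqr_ge0 // ltW //.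
Qed.

(** Model case: [F = t + A t^2 + B t^3 + P t^4 + ...] with [F' G = F]. The term [4 P t^3] of [F']
    meets only the leading term [t] of [G] at this order; moved to the right-hand side it turns [P]
    into [P - 4 P]. *)
Lemma fourth_coef_bound (al : R) (G : C -> C) (A B P : C) :
  0 <= al -> al <= (37 - Num.sqrt 505) / 72 ->
  (forall t, cmod t < 1 -> exists b, cder G t b) ->
  (forall t, t != 0 -> cmod t < 1 -> al <= cre (G t / t)) ->
  bigo 5 (fun t => G t * (1 + 2 * A * t + 3 * B * t ^+ 2)
                   - (t + A * t ^+ 2 + B * t ^+ 3 - 3 * P * t ^+ 4)) ->
  cmod P <= (1 - al) * (3 - 4 * al) * (4 - 6 * al) / 3.
Proof.
move=> al0 al1 hG rG eG; have [al2 al3] := alpha_bounds al1.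
pose be := 1 - al; have be0 : 0 < be by rewrite /be; lra.
have b2 : ofr (2 * be) != 0 :> C by rewrite ofr_eq0 gt_eqF // mulr_gt0.
(* Coefficients of the quotient by [1 + 2 A t + 3 B t^2], so that [poly] is the expansion of [G] to
   order four. *)
pose p1 : C := - A; pose p2 : C := 2 * A ^+ 2 - 2 * B; pose p3 : C := - 3 * P + 7 * A * B - 4 * A ^+ 3.
pose poly t : C := t + p1 * t ^+ 2 + p2 * t ^+ 3 + p3 * t ^+ 4.
have eP : bigo 5 (fun t => G t - poly t).
  pose q t : C := 1 + 2 * A * t + 3 * B * t ^+ 2.
  have hq t : exists a, cder q t a.
    eexists; apply: cderD; first apply: cderD; first exact: cder_cst.
      by apply: cderM; [exact: cder_cst|exact: cder_id].
    by apply: cderM; [exact: cder_cst|apply: cderX; exact: cder_id].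
  have [a0 ha0] := hq 0.
  have q0 : q 0 = 1 by rewrite /q !mulr0 expr0n /= mulr0 !addr0.
  have iq : bigo 0 (fun t => (q t)^-1) by apply: inv_bigo0 ha0 _; rewrite q0 oner_eq0.
  have nq : exists2 d : R, 0 < d & forall t, cmod t < d -> q t != 0.
    have := cder_cont ha0; move=> /continuous_nrm/(_ 1 ltr01)[d d0 H].
    exists d => // t; rewrite -(subr0 t) => /H; rewrite subr0 q0 => h.
    by apply: contraTneq h => ->; rewrite sub0r nrmN nrm1 ltxx.
  have [d d0 Hd] := nq.
  (* [r1] and [r2] are the coefficients of degrees 5 and 6 of [poly t * q t]. *)
  pose r1 : C := 2 * A * p3 + 3 * B * p2; pose r2 : C := 3 * B * p3.
  have e1 : bigo 5 (fun t => (G t - poly t) * q t).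
    have e2 : bigo 5 (fun t => t ^+ 5 * (r1 + r2 * t)).
      apply: (@bigoM _ 5 0); first exact: bigoX.
      by apply: bigoD; [exact: bigo_cst|apply: bigoMl; apply: bigo_le (bigoX _ 1)].
    apply: bigo_ext (bigoB eG e2) => t; rewrite /q /poly /r1 /r2 /p1 /p2 /p3; ring.
  apply: (@bigo_eq _ _ _ (fun t => (G t - poly t) * q t * (q t)^-1) d d0); last exact: (bigoM e1 iq).
  by move=> t _ td; rewrite mulfK // Hd.
(* [G / t = 1 + p1 t + p2 t^2 + p3 t^3 + ...], and [t (w1 + w2 t + w3 t^2 + ...)] is the
   Schwarz function [(p - 1) / (p + 1 - 2 al)] of [p = G / t]. *)
pose w1 : C := p1 / ofr (2 * be).
pose w2 : C := (p2 - p1 * w1) / ofr (2 * be).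
pose w3 : C := (p3 - p1 * w2 - p2 * w1) / ofr (2 * be).
have E1 : p1 = ofr (2 * be) * w1 by rewrite /w1 mulrC divfK.
have E2 : p2 = ofr (2 * be) * w2 + p1 * w1 by rewrite /w2 [ofr _ * _]mulrC divfK // subrK.
have E3 : p3 = ofr (2 * be) * w3 + p1 * w2 + p2 * w1.
  by rewrite /w3 [ofr _ * _]mulrC divfK //; ring.
clearbody w1 w2 w3.
pose D t : C := t * (G t + ofr (1 - 2 * al) * t).
pose W t : C := w1 + w2 * t + w3 * t ^+ 2.
(* With [p = G / t] this is [(p - 1) / (t (p + 1 - 2 al))], the Schwarz function divided by [t]; the
   removable singularity is filled with its limit [w1]. *)
pose phi t : C := if t == 0 then w1 else (G t - t) / D t.
have lowD t : t != 0 -> cmod t < 1 -> be * cmod t ^+ 2 <= cmod (D t).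
  move=> t0 t1; have -> : D t = t ^+ 2 * (G t / t + ofr (1 - 2 * al)).
    by rewrite /D; field.
  rewrite nrmM nrmX mulrC ler_wpM2l ?sqr_ge0 //.
  apply: le_trans (cre_le _); apply: le_trans (ler_norm _); rewrite creD cre_ofr.
  by have := rG t t0 t1; rewrite /be; lra.
have D0 t : t != 0 -> cmod t < 1 -> D t != 0.
  move=> t0 t1; rewrite -nrm_gt0; apply: lt_le_trans (lowD t t0 t1).
  by rewrite mulr_gt0 // exprn_gt0 // nrm_gt0.
have ephi : bigo 3 (fun t => phi t - W t).
  have e1 : bigo 5 (fun t => G t - t - W t * D t).
    pose s0 : C := - (w2 * p3 + w3 * p2 ) ; pose s1 : C := - (w3 * p3).
    have e2 : bigo 5 (fun t => (1 - W t * t) * (G t - poly t)).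
      apply: (@bigoM _ 0 5) => //; apply: bigoB; first exact: bigo_cst.
      apply: (@bigoM _ 0 0); last by apply: bigo_le (bigoX _ 1).
      rewrite /W; apply: bigoD; first apply: bigoD; first exact: bigo_cst.
        by apply: bigoMl; apply: bigo_le (bigoX _ 1).
      by apply: bigoMl; apply: bigo_le (bigoX _ 2).
    have e3 : bigo 5 (fun t => t ^+ 5 * (- (w1 * p3 + w2 * p2 + w3 * p1) - (w2 * p3 + w3 * p2) * t - w3 * p3 * t ^+ 2)).
      apply: (@bigoM _ 5 0); first exact: bigoX.
      apply: bigoB; first apply: bigoB; first exact: bigo_cst.
        by apply: bigoMl; apply: bigo_le (bigoX _ 1).
      by apply: bigoMl; apply: bigo_le (bigoX _ 2).
    apply: bigo_ext (bigoD e2 e3) => t; rewrite /W /D /poly.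
    have eb : ofr (1 - 2 * al) = ofr (2 * be) - 1 by rewrite -ofr1 -ofrB /be; congr ofr; ring.
    rewrite eb; move: E1 E2 E3; move: (ofr (2 * be)) => b E1 E2 E3.
    clearbody p1 p2 p3; rewrite E3 E2 E1; ring.
  have [K K0 [d d0 HK]] := e1.
  apply: (@bigo_intro _ _ _ (K / be) (Num.min d 1)); first by rewrite lt_min d0 ltr01.
  move=> t t0; rewrite lt_min => /andP[td t1]; rewrite /phi (negbTE t0).
  have -> : (G t - t) / D t - W t = (G t - t - W t * D t) / D t.
    by rewrite [RHS]mulrBl mulfK ?D0.
  have tp : 0 < cmod t by rewrite nrm_gt0.
  rewrite nrmM nrmV ler_pdivrMr ?nrm_gt0 ?D0 //; apply: le_trans (HK t t0 td) _.
  have -> : K * cmod t ^+ 5 = K / be * cmod t ^+ 3 * (be * cmod t ^+ 2).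
    by field; rewrite gt_eqF.
  by rewrite ler_wpM2l ?lowD // mulr_ge0 ?exprn_ge0 ?nrm_ge0 // divr_ge0 // ltW.
have hphi t : cmod t < 1 -> exists b, cder phi t b.
  move=> t1; have [->|t0] := eqVneq t 0.
    exists w2; apply: (bigo2_cder (a := w1)); last by rewrite /phi eqxx.
    apply: bigo_ext (bigoD (bigo_le (n := 2) _ ephi) (bigoMl w3 (bigoX R 2))) => // t'.
    by rewrite /W; ring.
  have [b hb] := hG t t1.
  have hD : exists b', cder D t b'.
    eexists; apply: cderM; first exact: cder_id.
    by apply: cderD; [exact: hb|apply: cderM; [exact: cder_cst|exact: cder_id]].
  have [b' hb'] := hD.
  eexists; apply: (@cder_near _ phi (fun t => (G t - t) * (D t)^-1) t _ (cmod t)).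
  - by rewrite nrm_gt0.
  - move=> y yt; rewrite /phi; case: eqVneq => // y0.
    by move: yt; rewrite y0 sub0r nrmN ltxx.
  - apply: cderM; first by apply: cderB; [exact: hb|exact: cder_id].
    by apply: cderV; [exact: D0|exact: hb'].
have bphi t : t != 0 -> cmod t < 1 -> cmod t * cmod (phi t) <= 1.
  move=> t0 t1; rewrite /phi (negbTE t0) -nrmM.
  pose p := G t / t.
  have pE : G t = p * t by rewrite /p divfK.
  have pa := rG t t0 t1; rewrite -/p in pa; clearbody p.
  have c0 : p + ofr (1 - 2 * al) != 0.
    apply/eqP => /(congr1 (@cre R)); rewrite creD cre_ofr cre0; lra.
  have -> : t * ((G t - t) / D t) = (p - 1) / (p + ofr (1 - 2 * al)).
    rewrite /D pE; move: c0; move: (ofr (1 - 2 * al)) => o c0.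
    have -> : t * (p * t + o * t) = t * t * (p + o) by ring.
    by field; rewrite c0 t0.
  rewrite nrmM nrmV ler_pdivrMr ?nrm_gt0 // mul1r.
  rewrite -(@ler_pXn2r _ 2) ?nnegrE ?nrm_ge0 // !nrmsq !reimE.
  have : 0 <= (1 - al) * (cre p - al) by rewrite mulr_ge0 //; lra.
  move=> h; rewrite -subr_ge0 (_ : _ - _ = 4 * ((1 - al) * (cre p - al))); first by rewrite mulr_ge0.
  by ring.
have [h2 h3] := schwarz_coefs hphi bphi ephi.
(* In terms of [be = 1 - al], mu is [2 - 7 * be] and nu is [(3 * be - 1) * (4 * be - 1)], here
   expanded. *)
have EP : 3 * P = - (ofr (2 * be) * (w3 + ofr (2 - 7 * be) * (w1 * w2) + ofr (1 - 7 * be + 12 * be ^+ 2) * w1 ^+ 3)).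
  have EA : A = - p1 by rewrite /p1 opprK.
  have EB : 2 * B = 2 * A ^+ 2 - p2 by rewrite /p2; ring.
  have E3P : 3 * P = - p3 + 7 * A * B - 4 * A ^+ 3 by rewrite /p3; ring.
  have b2' : ofr (2 * be) = 2 * ofr be by rewrite ofrM ofr_nat.
  have n2 : (2 : C) != 0 by rewrite pnatr_eq0.
  apply: (mulfI n2).
  have -> : 2 * (3 * P) = - 2 * p3 + 7 * A * (2 * B) - 8 * A ^+ 3 by rewrite E3P; ring.
  have o1 (b : R) : ofr (2 - 7 * b) = 2 - 7 * ofr b by rewrite ofrB ofrM !ofr_nat.
  have o2 (b : R) : ofr (1 - 7 * b + 12 * b ^+ 2) = 1 - 7 * ofr b + 12 * ofr b ^+ 2.
    by rewrite ofrD ofrB !ofrM !ofr_nat ofr1.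
  rewrite EB EA o1 o2.
  move: E1 E2 E3; rewrite b2'; move: (ofr be) => b E1 E2 E3.
  by clearbody p1 p2 p3; rewrite E3 E2 E1; ring.
set nu := 1 - 7 * be + 12 * be ^+ 2 in EP.
have w10 := nrm_ge0 w1.
have w11 : cmod w1 <= 1.
  rewrite -(@ler_pXn2r _ 2) ?nnegrE // expr1n; have := nrm_ge0 w2; lra.
have nu0 : 0 <= nu by rewrite /nu /be; nra.
have h : cmod (w3 + ofr (2 - 7 * be) * (w1 * w2) + ofr nu * w1 ^+ 3) <= nu.
  apply: le_trans (nrmD _ _) _; apply: le_trans (lerD (nrmD _ _) (lexx _)) _.
  rewrite (nrmM (ofr (2 - 7 * be))) (nrmM w1 w2) (nrmM (ofr nu)) nrmX !nrm_ofr (ger0_norm nu0) ler0_norm; last by rewrite /be; lra.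
  apply: le_trans (@real_ineq (7 * be - 2) nu (cmod w1) _ _ _); last first.
  - by rewrite w10 w11.
  - rewrite /nu /be; nra.
  - rewrite /be; lra.
  apply: lerD => //; apply: lerD => //; rewrite opprB -mulrA; apply: ler_wpM2l; first by rewrite /be; lra.
  exact: ler_wpM2l.
have h4 : cmod (3 * P) <= 2 * be * nu.
  by rewrite EP nrmN nrmM nrm_ofr ger0_norm ?ler_wpM2l // mulr_ge0 // ltW.
have e3 : cmod (3 : C) = 3 :> R by rewrite -(ofr_nat R 3) nrm_ofr ger0_norm.
rewrite nrmM e3 in h4.
move: h4; rewrite /nu /be; nra.
Qed.

End OneVar.

(** * The upper bound *)

Section Hol.
Variable R : realType.
Local Notation C := (CC R).
Implicit Types (phi psi : C -> C) (t : C).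

Definition hol phi t := exists a, cder phi t a.

Lemma hol_cst c t : hol (fun=> c) t. Proof. by eexists; exact: cder_cst. Qed.
Lemma holD phi psi t : hol phi t -> hol psi t -> hol (fun s => phi s + psi s) t.
Proof. by move=> [a Ha] [b Hb]; eexists; exact: cderD Ha Hb. Qed.
Lemma holM phi psi t : hol phi t -> hol psi t -> hol (fun s => phi s * psi s) t.
Proof. by move=> [a Ha] [b Hb]; eexists; exact: cderM Ha Hb. Qed.
Lemma holV phi t : phi t != 0 -> hol phi t -> hol (fun s => (phi s)^-1) t.
Proof. by move=> p0 [a Ha]; eexists; exact: cderV Ha. Qed.

Lemma hol_sum (I : finType) (F : I -> C -> C) t : (forall i, hol (F i) t) ->
  hol (fun s => \sum_i F i s) t.
Proof.
move=> H; elim: (index_enum I) => [|i r IH].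
  by rewrite (_ : (fun _ => _) = fun=> 0); [exact: hol_cst|apply: funext => s; rewrite big_nil].
rewrite (_ : (fun _ => _) = (fun s => F i s + \sum_(j <- r) F j s)); first exact: holD.
by apply: funext => s; rewrite big_cons.
Qed.

Lemma hol_prod (I : finType) (F : I -> C -> C) t : (forall i, hol (F i) t) ->
  hol (fun s => \prod_i F i s) t.
Proof.
move=> H; elim: (index_enum I) => [|i r IH].
  by rewrite (_ : (fun _ => _) = fun=> 1); [exact: hol_cst|apply: funext => s; rewrite big_nil].
rewrite (_ : (fun _ => _) = (fun s => F i s * \prod_(j <- r) F j s)); first exact: holM.
by apply: funext => s; rewrite big_cons.
Qed.

Lemma hol_det n (A : C -> 'M[C]_n) t : (forall i j, hol (fun s => A s i j) t) ->
  hol (fun s => \det (A s)) t.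
Proof.
move=> H; rewrite /determinant; apply: hol_sum => p.
by apply: holM; [exact: hol_cst|exact: hol_prod].
Qed.

(** Cramer's rule. [invmx] agrees with it only on invertible matrices, hence a hypothesis on a whole
    neighbourhood of [t]. *)
Lemma hol_invmx n (A : C -> 'M[C]_n) t (r : R) : 0 < r -> (forall s, cmod (s - t) < r -> A s \in unitmx) ->
  (forall i j, hol (fun s => A s i j) t) -> forall i j, hol (fun s => invmx (A s) i j) t.
Proof.
move=> r0 uA H i j.
have [a Ha] : hol (fun s => (\det (A s))^-1 * cofactor (A s) j i) t.
  apply: holM.
    apply: holV; last exact: hol_det.
    by have := uA t; rewrite subrr nrm0 => /(_ r0); rewrite unitmxE unitfE.
  apply: holM; first exact: hol_cst.
  apply: hol_det => i' j'; have := H (lift j i') (lift i j').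
  by congr hol; apply: funext => s; rewrite !mxE.
exists a; apply: (cder_near r0) Ha => s sr.
by rewrite /invmx (uA s sr) !mxE.
Qed.

Lemma bigo_sum (I : finType) m (F : I -> C -> C) : (forall i, bigo m (F i)) ->
  bigo m (fun s => \sum_i F i s).
Proof.
move=> H; elim: (index_enum I) => [|i r IH].
  by apply: (@bigo_intro _ _ _ 0 1) => // s _ _; rewrite big_nil nrm0 mul0r.
by apply: bigo_ext (bigoD (H i) IH) => s; rewrite big_cons.
Qed.

End Hol.

(** * The fourth order term at points with [|z_k| = |z|] *)

Section Upper.
Variable R : realType.
Local Notation C := (CC R).
Variable n : nat.
Implicit Types (x y z v : 'rV[C]_n) (k : 'I_n).

Lemma polydiskE x : polydisk x <-> nrm x < 1.
Proof. by rewrite /polydisk /= -lt_nrm. Qed.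

Lemma nrm_delta k : nrm (delta_mx 0 k : 'rV[C]_n) = 1.
Proof.
apply/eqP; rewrite eq_le; apply/andP; split.
  apply: nrm_row_le => // j; rewrite mxE /=.
  by case: (_ == _); rewrite ?nrm1 ?nrm0.
by have := nrm_entry (delta_mx 0 k : 'rV[C]_n) k; rewrite mxE !eqxx nrm1.
Qed.

(** Where the norm is attained by the [k]-th entry, the [k]-th coordinate, rotated to be positive at
    [x], is a support functional. Starlikeness can then be tested on one coordinate of the
    quotient. *)
Lemma face_functional x k : x != 0 -> cmod (x 0 k) = nrm x ->
  exists2 T : {linear 'rV[C]_n -> C}, support_functional x T &
    forall y, T y = (x 0 k)^-1 * ofr (nrm x) * y 0 k.
Proof.
move=> x0 xk; have np : 0 < nrm x by rewrite nrm_gt0.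
pose c : C := (x 0 k)^-1 * ofr (nrm x).
have lin : linear (fun y => c * y 0 k : C).
  by move=> a u v; rewrite !mxE mulrDr /GRing.scale /= mulrCA.
pose LM := GRing.isLinear.Build C 'rV[C]_n C *:%R (fun y => c * y 0 k : C) lin.
pose T : {linear 'rV[C]_n -> C} := HB.pack (fun y => c * y 0 k : C) LM.
have c1 : cmod c = 1.
  by rewrite nrmM nrmV xk nrm_ofr ger0_norm ?nrm_ge0 // mulVf // gt_eqF.
exists T => //; split.
  rewrite /dual_norm; set S := [set _ | _ in _].
  have S1 : S 1.
    exists (delta_mx 0 k) => /=; last by rewrite -/(nrm _) mxE !eqxx mulr1 -[LHS]/(cmod c).
    by rewrite nrmE nrm_delta.
  have ubS : ubound S 1.
    move=> _ [y /= y1 <-]; rewrite -[X in X <= _]/(cmod (c * y 0 k)) nrmM c1 mul1r.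
    apply: le_trans (nrm_entry _ _) _; by rewrite -le_nrm.
  apply/eqP; rewrite eq_le; apply/andP; split.
    by apply: ge_sup => //; exists 1.
  by apply: ub_le_sup => //; exists 1.
rewrite -[LHS]/(c * x 0 k) /c nrmE mulrAC mulVf ?mul1r //.
by rewrite -nrm_gt0 xk.
Qed.

Variable f : 'rV[C]_n -> 'rV[C]_n.

Lemma diff_jacobian x v : 'd f x v = v *m 'J f x.
Proof. by rewrite /jacobian mul_rV_lin1. Qed.

Variable al : R.
Hypothesis sf : almost_starlike al f.

(* [quot x] is the paper's [(Df(x))^-1 f(x)]. *)
Definition quot x := f x *m invmx ('J f x).

Lemma starlike_face x k : x != 0 -> nrm x < 1 -> cmod (x 0 k) = nrm x ->
  al <= cre (quot x 0 k / x 0 k).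
Proof.
move=> x0 x1 xk; have [_ _ H] := sf.
have [T sT TE] := face_functional x0 xk.
have := H x T (iffRL (polydiskE x) x1) x0 sT; rewrite -/(quot x) TE -/(nrm x) -/(cre _).
have np : 0 < nrm x by rewrite nrm_gt0.
have -> : (x 0 k)^-1 * ofr (nrm x) * quot x 0 k = ofr (nrm x) * (quot x 0 k / x 0 k) by ring.
by rewrite creM cre_ofr cim_ofr mul0r subr0 mulrC ler_pM2l.
Qed.

Lemma f_diff x : nrm x < 1 -> differentiable f x.
Proof. by have [_ [H _] _] := sf => /polydiskE; exact: H. Qed.
Lemma f_unit x : nrm x < 1 -> 'J f x \in unitmx.
Proof. by have [_ [_ H] _] := sf => /polydiskE; exact: H. Qed.

Definition coordf k : 'rV[C]_n -> C := component f k.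

Lemma comp_diff k x : nrm x < 1 -> differentiable (coordf k) x.
Proof. by move=> /f_diff /(entry_diff k)[]. Qed.
Lemma comp_dE k x v : nrm x < 1 -> 'd (coordf k) x v = 'd f x v 0 k.
Proof. by move=> /f_diff /(entry_diff k)[_ ->]. Qed.

Lemma comp0 k : coordf k 0 = 0.
Proof. by have [[f0 _] _ _] := sf; rewrite /coordf /component f0 mxE. Qed.
Lemma comp_d0 k v : 'd (coordf k) 0 v = v 0 k.
Proof.
rewrite comp_dE ?nrm0 //; by have [[_ ->] _ _] := sf.
Qed.

Lemma quot_eq k x : nrm x < 1 -> 'd (coordf k) x (quot x) = coordf k x.
Proof.
by move=> x1; rewrite comp_dE // diff_jacobian /quot mulmxKV // f_unit.
Qed.

Lemma linear_sum_delta (F : 'rV[C]_n -> C) x v :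
  'd F x v = \sum_j v 0 j * 'd F x (delta_mx 0 j).
Proof.
rewrite {1}(row_sum_delta v) linear_sum; apply: eq_bigr => j _.
by rewrite linearZ.
Qed.

Section Line.
Variable z : 'rV[C]_n.
Hypothesis z1 : nrm z = 1.

Let ball t : cmod t < 1 -> nrm (t *: z) < 1.
Proof. by move=> t1; rewrite nrmZ z1 mulr1. Qed.

Lemma hol_line (F : 'rV[C]_n -> C) t : differentiable F (t *: z) -> cder (fun s => F (s *: z)) t ('d F (t *: z) z).
Proof.
move=> dF; have := @line_cder _ _ F 0 z t; rewrite add0r => /(_ dF).
by rewrite (_ : (fun s => F (0 + s *: z)) = (fun s => F (s *: z))) //; apply: funext => s; rewrite add0r.
Qed.

Lemma dcomp_diff j v x : nrm x < 1 -> differentiable (fun y => 'd (coordf j) y v) x.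
Proof. by move=> x1; exact: (frechet_diff (comp_diff j) [:: v] x1). Qed.

Lemma jac_hol i j t : cmod t < 1 -> hol (fun s => 'J f (s *: z) i j) t.
Proof.
move=> t1; have b := ball t1.
have H := hol_line (dcomp_diff j (delta_mx 0 i) b).
eexists; apply: (@cder_near _ _ _ _ _ (1 - cmod t)) H; first by rewrite subr_gt0.
move=> s st; have s1 : cmod s < 1.
  by rewrite -(subrK t s); apply: le_lt_trans (nrmD _ _) _; lra.
by rewrite mxE comp_dE // ball.
Qed.

Definition gline j (t : C) : C := quot (t *: z) 0 j.

Lemma gline_hol j t : cmod t < 1 -> hol (gline j) t.
Proof.
move=> t1; rewrite (_ : gline j = fun s => \sum_i f (s *: z) 0 i * invmx ('J f (s *: z)) i j); last first.
  by apply: funext => s; rewrite /gline /quot mxE.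
apply: hol_sum => i; apply: holM.
  by eexists; exact: (hol_line (comp_diff i (ball t1))).
apply: (@hol_invmx _ _ _ _ (1 - cmod t)); first by rewrite subr_gt0.
  move=> s st; apply: f_unit; apply: ball.
  by rewrite -(subrK t s); apply: le_lt_trans (nrmD _ _) _; lra.
by move=> i' j'; exact: jac_hol.
Qed.

Lemma gline0 j : gline j 0 = 0.
Proof.
rewrite /gline scale0r /quot; have [[-> _] _ _] := sf.
by rewrite mul0mx mxE.
Qed.

(* Differentiate [sum_i g_i(t z) D_i f_j(t z) = f_j(t z)] at [t = 0]. *)
Lemma gline_bigo j : bigo 2 (fun t => gline j t - t * z 0 j).
Proof.
have n0 : cmod (0 : C) < 1 by rewrite nrm0.
have [a ha] := gline_hol j n0.
suff aE : a = z 0 j.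
  have [c Hc] := @expansion _ (gline j) 1 2 ltr01 (fun t t1 => gline_hol j t1).
  have c0 : c 0%N = 0.
    apply: bigo1_cst0; have h1 := cder_bigo1 ha.
    have h2 : bigo 1 (fun t => c 1%N * t ^+ 1) by exact/bigoMl/bigoX.
    have h3 : bigo 1 (fun t => gline j t - \sum_(j < 2) c j * t ^+ j) by apply: bigo_le Hc.
    have h4 := bigoN (bigoD (bigoB h3 h1) h2).
    apply: bigo_ext h4 => t.
    by rewrite !big_ord_recr big_ord0 /= gline0 expr0 expr1; ring.
  have c1 : c 1%N = a.
    apply: cder_unique ha; apply: (bigo2_cder (a := 0)); last exact: gline0.
    apply: bigo_ext Hc => t; rewrite !big_ord_recr big_ord0 /= c0 expr1; ring.
  apply: bigo_ext Hc => t; rewrite !big_ord_recr big_ord0 /= c0 c1 aE expr1; ring.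
have lin i : exists b, cder (fun s => 'd (coordf j) (s *: z) (delta_mx 0 i)) 0 b.
  eexists; apply: (hol_line (dcomp_diff j (delta_mx 0 i) _)); exact: ball.
have H1 : cder (fun s => \sum_i gline i s * 'd (coordf j) (s *: z) (delta_mx 0 i)) 0 a.
  (* [gline i] vanishes at 0 and the derivative of [f] at 0 is the identity, so the product rule
     leaves only the term [i = j]. *)
  have h i : cder (fun s => gline i s * 'd (coordf j) (s *: z) (delta_mx 0 i)) 0 (if i == j then a else 0).
    have [b hb] := lin i.
    have [a' ha'] := gline_hol i n0.
    suff -> : (if i == j then a else 0) = a' * 'd (coordf j) (0 *: z) (delta_mx 0 i) + gline i 0 * b.
      exact: cderM ha' hb.
    rewrite (gline0 i) mul0r addr0.
    rewrite (scale0r z).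
    rewrite (comp_d0 j) mxE eqxx /=.
    case: eqVneq => [e|e]; last by rewrite mulr0.
    by rewrite mulr1; rewrite e in ha'; exact: cder_unique ha ha'.
  have -> : a = \sum_i (if i == j then a else 0) by rewrite -big_mkcond big_pred1_eq.
  elim: (index_enum 'I_n) => [|i r IH].
    rewrite big_nil (_ : (fun _ => _) = fun=> 0); first exact: cder_cst.
    by apply: funext => s; rewrite big_nil.
  rewrite big_cons (_ : (fun _ => _) = (fun s => gline i s * 'd (coordf j) (s *: z) (delta_mx 0 i) + \sum_(i0 <- r) gline i0 s * 'd (coordf j) (s *: z) (delta_mx 0 i0))); first exact: cderD.
  by apply: funext => s; rewrite big_cons.
have H2 : cder (fun s => coordf j (s *: z)) 0 (z 0 j).
  by have := hol_line (comp_diff j (ball n0)); rewrite scale0r comp_d0.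
apply: cder_unique H1 _; apply: (@cder_near _ _ _ _ _ 1) H2 => // s; rewrite subr0 => s1.
by rewrite -linear_sum_delta quot_eq // ball.
Qed.

Variables (k : 'I_n) (a b : C).
Hypothesis ha : forall y, htaylor (coordf k) 2 y = a * y 0 k ^+ 2.
Hypothesis hb : forall y, htaylor (coordf k) 3 y = b * y 0 k ^+ 3.

Lemma htaylor0E y : htaylor (coordf k) 0 y = 0.
Proof. by rewrite htaylor_deg0 comp0. Qed.
Lemma htaylor1E y : htaylor (coordf k) 1 y = y 0 k.
Proof.
rewrite /htaylor /frechet_pow -[frechet _ _ _]/('d (coordf k) (0 : 'rV[C]_n) y).
by rewrite comp_d0 divr1.
Qed.

Definition crem y : C := coordf k y - (y 0 k + a * y 0 k ^+ 2 + b * y 0 k ^+ 3).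

Lemma rem_line x v : nrm x < 1 ->
  differentiable crem x /\ 'd crem x v = 'd (coordf k) x v - v 0 k * (1 + 2 * a * x 0 k + 3 * b * x 0 k ^+ 2).
Proof.
move=> x1; have dc y : differentiable (fun y : 'rV[C]_n => y 0 k : C) y by exact: differentiable_coord.
have d2 : differentiable (fun y : 'rV[C]_n => y 0 k ^+ 2 : C) x.
  exact: (@differentiableM _ _ (fun y : 'rV[C]_n => y 0 k : C) (fun y => y 0 k)).
have d3 : differentiable (fun y : 'rV[C]_n => y 0 k ^+ 3 : C) x.
  exact: (@differentiableM _ _ (fun y : 'rV[C]_n => y 0 k : C) (fun y => y 0 k ^+ 2)).
have dr : differentiable crem x.
  apply: (@differentiableB _ _ _ (coordf k) (fun y => y 0 k + a * y 0 k ^+ 2 + b * y 0 k ^+ 3)); first exact: comp_diff.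
  apply: (@differentiableD _ _ _ (fun y : 'rV[C]_n => y 0 k + a * y 0 k ^+ 2) (fun y : 'rV[C]_n => b * y 0 k ^+ 3)).
    apply: (@differentiableD _ _ _ (fun y : 'rV[C]_n => y 0 k) (fun y : 'rV[C]_n => a * y 0 k ^+ 2)); first exact: dc.
    apply: (@differentiableZ _ _ _ (fun y : 'rV[C]_n => y 0 k ^+ 2)).
    exact: d2.
  apply: (@differentiableZ _ _ _ (fun y : 'rV[C]_n => y 0 k ^+ 3)).
  exact: d3.
split=> //; have x0 : x + 0 *: v = x by rewrite scale0r addr0.
have h1 := @line_cder _ _ crem x v 0; rewrite x0 in h1; apply: cder_unique (h1 dr) _.
have h2 := @line_cder _ _ (coordf k) x v 0; rewrite x0 in h2; have {}h2 := h2 (comp_diff k x1).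
have h3 : cder (fun s => x 0 k + s * v 0 k) 0 (v 0 k).
  have := cderD (cder_cst (x 0 k) 0) (cderM (@cder_id R 0) (cder_cst (v 0 k) 0)).
  by rewrite add0r mul1r mulr0 addr0.
have h4 := cderB h2 (cderD (cderD h3 (cderM (cder_cst a 0) (cderX 2 h3))) (cderM (cder_cst b 0) (cderX 3 h3))).
rewrite (_ : (fun s => crem (x + s *: v)) = (fun x0 : C =>
          coordf k (x + x0 *: v) -
          (x 0 k + x0 * v 0 k + a * (x 0 k + x0 * v 0 k) ^+ 2 +
           b * (x 0 k + x0 * v 0 k) ^+ 3))); last first.
  by apply: funext => s; rewrite /crem !mxE.
rewrite (_ : _ - _ = 'd (coordf k) x v -
        (v 0 k + (0 * (x 0 k + 0 * v 0 k) ^+ 2 + a * (v 0 k * (2%:R * (x 0 k + 0 * v 0 k) ^+ 2.-1))) +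
         (0 * (x 0 k + 0 * v 0 k) ^+ 3 + b * (v 0 k * (3%:R * (x 0 k + 0 * v 0 k) ^+ 3.-1))))) //.
by rewrite /=; ring.
Qed.

Lemma rem_htaylor j y : htaylor crem j y = if (j < 4)%N then 0 else htaylor (coordf k) j y.
Proof.
have rd x : nrm x < 1 -> differentiable crem x by move=> h; case: (rem_line 0 h).
pose m := maxn j.+1 4.
pose cp (i : nat) : C := if (i < 4)%N then 0 else htaylor (coordf k) i y.
apply: (@taylor_line_uniq _ _ crem 1 y m cp ltr01 rd); last by rewrite leq_max leqnn.
have m4 : (4 <= m)%N by rewrite leq_max leqnn orbT.
apply: bigo_ext (taylor_line y m ltr01 (comp_diff k)) => t.
have -> : \sum_(j < m) htaylor (coordf k) j y * t ^+ j = \sum_(j < m) cp j * t ^+ j +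
   ((t * y 0 k) + a * (t * y 0 k) ^+ 2 + b * (t * y 0 k) ^+ 3).
  rewrite -(subnKC m4) !big_split_ord /=.
  rewrite (eq_bigr (fun i : 'I_(m - 4) => cp (4 + i)%N * t ^+ (4 + i))); last first.
    by move=> i _; rewrite /cp ltnNge leq_addr.
  move: (\sum_(i < m - 4) _) => S.
  rewrite !big_ord_recr !big_ord0 /= /cp /= htaylor0E htaylor1E ha hb; ring.
rewrite /crem !mxE; ring.
Qed.

(** The direction [v] is arbitrary, not that of the line, so the uniform expansion on a ball is
    differentiated by [deriv_bigO]. Order three suffices because [gline_bigo] supplies the other two
    orders. *)
Lemma rem_deriv v : bigo 3 (fun t => 'd crem (t *: z) v).
Proof.
have rd x : nrm x < 1 -> differentiable crem x by move=> h; case: (rem_line 0 h).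
have [K [d /andP[d0 d1] H]] := taylor_unif 4 ltr01 rd.
have H' x : nrm x < d -> cmod (crem x) <= `|K| * nrm x ^+ 4.
  move=> /H; rewrite big1 ?subr0; last by move=> i _; rewrite rem_htaylor ltn_ord.
  by move=> h; apply: le_trans h _; rewrite ler_wpM2r ?exprn_ge0 ?nrm_ge0 ?ler_norm.
have rd' x : nrm x < d -> differentiable crem x by move=> xd; apply: rd; exact: lt_trans d1.
apply: (@bigo_intro _ _ _ (2 ^+ 5 * `|K| * nrm v) (d / 2)); first by rewrite divr_gt0.
move=> t t0 td; have nz : nrm (t *: z) = cmod t by rewrite nrmZ z1 mulr1.
have := @deriv_bigO _ _ crem 3 `|K| d (normr_ge0 _) rd' H' (t *: z) v.
rewrite nz -nrm_gt0 nz nrm_gt0 => /(_ t0 td) h; apply: le_trans h _.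
by rewrite le_eqVlt; apply/orP; left; apply/eqP; ring.
Qed.

(** Euler's identity for the leading term: the radial derivative multiplies a homogeneous term of
    degree four by 4. *)
Lemma rem_line_bigo : bigo 5 (fun t => t * 'd crem (t *: z) z - 4 * htaylor (coordf k) 4 z * t ^+ 4).
Proof.
have rd x : nrm x < 1 -> differentiable crem x by move=> h; case: (rem_line 0 h).
set P := htaylor (coordf k) 4 z.
have H : bigo 5 (fun t => crem (t *: z) - P * t ^+ 4).
  apply: bigo_ext (taylor_line z 5 ltr01 rd) => t.
  by rewrite !big_ord_recr big_ord0 /= !rem_htaylor /= -/P; ring.
have h : bigo 4 (fun t => 'd crem (t *: z) z - P * (1 * (4%:R * t ^+ 3))).
  apply: (@bigo_deriv _ 4 (fun t => crem (t *: z) - P * t ^+ 4) _ 1 ltr01) H _.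
    move=> t t1; apply: cderB; first by apply: hol_line; apply: rd; exact: ball.
    have := cderM (cder_cst P t) (cderX 4 (@cder_id R t)).
    by rewrite mul0r add0r.
  by rewrite scale0r /crem comp0 !mxE !expr0n /= !mulr0; ring.
apply: bigo_ext (@bigoM _ 1 4 _ _ (bigoX R 1) h) => t; rewrite expr1; ring.
Qed.

Hypothesis zk : cmod (z 0 k) = 1.
Hypothesis al0 : 0 <= al.
Hypothesis al1 : al <= (37 - Num.sqrt 505) / 72.

(* With [x = t z], [Df_k(x) g(x) = f_k(x)] reads
   [g_k (1 + 2 a x_k + 3 b x_k^2) + D(crem)(x) g(x) = f_k(x)], and [g(x)] may be
   replaced by [x] in the second term up to [O(t^5)]. *)
Lemma face_bound : cmod (htaylor (coordf k) 4 z) <= (1 - al) * (3 - 4 * al) * (4 - 6 * al) / 3.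
Proof.
have zn : z 0 k != 0 by rewrite -nrm_gt0 zk.
set P := htaylor (coordf k) 4 z.
have key : bigo 5 (fun t => gline k t * (1 + 2 * a * (t * z 0 k) + 3 * b * (t * z 0 k) ^+ 2)
   - (t * z 0 k + a * (t * z 0 k) ^+ 2 + b * (t * z 0 k) ^+ 3 - 3 * P * t ^+ 4)).
  have e1 := taylor_line z 5 ltr01 (comp_diff k).
  have e2 := rem_line_bigo; rewrite -/P in e2.
  have e3 : bigo 5 (fun t => \sum_j (gline j t - t * z 0 j) * 'd crem (t *: z) (delta_mx 0 j)).
    by apply: bigo_sum => j; apply: (@bigoM _ 2 3); [exact: gline_bigo|exact: rem_deriv].
  apply: (@bigo_eq _ _ _ _ 1 ltr01 _ (bigoB e1 (bigoD e2 e3))) => t _ t1.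
  have b1 := ball t1.
  have h1 := quot_eq k b1.
  have [_ h2] := rem_line (quot (t *: z)) b1.
  have h3 : 'd crem (t *: z) (quot (t *: z)) = t * 'd crem (t *: z) z +
     \sum_j (gline j t - t * z 0 j) * 'd crem (t *: z) (delta_mx 0 j).
    rewrite [in LHS]linear_sum_delta [in RHS](linear_sum_delta _ _ z) mulr_sumr -big_split /=.
    by apply: eq_bigr => j _; rewrite /gline; ring.
  have ez : (t *: z) 0 k = t * z 0 k by rewrite mxE.
  have h5 := etrans (etrans (esym (congr1 (fun u => u - quot (t *: z) 0 k * (1 + 2 * a * (t *: z) 0 k + 3 * b * (t *: z) 0 k ^+ 2)) h1)) (esym h2)) h3.
  cbv beta in h5; rewrite ez in h5.
  have h4 : \sum_j (gline j t - t * z 0 j) * 'd crem (t *: z) (delta_mx 0 j) =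
    coordf k (t *: z) - gline k t * (1 + 2 * a * (t * z 0 k) + 3 * b * (t * z 0 k) ^+ 2) - t * 'd crem (t *: z) z.
    rewrite -/(gline k t) in h5.
    move: h5; move: (\sum_j _) => S h5.
    by rewrite (_ : coordf k (t *: z) - _ = t * 'd crem (t *: z) z + S) // addrC addKr.
  rewrite h4 !big_ord_recr big_ord0 /= htaylor0E htaylor1E ha hb -/P.
  move: (coordf k (t *: z)) (gline k t) ('d crem (t *: z) z) (z 0 k) => u g r zz.
  ring.
have -> : cmod P = cmod (P / z 0 k) by rewrite nrmM nrmV zk invr1 mulr1.
(* Division by [z 0 k] makes the expansion start with [t]; the coefficients of degrees two, three
   and four are rescaled accordingly, and the modulus of the last is unchanged. *)
apply: (@fourth_coef_bound _ al (fun t => gline k t / z 0 k) (a * z 0 k) (b * z 0 k ^+ 2)) => //.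
- by move=> t t1; apply: holM; [exact: gline_hol|exact: hol_cst].
- move=> t t0 t1; have nz : nrm (t *: z) = cmod t by rewrite nrmZ z1 mulr1.
  have ez : (t *: z) 0 k = t * z 0 k by rewrite mxE.
  have := @starlike_face (t *: z) k; rewrite nz ez nrmM zk mulr1 -nrm_gt0 nz nrm_gt0.
  move=> /(_ t0 t1 erefl); rewrite /gline.
  rewrite (_ : quot (t *: z) 0 k / (t * z 0 k) = quot (t *: z) 0 k / z 0 k / t) //.
  by field; rewrite t0 zn.
apply: bigo_ext (bigoMl (z 0 k)^-1 key) => t; field.
exact: zn.
Qed.

End Line.
End Upper.

(** * From the faces to all points *)

Section Upper.
Variable R : realType.
Local Notation C := (CC R).
Variable n : nat.
Variable f : 'rV[C]_n -> 'rV[C]_n.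
Variable al : R.
Hypothesis al0 : 0 <= al.
Hypothesis al1 : al <= (37 - Num.sqrt 505) / 72.
Hypothesis sf : almost_starlike al f.
Hypothesis pf : pure_low_order_terms f.

Let M := (1 - al) * (3 - 4 * al) * (4 - 6 * al) / 3.

(** Both sides are homogeneous of degree [j], so shrinking [y] into the polydisk proves the identity
    everywhere. *)
Lemma pure_extend k j (a : C) : (forall z, polydisk z -> htaylor (coordf f k) j z = a * z 0 k ^+ j) ->
  forall y, htaylor (coordf f k) j y = a * y 0 k ^+ j.
Proof.
move=> H y; have y1 : 0 < nrm y + 1 by rewrite ltr_wpDl ?nrm_ge0.
pose s : C := ofr (nrm y + 1)^-1.
have s0 : s != 0 by rewrite ofr_eq0 gt_eqF // invr_gt0.
have := H (s *: y); rewrite (htaylor_hom j s y ltr01 (comp_diff sf k)) mxE exprMn => H'.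
apply: (@mulfI _ (s ^+ j)); first by rewrite expf_neq0.
rewrite H'; first by rewrite mulrCA.
apply/polydiskE; rewrite nrmZ nrm_ofr ger0_norm ?invr_ge0 ?(ltW y1) //.
by rewrite mulrC ltr_pdivrMr // mul1r ltrDl.
Qed.

Lemma pure_coefs k : exists a b : C, (forall y, htaylor (coordf f k) 2 y = a * y 0 k ^+ 2) /\
  (forall y, htaylor (coordf f k) 3 y = b * y 0 k ^+ 3).
Proof.
exists (pure_partial f k 2 0 / 2`!%:R), (pure_partial f k 3 0 / 3`!%:R).
by split; apply: pure_extend => z /(pf k)[].
Qed.

(* When [|w_j| < |w|], the maximum principle in the variable [w_j] is applied to
   [crem (s w) / s^4], which tends to the fourth order term as [s] tends to [0]. *)
Lemma fourth_bound1 j w : nrm w <= 1 -> cmod (htaylor (coordf f j) 4 w) <= M.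
Proof.
move=> w1; have [a [b [ha hb]]] := pure_coefs j.
pose rm : 'rV[C]_n -> C := crem f j a b.
have rd x : nrm x < 1 -> differentiable rm x by move=> h; case: (rem_line sf j a b 0 h).
have [K [d /andP[d0 d1] H]] := taylor_unif 5 ltr01 rd.
have H' x : nrm x < d -> cmod (rm x - htaylor (coordf f j) 4 x) <= `|K| * nrm x ^+ 5.
  move=> xd; have := H x xd; rewrite !big_ord_recr big_ord0 /= !(rem_htaylor sf ha hb) /= !addr0 add0r.
  by move=> h; apply: le_trans h _; rewrite ler_wpM2r ?exprn_ge0 ?nrm_ge0 ?ler_norm.
pose e : 'rV[C]_n := delta_mx 0 j.
have main (s : R) : 0 < s < d -> cmod (htaylor (coordf f j) 4 w) <= M + 2 * `|K| * s.
  move=> /andP[s0 sd]; have sn : cmod (ofr s) = s by rewrite nrm_ofr ger0_norm // ltW.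
  (* [w' t] is [w] with its [j]-th entry replaced by [t]. For [|t| = 1] its norm is 1 and is
     attained at that entry, so [face_bound] applies on the whole circle. *)
  pose w' (t : C) : 'rV[C]_n := w + (t - w 0 j) *: e.
  have w'E t i : w' t 0 i = if i == j then t else w 0 i.
    rewrite !mxE eqxx /=; case: eqVneq => [->|_]; rewrite ?mulr1 ?mulr0 ?addr0 //.
    by rewrite addrC subrK.
  have w'n t : cmod t <= 1 -> nrm (w' t) <= 1.
    move=> t1; apply: nrm_row_le => // i; rewrite w'E; case: eqP => // _.
    exact: le_trans (nrm_entry _ _) w1.
  have sw t : cmod t <= 1 -> nrm (ofr s *: w' t) <= s.
    by move=> t1; rewrite nrmZ sn ler_piMr ?(ltW s0) ?w'n.
  pose phi t := rm (ofr s *: w' t).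
  have hd : hdisc phi.
    move=> t t1; exists ('d rm (ofr s *: (w - w 0 j *: e) + t *: (ofr s *: e)) (ofr s *: e)).
    have E u : ofr s *: (w - w 0 j *: e) + u *: (ofr s *: e) = ofr s *: w' u.
      by rewrite /w' scalerBl scalerA mulrC -scalerA -scalerDr addrA addrAC.
    rewrite (_ : phi = fun u => rm (ofr s *: (w - w 0 j *: e) + u *: (ofr s *: e))); last first.
      by apply: funext => u; rewrite E.
    apply: line_cder; rewrite E; apply: rd; apply: le_lt_trans (sw t t1) _; lra.
  have hb' t : cmod t = 1 -> cmod (phi t) <= s ^+ 4 * M + `|K| * s ^+ 5.
    move=> t1; have t1' : cmod t <= 1 by rewrite t1.
    have n1 : nrm (w' t) = 1.
      apply/eqP; rewrite eq_le w'n //=; have := nrm_entry (w' t) j.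
      by rewrite w'E eqxx t1.
    have h1 := H' _ (le_lt_trans (sw t t1') sd).
    have fb : cmod (htaylor (coordf f j) 4 (w' t)) <= M.
      by apply: (face_bound sf n1 ha hb) => //; rewrite w'E eqxx.
    rewrite nrmZ n1 mulr1 sn in h1.
    rewrite -(subrK (htaylor (coordf f j) 4 (ofr s *: w' t)) (phi t)).
    apply: le_trans (nrmD _ _) _; rewrite addrC; apply: lerD => //.
    rewrite (htaylor_hom 4 _ _ ltr01 (comp_diff sf j)) nrmM nrmX sn.
    by rewrite ler_wpM2l // exprn_ge0 // ltW.
  have wj : cmod (w 0 j) <= 1 by exact: le_trans (nrm_entry _ _) w1.
  have := max_modulus hd wj hb'.
  have ww : w' (w 0 j) = w by rewrite /w' subrr scale0r addr0.
  rewrite /phi ww => h1.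
  have sw1 : nrm (ofr s *: w) <= s by rewrite -ww; exact: sw.
  have h2 := H' _ (le_lt_trans sw1 sd).
  have h3 : cmod (htaylor (coordf f j) 4 (ofr s *: w)) <= s ^+ 4 * M + `|K| * s ^+ 5 + `|K| * s ^+ 5.
    rewrite -(subKr (rm (ofr s *: w)) (htaylor (coordf f j) 4 (ofr s *: w))).
    apply: le_trans (nrmB _ _) _; apply: lerD => //; apply: le_trans h2 _.
    by rewrite ler_wpM2l // lerXn2r ?nnegrE ?nrm_ge0 // ltW.
  rewrite (htaylor_hom 4 _ _ ltr01 (comp_diff sf j)) nrmM nrmX sn in h3.
  rewrite -(ler_pM2l (exprn_gt0 4 s0)); apply: le_trans h3 _.
  by rewrite le_eqVlt; apply/orP; left; apply/eqP; ring.
apply/ler_addgt0Pl => eps eps0.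
pose s := Num.min (d / 2) (eps / (2 * `|K| + 1)).
have K1 : 0 < 2 * `|K| + 1 by rewrite ltr_wpDl // mulr_ge0.
have s0 : 0 < s by rewrite lt_min !divr_gt0.
have [s1 s2] : s <= d / 2 /\ s <= eps / (2 * `|K| + 1) by rewrite !ge_min !lexx orbT.
rewrite ler_pdivlMr // in s2.
apply: le_trans (main s _) _; first by apply/andP; split; lra.
rewrite addrC lerD2r; lra.
Qed.

Lemma fourth_bound j z : cmod (htaylor (coordf f j) 4 z) <= M * nrm z ^+ 4.
Proof.
have [->|z0] := eqVneq z 0; first by rewrite htaylor_at0 !nrm0 expr0n mulr0.
have np : 0 < nrm z by rewrite nrm_gt0.
pose w := ofr (nrm z)^-1 *: z.
have zw : z = ofr (nrm z) *: w by rewrite scalerA -ofrM divff ?gt_eqF // ofr1 scale1r.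
have w1 : nrm w <= 1 by rewrite nrmZ nrm_ofr ger0_norm ?invr_ge0 ?nrm_ge0 // mulVf // gt_eqF.
rewrite {1}zw (htaylor_hom 4 _ _ ltr01 (comp_diff sf j)) nrmM nrmX nrm_ofr ger0_norm ?nrm_ge0 // mulrC.
by rewrite ler_wpM2r ?exprn_ge0 ?nrm_ge0 ?fourth_bound1.
Qed.

Lemma upper_bound z : (0 < n)%N ->
  `|frechet_pow f 4 0 z| / 4`!%:R <= (M%:C : C) * `|z| ^+ 4.
Proof.
move=> n0; have [k kE] := nrm_rowP (frechet_pow f 4 0 z) n0.
have f4 : (4`!%:R : C) != 0 by rewrite pnatr_eq0 -lt0n fact_gt0.
have e1 : frechet_pow f 4 0 z 0 k = 4`!%:R * htaylor (coordf f k) 4 z.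
  have [|_ ->] := @frechet_entry _ _ _ f 1 (@f_diff _ _ _ _ sf) (nseq 4 z) 0; first by rewrite nrm0.
  by rewrite /htaylor mulrC divfK.
have n4 : cmod (4`!%:R : C) = 4`!%:R :> R by rewrite -(ofr_nat R) nrm_ofr ger0_norm.
rewrite nrmE kE e1 nrmM n4 ofrM ofr_nat mulrAC divff // mul1r [`|z|]nrmE -ofrX -[M%:C]/(ofr M) -ofrM ler_ofr.
exact: fourth_bound.
Qed.

End Upper.

(** * Exponential, logarithm and the extremal function *)

Section ExpLog.
Variable R : realType.
Local Notation C := (CC R).

Definition cexp (z : C) : C := ofr (expR (cre z)) * cis (cim z).

Lemma cisD (s t : R) : cis (s + t) = cis s * cis t.
Proof. by apply: cplx_eq; rewrite !reimE ?cosD ?sinD //; ring. Qed.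

Lemma cexpD z w : cexp (z + w) = cexp z * cexp w.
Proof. by rewrite /cexp creD cimD expRD cisD ofrM; ring. Qed.

Lemma cexp0 : cexp 0 = 1.
Proof. by rewrite /cexp cre0 cim0 expR0 cis0 mulr1. Qed.

Lemma cexp_neq0 z : cexp z != 0.
Proof.
apply/eqP => H; have := cexpD z (- z); rewrite subrr cexp0 H mul0r => /eqP.
by rewrite oner_eq0.
Qed.

Lemma real_deriv_eps (g : R -> R) (g' : R) : is_derive (0 : R) (1 : R) g g' ->
  forall e : R, 0 < e -> exists2 d : R, 0 < d & forall x, `|x| < d -> `|g x - g 0 - g' * x| <= e * `|x|.
Proof.
move=> [dg <-] e e0; have := derivable_nbhs dg => /eqaddoP/(_ e e0)/nbhs_ballP[d /= d0 H].
exists d => // x xd; have := H x; rewrite /ball /= sub0r normrN => /(_ xd).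
rewrite -[X in `|X| <= _ -> _]/(g (x *: 1 + 0) - (g 0 + x *: 'D_1 g 0)).
by rewrite [x *: 1](mulr1 x) addr0 opprD addrA /GRing.scale /= (mulrC x).
Qed.

Lemma cder_cexp0 : cder cexp 0 1.
Proof.
move=> e e0; pose q := Num.min (e / 8) 1.
have q0 : 0 < q by rewrite lt_min ltr01 divr_gt0.
have [q1 q2] : q <= e / 8 /\ q <= 1 by rewrite !ge_min !lexx orbT.
have [d1 d10 H1] := real_deriv_eps (is_derive_expR (0 : R)) q0.
have [d2 d20 H2] := real_deriv_eps (is_derive_cos (0 : R)) q0.
have [d3 d30 H3] := real_deriv_eps (is_derive_sin (0 : R)) q0.
rewrite expR0 in H1; rewrite cos0 sin0 in H2; rewrite cos0 sin0 in H3.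
exists (Num.min (Num.min d1 d2) (Num.min d3 (q / 2))).
  by rewrite !lt_min d10 d20 d30 divr_gt0.
move=> h; rewrite !lt_min => /andP[/andP[h1 h2] /andP[h3 h4]].
have hr := cre_le h; have hi := cim_le h; have h0 := nrm_ge0 h.
set x := cre h in hr *; set y := cim h in hi *.
have {}H1 := H1 x (le_lt_trans hr h1); rewrite mul1r in H1.
have {}H2 := H2 y (le_lt_trans hi h2); rewrite oppr0 mul0r subr0 in H2.
have {}H3 := H3 y (le_lt_trans hi h3); rewrite mul1r subr0 in H3.
rewrite add0r cexp0 mul1r.
apply: le_trans (nrm_le _) _; rewrite /cexp !reimE -/x -/y !mul0r subr0 addr0 subr0.
set E := expR x in H1 *; set c := cos y in H2 *; set s := sin y in H3 *.
set N := cmod h in h1 h2 h3 h4 hr hi h0 *.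
have qx : q * `|x| <= q * N by rewrite ler_wpM2l // ltW.
have qy : q * `|y| <= q * N by rewrite ler_wpM2l // ltW.
have E1 : `|E - 1| <= 2 * N.
  rewrite (_ : E - 1 = (E - 1 - x) + x); last by ring.
  apply: le_trans (ler_normD _ _) _.
  have : q * N <= 1 * N by rewrite ler_wpM2r.
  lra.
have E2 : `|E| <= 2.
  rewrite (_ : E = (E - 1) + 1); last by ring.
  by apply: le_trans (ler_normD _ _) _; rewrite normr1; lra.
have e1 : `|E * c - 1 - x| <= 3 * (q * N).
  rewrite (_ : _ - _ - _ = (E - 1 - x) + E * (c - 1)); last by ring.
  apply: le_trans (ler_normD _ _) _; rewrite normrM.
  have := ler_pM (normr_ge0 _) (normr_ge0 _) E2 H2; lra.
have e2 : `|E * s - y| <= 3 * (q * N).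
  rewrite (_ : _ - _ = E * (s - y) + (E - 1) * y); last by ring.
  apply: le_trans (ler_normD _ _) _; rewrite !normrM.
  have := ler_pM (normr_ge0 _) (normr_ge0 _) E2 H3.
  have := ler_pM (normr_ge0 _) (normr_ge0 _) E1 hi.
  have : 2 * N * N <= q * N by rewrite ler_wpM2r //; lra.
  lra.
have : q * N <= e / 8 * N by rewrite ler_wpM2r.
have : 0 <= e * N by rewrite mulr_ge0 // ltW.
lra.
Qed.

Lemma cder_cexp z : cder cexp z (cexp z).
Proof.
have := cder_cexp0; move=> H e e0.
have n0 : 0 < cmod (cexp z) by rewrite nrm_gt0 cexp_neq0.
have [d d0 Hd] := H (e / cmod (cexp z)) (divr_gt0 e0 n0).
exists d => // h /Hd; rewrite add0r cexp0 mul1r cexpD => h1.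
have -> : cexp z * cexp h - cexp z - cexp z * h = cexp z * (cexp h - 1 - h) by ring.
rewrite nrmM; apply: le_trans (ler_wpM2l (nrm_ge0 _) h1) _.
by rewrite mulrA mulrCA divff ?mulr1 // gt_eqF.
Qed.

(** The principal logarithm for positive real part, where [atan (cim w / cre w)] is the argument;
    [koebe_re] keeps [1 + g t] in that half-plane. *)
Definition clog (w : C) : C := mkc (ln (cmod w)) (atan (cim w / cre w)).

Lemma cexp_log w : 0 < cre w -> cexp (clog w) = w.
Proof.
move=> w0; have n0 : 0 < cmod w by apply: lt_le_trans (le_trans (ler_norm _) (cre_le w)).
rewrite /cexp /clog cre_mk cim_mk lnK ?posrE //.
set q := cim w / cre w.
have c1 : cos (atan q) = cre w / cmod w.
  rewrite cos_atan; have -> : 1 + q ^+ 2 = (cmod w / cre w) ^+ 2.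
    by rewrite /q !exprMn !exprVn nrmsq; field; rewrite gt_eqF.
  by rewrite sqrtr_sqr ger0_norm ?divr_ge0 ?(ltW w0) ?(ltW n0) // invf_div.
have c0 : cos (atan q) != 0 by rewrite c1 mulf_neq0 ?invr_eq0 ?gt_eqF.
have s1 : sin (atan q) = cim w / cmod w.
  have : tan (atan q) = q by exact: atanK.
  rewrite /tan => /(congr1 (fun u => u * cos (atan q))); rewrite divfK // => ->.
  by rewrite c1 /q; field; rewrite !gt_eqF.
by apply: cplx_eq; rewrite /cis !reimE c1 s1; field; rewrite gt_eqF.
Qed.

Lemma clog1 : clog 1 = 0.
Proof. by apply: cplx_eq; rewrite /clog !reimE ?nrm1 ?ln1 // mul0r atan0. Qed.

Lemma clog_cont w : 0 < cre w -> forall e : R, 0 < e -> exists2 d : R, 0 < d &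
  forall h, cmod h < d -> cmod (clog (w + h) - clog w) < e.
Proof.
move=> w0 e e0; have n0 : 0 < cmod w by apply: lt_le_trans (le_trans (ler_norm _) (cre_le w)).
have crec : (fun z : C => cre z) @ w --> cre w.
  move=> P /nbhs_ballP[q /= q0 H].
  apply: (iffRL (near_nrm w (fun z => P (cre z)))); exists q => // y yq.
  by apply: H; rewrite /ball /= -creB; apply: le_lt_trans (cre_le _) _; rewrite nrm_sub.
have cimc : (fun z : C => cim z) @ w --> cim w.
  move=> P /nbhs_ballP[q /= q0 H].
  apply: (iffRL (near_nrm w (fun z => P (cim z)))); exists q => // y yq.
  by apply: H; rewrite /ball /= -cimB; apply: le_lt_trans (cim_le _) _; rewrite nrm_sub.
have nrmc : (fun z : C => cmod z) @ w --> cmod w.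
  move=> P /nbhs_ballP[q /= q0 H].
  apply: (iffRL (near_nrm w (fun z => P (cmod z)))); exists q => // y yq.
  apply: H; rewrite /ball /=; apply: le_lt_trans yq; rewrite ler_norml.
  have h1 := nrmD (y - w) w; have h2 := nrmD (w - y) y.
  rewrite !subrK (nrm_sub w) in h1 h2; apply/andP; split; lra.
have c1 : (fun z : C => ln (cmod z)) @ w --> ln (cmod w).
  exact: (@continuous_cvg _ _ _ _ _ _ (@ln R) _ (continuous_ln n0) nrmc).
have c2 : (fun z : C => atan (cim z / cre z)) @ w --> atan (cim w / cre w).
  have cq : (fun z : C => cim z / cre z) @ w --> cim w / cre w.
    have w0' : cre w != 0 by rewrite gt_eqF.
    exact: (cvgM cimc (cvgV w0' crec)).
  exact: (@continuous_cvg _ _ _ _ _ _ (@atan R) _ (@continuous_atan R _) cq).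
have e2 : 0 < e / 2 by rewrite divr_gt0.
have /near_nrm[d1 d10 H1] := c1 _ (nbhsx_ballx (ln (cmod w)) (e / 2) e2).
have /near_nrm[d2 d20 H2] := c2 _ (nbhsx_ballx (atan (cim w / cre w)) (e / 2) e2).
exists (Num.min d1 d2); first by rewrite lt_min d10.
move=> h; rewrite lt_min => /andP[hd1 hd2].
have wh : w + h - w = h by rewrite addrC addKr.
have := H1 (w + h); rewrite wh => /(_ hd1); rewrite /ball /= distrC => h1.
have := H2 (w + h); rewrite wh => /(_ hd2); rewrite /ball /= distrC => h2.
apply: le_lt_trans (nrm_le _) _; rewrite creB cimB /clog !cre_mk !cim_mk; lra.
Qed.

(* [clog] is a continuous right inverse of [cexp]. *)
Lemma cder_clog w : 0 < cre w -> cder clog w w^-1.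
Proof.
move=> w0; have n0 : 0 < cmod w by apply: lt_le_trans (le_trans (ler_norm _) (cre_le w)).
have wn : w != 0 by rewrite -nrm_gt0.
move=> e e0; pose q := Num.min (1 / 2) (e * cmod w / 2).
have q0 : 0 < q by rewrite lt_min !divr_gt0 // mulr_gt0.
have [q1 q2] : q <= 1 / 2 /\ q <= e * cmod w / 2 by rewrite !ge_min !lexx orbT.
have [d1 d10 H1] := cder_cexp0 q0.
have [d2 d20 H2] := clog_cont w0 d10.
exists (Num.min d2 (cre w)); first by rewrite lt_min d20.
move=> h; rewrite lt_min => /andP[hd hw].
have wh : 0 < cre (w + h).
  by rewrite creD; have := le_trans (ler_norm _) (cre_le (- h)); rewrite creN nrmN; lra.
set k := clog (w + h) - clog w.
have ek : cexp k = 1 + w^-1 * h.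
  have : cexp k * w = w + h by rewrite -{1}(cexp_log w0) -cexpD subrK cexp_log.
  by move=> H; apply: (mulIf wn); rewrite H; field.
have := H1 k (H2 h hd); rewrite add0r cexp0 mul1r ek.
have -> : 1 + w^-1 * h - 1 - k = - (k - w^-1 * h) by ring.
rewrite nrmN => h1; set N := cmod (w^-1 * h).
have kN : cmod k <= 2 * N.
  have : cmod k <= cmod (k - w^-1 * h) + N by rewrite -{1}(subrK (w^-1 * h) k); exact: nrmD.
  have : q * cmod k <= 1 / 2 * cmod k by rewrite ler_wpM2r ?nrm_ge0.
  lra.
have NE : N = cmod h / cmod w by rewrite /N nrmM nrmV mulrC.
apply: le_trans h1 _; apply: (@le_trans _ _ (q * (2 * N))); first by rewrite ler_wpM2l // ltW.
apply: (@le_trans _ _ (e * cmod w / 2 * (2 * N))).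
  by rewrite ler_wpM2r // mulr_ge0 // nrm_ge0.
by rewrite NE le_eqVlt; apply/orP; left; apply/eqP; field; rewrite gt_eqF.
Qed.

(** * The extremal function of one variable *)

Section Koebe.
Variable g : R.
Hypothesis g01 : 0 < g <= 1.

(* [kpow t = (1 + g t)^(-(1 + g) / g)]; for [g = 1] this gives a rotation of the Koebe
   function. *)
Definition kpow (t : C) : C := cexp (ofr (- ((1 + g) / g)) * clog (1 + ofr g * t)).
Definition koebe (t : C) : C := t * kpow t.
Definition dkoebe (t : C) : C := kpow t * (1 - t) / (1 + ofr g * t).

Lemma koebe_re t : cmod t < 1 -> 0 < cre (1 + ofr g * t).
Proof.
have /andP[g0 g1] := g01; move=> t1; rewrite creD creM cre_ofr cim_ofr mul0r subr0 cre1.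
have := le_trans (ler_norm _) (cre_le (- t)); rewrite creN nrmN => h.
have : g * (- cre t) <= g * cmod t by rewrite ler_wpM2l // ltW.
have : g * cmod t < g * 1 by rewrite ltr_pM2l.
lra.
Qed.

Lemma koebe_den t : cmod t < 1 -> 1 + ofr g * t != 0.
Proof. by move=> /koebe_re; apply: contraTneq => ->; rewrite cre0 ltxx. Qed.

Lemma cder_koebe t : cmod t < 1 -> cder koebe t (dkoebe t).
Proof.
have /andP[g0 g1] := g01; move=> t1; have dn := koebe_den t1.
have gn : ofr g != 0 by rewrite ofr_eq0 gt_eqF.
have h1 := cderD (cder_cst 1 t) (cderM (cder_cst (ofr g) t) (@cder_id R t)).
have h2 := cderM (cder_cst (ofr (- ((1 + g) / g))) t) (cder_comp h1 (cder_clog (koebe_re t1))).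
have h3 := cderM (@cder_id R t) (cder_comp h2 (cder_cexp _)).
suff -> : dkoebe t = 1 * kpow t + t * (kpow t * (0 * clog (1 + ofr g * t) +
    ofr (- ((1 + g) / g)) * ((1 + ofr g * t)^-1 * (0 + (0 * t + ofr g * 1))))) by exact: h3.
rewrite ofrN ofrM ofrD ofr1 ofrV /dkoebe; field.
by rewrite gn dn.
Qed.

(** Comparing coefficients gives [j c_(j+1) = - (1 + j g) c_j], the recursion behind [kcoef]. *)
Lemma koebe_ode t : cmod t < 1 -> t * (1 + ofr g * t) * dkoebe t = (1 - t) * koebe t.
Proof. by move=> t1; have dn := koebe_den t1; rewrite /dkoebe /koebe; field. Qed.

Lemma one_sub_neq0 (t : C) : cmod t < 1 -> 1 - t != 0.
Proof.
by rewrite subr_eq0 => t1; apply: contraTneq t1 => <-; rewrite nrm1 ltxx.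
Qed.

Lemma dkoebe_neq0 t : cmod t < 1 -> dkoebe t != 0.
Proof.
move=> t1; rewrite /dkoebe; apply: mulf_neq0; last by rewrite invr_eq0 koebe_den.
by apply: mulf_neq0; [exact: cexp_neq0|exact: one_sub_neq0].
Qed.

Lemma dkoebe0 : dkoebe 0 = 1.
Proof. by rewrite /dkoebe /kpow mulr0 addr0 clog1 mulr0 cexp0 subr0 mulr1 divr1. Qed.

Lemma koebe_quot t : cmod t < 1 -> koebe t = t * ((1 + ofr g * t) / (1 - t)) * dkoebe t.
Proof.
move=> t1; rewrite /koebe /dkoebe; field.
by rewrite one_sub_neq0 // koebe_den.
Qed.

(** The Moebius map [(1 + g t) / (1 - t)] sends the disc onto the half-plane of real parts above
    [(1 - g) / 2]. It is the function p whose Schwarz function is [t]. *)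
Lemma koebe_starlike t : cmod t < 1 -> (1 - g) / 2 <= cre ((1 + ofr g * t) / (1 - t)).
Proof.
have /andP[g0 g1] := g01; move=> t1; have tn := one_sub_neq0 t1.
have np : 0 < cmod (1 - t) ^+ 2 by rewrite exprn_gt0 // nrm_gt0.
have -> : (1 + ofr g * t) / (1 - t) = ofr (cmod (1 - t) ^- 2) * ((1 + ofr g * t) * conjc (1 - t)).
  have cn : conjc (1 - t) != 0 :> C by rewrite -nrm_gt0 nrm_conj nrm_gt0.
  by rewrite ofrV -conj_sq; move: cn; move: (conjc (1 - t) : C) => cc cn; field; rewrite tn cn.
rewrite creM cre_ofr cim_ofr mul0r subr0 [leRHS]mulrC ler_pdivlMr // conjB conj1.
have : cmod t ^+ 2 <= 1 by rewrite expr_le1 ?nrm_ge0 // ltW.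
rewrite !nrmsq; case: t t1 tn np => x y _ _ _; rewrite !reimE /cre /cim /=.
move=> h; have : 0 <= (1 + g) * (1 - (x ^+ 2 + y ^+ 2)) by rewrite mulr_ge0 //; lra.
nra.
Qed.

Definition kcoef (j : nat) : C :=
  ofr (nth 0 [:: 0; 1; - (1 + g); (1 + g) * (1 + 2 * g) / 2; - ((1 + g) * (1 + 2 * g) * (1 + 3 * g)) / 6] j).

Lemma koebe_expansion : bigo 5 (fun t => koebe t - \sum_(j < 5) kcoef j * t ^+ j).
Proof.
have [c Hc] := @expansion _ koebe 1 5 ltr01 (fun t t1 => ex_intro _ _ (cder_koebe t1)).
have n0 : cmod (0 : C) < 1 by rewrite nrm0.
have k0 : koebe 0 = 0 by rewrite /koebe mul0r.
have sm m (d : nat -> C) : bigo 1 (fun t => \sum_(j < m) d j.+1 * t ^+ j.+1).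
  elim: m => [|k IHk]; first by apply: (@bigo_intro _ _ _ 0 1) => // t _ _; rewrite big_ord0 nrm0 mul0r.
  apply: bigo_ext (bigoD IHk (bigoMl (d k.+1) (bigo_le (n := 1) _ (bigoX R k.+1)))) => // t.
  by rewrite big_ord_recr.
have c0 : c 0%N = 0.
  apply: bigo1_cst0.
  have h1 := cder_bigo1 (cder_koebe n0).
  have h2 : bigo 1 (fun t => koebe t - \sum_(j < 5) c j * t ^+ j) by apply: bigo_le Hc.
  apply: bigo_ext (bigoN (bigoD (bigoB h2 h1) (sm 4 c))) => t.
  by rewrite !big_ord_recr !big_ord0 /= k0 expr0; ring.
have Hd : bigo 4 (fun t => dkoebe t - (c 1%N + c 2%N * (2 * t) + c 3%N * (3 * t ^+ 2) + c 4%N * (4 * t ^+ 3))).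
  apply: (@bigo_deriv _ 4 (fun t => koebe t - (c 1%N * t + c 2%N * t ^+ 2 + c 3%N * t ^+ 3 + c 4%N * t ^+ 4)) _ 1 ltr01).
  - move=> t t1; apply: cderB; first exact: cder_koebe.
    have X j : cder (fun s => c j * s ^+ j) t (c j * (j%:R * t ^+ j.-1)).
      by have := cderM (cder_cst (c j) t) (cderX j (@cder_id R t)); rewrite mul0r add0r mul1r.
    have := cderD (cderD (cderD (X 1%N) (X 2%N)) (X 3%N)) (X 4%N).
    by rewrite /= !expr1 expr0 !mulr1.
  - by apply: bigo_ext Hc => t; rewrite !big_ord_recr !big_ord0 /= c0 expr1; ring.
  - by rewrite k0 !expr0n /= !mulr0 !addr0 subrr.
have Hode : bigo 5 (fun t => t * (1 + ofr g * t) * (c 1%N + c 2%N * (2 * t) + c 3%N * (3 * t ^+ 2) + c 4%N * (4 * t ^+ 3))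
     - (1 - t) * (c 1%N * t + c 2%N * t ^+ 2 + c 3%N * t ^+ 3 + c 4%N * t ^+ 4)).
  have h1 : bigo 5 (fun t => (1 - t) * (koebe t - \sum_(j < 5) c j * t ^+ j)).
    apply: (@bigoM _ 0 5) => //; apply: bigoB; first exact: bigo_cst.
    by apply: bigo_le (bigoX _ 1).
  have h2 : bigo 5 (fun t => (t ^+ 1 * (1 + ofr g * t)) * (dkoebe t - (c 1%N + c 2%N * (2 * t) + c 3%N * (3 * t ^+ 2) + c 4%N * (4 * t ^+ 3)))).
    apply: (@bigoM _ 1 4) => //; apply: (@bigoM _ 1 0); first exact: bigoX.
    apply: bigoD; first exact: bigo_cst.
    by apply: bigoMl; apply: bigo_le (bigoX _ 1).
  apply: (@bigo_eq _ _ _ _ 1 ltr01 _ (bigoB h1 h2)) => t _ t1.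
  have := koebe_ode t1; rewrite !big_ord_recr !big_ord0 /= c0 expr0 !expr1 => E.
  rewrite mulrBr [in RHS](mulrBr _ (dkoebe t)) E; ring.
pose d (j : nat) : C := nth 0 [:: 0; 0; c 2%N + (1 + ofr g) * c 1%N; 2 * c 3%N + (1 + 2 * ofr g) * c 2%N; 3 * c 4%N + (1 + 3 * ofr g) * c 3%N] j.
have Hz : forall j, (j < 5)%N -> d j = 0.
  apply: bigo_uniq.
  (* The term of degree five of the polynomial in [Hode], which the list [d] does not record. *)
  have h5 : bigo 5 (fun t => t ^+ 5 * ((4 * ofr g + 1) * c 4%N)).
    by apply: (@bigoM _ 5 0); [exact: bigoX|exact: bigo_cst].
  apply: bigo_ext (bigoB Hode h5) => t.
  by rewrite !big_ord_recr !big_ord0 /= /d /=; ring.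
have c1 : c 1%N = 1.
  apply: cder_unique; last by rewrite -dkoebe0; exact: cder_koebe.
  apply: (bigo2_cder (a := 0)) => //.
  have h : bigo 2 (fun t => koebe t - \sum_(j < 5) c j * t ^+ j) by apply: bigo_le Hc.
  have h' : bigo 2 (fun t => t ^+ 2 * (c 2%N + c 3%N * t + c 4%N * t ^+ 2)).
    apply: (@bigoM _ 2 0); first exact: bigoX.
    apply: bigoD; first (apply: bigoD; first exact: bigo_cst); apply: bigoMl.
      by apply: bigo_le (bigoX _ 1).
    by apply: bigo_le (bigoX _ 2).
  apply: bigo_ext (bigoD h h') => t.
  by rewrite !big_ord_recr !big_ord0 /= c0 expr0 expr1; ring.
have c2 : c 2%N = kcoef 2.
  have := Hz 2%N isT; rewrite /d /= c1 mulr1 => /eqP; rewrite addr_eq0 => /eqP ->.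
  by rewrite /kcoef /= ofrN ofrD ofr1.
have n2 : (2 : C) != 0 by rewrite pnatr_eq0.
have n3 : (3 : C) != 0 by rewrite pnatr_eq0.
have c3 : c 3%N = kcoef 3.
  have := Hz 3%N isT; rewrite /d /= c2 => /eqP; rewrite addr_eq0 => /eqP E.
  by apply: (mulfI n2); rewrite E /kcoef /= !(ofrN, ofrM, ofrD, ofrV, ofr_nat, ofr1); field.
have c4 : c 4%N = kcoef 4.
  have := Hz 4%N isT; rewrite /d /= c3 => /eqP; rewrite addr_eq0 => /eqP E.
  by apply: (mulfI n3); rewrite E /kcoef /= !(ofrN, ofrM, ofrD, ofrV, ofr_nat, ofr1); field.
apply: bigo_ext Hc => t; congr (_ - _); apply: eq_bigr => -[j j5] _; congr (_ * _) => /=.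
by case: j j5 => [|[|[|[|[|j]]]]] j5 //; rewrite ?c0 ?c1 ?c2 ?c3 ?c4.
Qed.

End Koebe.
End ExpLog.

(** * The extremal map *)

Section Functional.
Variable R : realType.
Local Notation C := (CC R).
Variable n : nat.

(** Duality between the maximum norm and the sum norm; only this inequality serves below. *)
Lemma dual_norm_sum (T : {linear 'rV[C]_n -> C}) :
  dual_norm T = 1 -> \sum_k cmod (T (delta_mx 0 k)) <= 1.
Proof.
move=> <-; set t := fun k => T (delta_mx 0 k).
have TE y : T y = \sum_k y 0 k * t k.
  rewrite {1}(row_sum_delta y) linear_sum; apply: eq_bigr => k _; by rewrite linearZ.
(* Each entry rotates [t k] to its modulus. Where [t k = 0] the inverse of 0 is 0 and the entry
   vanishes. *)
pose y : 'rV[C]_n := \row_k (conjc (t k) * ofr (cmod (t k))^-1).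
have y1 : nrm y <= 1.
  apply: nrm_row_le => // k; rewrite mxE nrmM nrm_conj nrm_ofr ger0_norm ?invr_ge0 ?nrm_ge0 //.
  have [->|t0] := eqVneq (t k) 0; first by rewrite nrm0 mul0r.
  by rewrite divff // nrm_eq0.
have Ty : T y = ofr (\sum_k cmod (t k)).
  rewrite TE (big_morph (@ofr R) (@ofrD R) (ofr0 R)); apply: eq_bigr => k _; rewrite mxE.
  have [->|t0] := eqVneq (t k) 0; first by rewrite nrm0 mulr0.
  have n0 : cmod (t k) != 0 by rewrite nrm_eq0.
  by rewrite mulrAC mulrC [_ * t k]mulrC conj_sq -ofrM; congr ofr; field.
have s0 : 0 <= \sum_k cmod (t k) by apply: sumr_ge0 => k _; exact: nrm_ge0.
apply: ub_le_sup.
  exists (\sum_k cmod (t k)) => _ [x /= x1 <-]; rewrite -[X in X <= _]/(cmod (T x)) TE.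
  elim/big_rec2: _ => [|k a b _ h]; first by rewrite nrm0.
  apply: le_trans (nrmD _ _) _; apply: lerD => //; rewrite nrmM ler_piMl ?nrm_ge0 //.
  by apply: le_trans (nrm_entry _ _) _; rewrite -le_nrm.
exists y; first by rewrite /= nrmE -ofr1 ler_ofr.
by rewrite -[LHS]/(cmod (T y)) Ty nrm_ofr ger0_norm.
Qed.

(* Equality in [|x| = T x <= sum |t_k| |x_k| <= |x|] forces [t_k x_k = |t_k| |x|]. *)
Lemma support_re (T : {linear 'rV[C]_n -> C}) (x p : 'rV[C]_n) (al : R) :
  support_functional x T -> (forall k, al <= cre (p 0 k)) ->
  al * nrm x <= cre (T (\row_k (x 0 k * p 0 k))).
Proof.
move=> [/dual_norm_sum T1 Tx] Hp.
pose t k := T (delta_mx 0 k).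
have TE y : T y = \sum_k y 0 k * t k.
  rewrite {1}(row_sum_delta y) linear_sum; apply: eq_bigr => k _; by rewrite linearZ.
have creS (F : 'I_n -> C) : cre (\sum_k F k) = \sum_k cre (F k).
  exact: (big_morph (@cre R) (@creD R) (cre0 R)).
have sx : \sum_k cre (x 0 k * t k) = nrm x.
  by rewrite -creS -TE Tx nrmE cre_ofr.
have le1 k : cre (x 0 k * t k) <= cmod (t k) * nrm x.
  apply: le_trans (le_trans (ler_norm _) (cre_le _)) _; rewrite nrmM mulrC.
  by rewrite ler_wpM2l ?nrm_ge0 ?nrm_entry.
have eq1 k : cre (x 0 k * t k) = cmod (t k) * nrm x.
  have S0 : \sum_k (cmod (t k) * nrm x - cre (x 0 k * t k)) <= 0.
    rewrite sumrB sx -mulr_suml subr_le0 ler_piMl ?nrm_ge0 //.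
  have pos i : true -> 0 <= cmod (t i) * nrm x - cre (x 0 i * t i) by move=> _; rewrite subr_ge0.
  have /eqP : \sum_k (cmod (t k) * nrm x - cre (x 0 k * t k)) = 0.
    by apply/eqP; rewrite eq_le S0 sumr_ge0.
  rewrite psumr_eq0 // => /allP/(_ k); rewrite mem_index_enum => /(_ isT) /=.
  by rewrite subr_eq0 => /eqP ->.
have E k : x 0 k * t k = ofr (cmod (t k) * nrm x).
  have h : cmod (x 0 k * t k) <= cmod (t k) * nrm x.
    by rewrite nrmM mulrC ler_wpM2l ?nrm_ge0 ?nrm_entry.
  have s0 : 0 <= cmod (t k) * nrm x by rewrite mulr_ge0 ?nrm_ge0.
  have h2 : cmod (x 0 k * t k) ^+ 2 <= (cmod (t k) * nrm x) ^+ 2.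
    by apply: lerXn2r; rewrite ?nnegrE ?nrm_ge0.
  rewrite nrmsq eq1 in h2.
  have /eqP : cim (x 0 k * t k) ^+ 2 = 0.
    by apply/eqP; rewrite eq_le sqr_ge0 andbT; move: h2; rewrite gerDl.
  rewrite expf_eq0 /= => /eqP i0.
  by apply: cplx_eq; rewrite ?eq1 ?cre_ofr ?cim_ofr.
rewrite TE creS -sx mulr_sumr; apply: ler_sum => k _.
rewrite mxE mulrAC E creM cre_ofr cim_ofr mul0r subr0 mulrC.
by rewrite ler_wpM2l // mulr_ge0 ?nrm_ge0.
Qed.

End Functional.

(** * Iterated partial derivatives as Frechet derivatives *)

Section Partial.
Variable R : realType.
Local Notation C := (CC R).

(** ['D] and ['d] are linked at points of differentiability, and differentiating an equality needs
    it near the point; the induction therefore carries it on a whole ball. *)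
Lemma pure_partialE n (f : 'rV[C]_n -> 'rV[C]_n) k m (r : R) :
  (forall x, nrm x < r -> differentiable (component f k) x) ->
  forall x, nrm x < r -> pure_partial f k m x = frechet_pow (component f k) m x (delta_mx 0 k).
Proof.
move=> df; elim: m => [//|m IH] x xr.
rewrite /pure_partial iterS -/(pure_partial f k m).
have dg := frechet_diff df (nseq m (delta_mx 0 k)) xr.
have [] := @diff_ball_eq _ _ _ (pure_partial f k m) (frechet (component f k) (nseq m (delta_mx 0 k))) x (r - nrm x).
- by rewrite subr_gt0.
- move=> y yx; apply: IH; rewrite -(subrK x y); apply: le_lt_trans (nrmD _ _) _; lra.
- exact: dg.
move=> d1 d2.
exact: (etrans (@deriveE _ _ _ _ _ (delta_mx 0 k) d1) (congr1 (fun g => g (delta_mx 0 k)) d2)).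
Qed.
End Partial.

(** * The map acting by [koebe] in each coordinate *)

Section Extremal.
Variable R : realType.
Local Notation C := (CC R).
Variable n : nat.
Variable g : R.
Hypothesis g01 : 0 < g <= 1.

Definition kmap (x : 'rV[C]_n) : 'rV[C]_n := \row_k koebe g (x 0 k).

Lemma entry_lt1 (x : 'rV[C]_n) k : nrm x < 1 -> cmod (x 0 k) < 1.
Proof. by apply: le_lt_trans; exact: nrm_entry. Qed.

Lemma kmap_diff x : nrm x < 1 -> differentiable kmap x /\
  forall v, 'd kmap x v = \row_k (v 0 k * dkoebe g (x 0 k)).
Proof.
move=> x1; have dk k : differentiable (fun y : 'rV[C]_n => kmap y 0 k : C) x.
  rewrite (_ : (fun y => _) = koebe g \o (fun y : 'rV[C]_n => y 0 k : C)); last first.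
    by apply: funext => y; rewrite /kmap mxE.
  apply: differentiable_comp; first exact: differentiable_coord.
  by have [] := cder_diff (cder_koebe g01 (entry_lt1 k x1)).
have df : differentiable kmap x by exact: row_diff.
split=> // v; apply/rowP => k; rewrite mxE.
have [_ <-] := entry_diff k df.
have x0 : x + 0 *: v = x by rewrite scale0r addr0.
have h1 := @line_cder _ _ (fun y => kmap y 0 k : C) x v 0; rewrite x0 in h1.
apply: cder_unique (h1 (dk k)) _.
rewrite (_ : (fun s => _) = (fun s => koebe g (x 0 k + s * v 0 k))); last first.
  by apply: funext => s; rewrite /kmap !mxE.
have h3 : cder (fun s => x 0 k + s * v 0 k) 0 (v 0 k).
  have := cderD (cder_cst (x 0 k) 0) (cderM (@cder_id R 0) (cder_cst (v 0 k) 0)).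
  by rewrite add0r mul1r mulr0 addr0.
rewrite mulrC; apply: (@cder_comp _ (fun s => x 0 k + s * v 0 k) (koebe g)) => //.
by rewrite mul0r addr0; apply: cder_koebe => //; exact: entry_lt1.
Qed.

Lemma kmap_jacobian x : nrm x < 1 -> 'J kmap x = diag_mx (\row_k dkoebe g (x 0 k)).
Proof.
move=> x1; apply/matrixP => i j; rewrite !mxE.
have [_ ->] := kmap_diff x1; rewrite !mxE eqxx /= (eq_sym j).
by case: eqVneq => [->|]; rewrite ?mul1r ?mulr1n ?mul0r ?mulr0n.
Qed.

Lemma kmap_unit x : nrm x < 1 -> 'J kmap x \in unitmx.
Proof.
move=> x1; rewrite kmap_jacobian // unitmxE det_diag unitfE; apply/prodf_neq0 => k _.
by rewrite mxE; apply: dkoebe_neq0 => //; exact: entry_lt1.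
Qed.

Lemma kmap_starlike : almost_starlike ((1 - g) / 2) kmap.
Proof.
split.
- split; first by apply/rowP => k; rewrite !mxE /koebe mul0r.
  move=> v; have [|_ ->] := @kmap_diff 0; first by rewrite nrm0.
  by apply/rowP => k; rewrite !mxE dkoebe0 mulr1.
- split=> x /polydiskE x1; first by case: (kmap_diff x1).
  exact: kmap_unit.
move=> x T /polydiskE x1 x0 sT; rewrite -/(nrm x) -/(cre _).
pose p : 'rV[C]_n := \row_k ((1 + ofr g * x 0 k) / (1 - x 0 k)).
have uJ := kmap_unit x1.
have -> : kmap x *m invmx ('J kmap x) = \row_k (x 0 k * p 0 k).
  (* Multiplying by the Jacobian avoids inverting the diagonal matrix and leaves [koebe_quot] in
     each entry. *)
  rewrite -[RHS](mulmxK uJ); congr (_ *m _).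
  rewrite kmap_jacobian //; apply/rowP => k; rewrite mul_mx_diag !mxE.
  by apply: koebe_quot => //; exact: entry_lt1.
apply: support_re => // k; rewrite mxE; apply: koebe_starlike => //; exact: entry_lt1.
Qed.

Lemma kmap_htaylor k j z : (j < 5)%N ->
  htaylor (component kmap k) j z = kcoef g j * z 0 k ^+ j.
Proof.
move=> j5; have dk x : nrm x < 1 -> differentiable (component kmap k) x.
  by move=> /kmap_diff[/(entry_diff k)[]].
apply: (@taylor_line_uniq _ _ _ 1 z 5 (fun j => kcoef g j * z 0 k ^+ j) ltr01 dk) => //.
have E t : component kmap k (t *: z) = koebe g (z 0 k * t).
  by rewrite /component /kmap !mxE mulrC.
have [z0|z0] := eqVneq (z 0 k) 0.
  apply: (@bigo_ext _ _ _ (fun=> 0)); last first.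
    by apply: (@bigo_intro _ _ _ 0 1) => // t _ _; rewrite nrm0 mul0r.
  move=> t; rewrite E z0 mul0r /koebe mul0r !big_ord_recr big_ord0 /= !expr0n /=.
  by rewrite /kcoef /=; ring.
apply: bigo_ext (bigo_scale z0 (koebe_expansion g01)) => t.
by rewrite E; congr (_ - _); apply: eq_bigr => i _; rewrite exprMn; ring.
Qed.

Lemma kmap_pure : pure_low_order_terms kmap.
Proof.
move=> k z zb; have dk x : nrm x < 1 -> differentiable (component kmap k) x.
  by move=> /kmap_diff[/(entry_diff k)[]].
have pp m : (m < 5)%N -> pure_partial kmap k m 0 / m`!%:R = kcoef g m.
  move=> m5; have r0 : nrm (0 : 'rV[C]_n) < 1 by rewrite nrm0.
  rewrite (pure_partialE m dk r0).
  rewrite -[LHS]/(htaylor (component kmap k) m (delta_mx 0 k)) kmap_htaylor //.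
  by rewrite mxE !eqxx expr1n mulr1.
split.
  rewrite pp // -[LHS]/(htaylor (component kmap k) 2 z); exact: kmap_htaylor.
rewrite pp // -[LHS]/(htaylor (component kmap k) 3 z); exact: kmap_htaylor.
Qed.

End Extremal.

Theorem theorem3p5 (R : realType) (n : nat) (hn : (1 <= n)%N) (alpha : R)
    (halpha0 : 0 <= alpha) (halpha1 : alpha <= (37 - Num.sqrt 505) / 72) :
  let M : R := (1 - alpha) * (3 - 4 * alpha) * (4 - 6 * alpha) / 3 in
  let bounded_by (c : R) (f : 'rV[CC R]_n -> 'rV[CC R]_n) :=
    forall z : 'rV[CC R]_n, polydisk z ->
      `|frechet_pow f 4 0 z| / 4`!%:R <= (c%:C : CC R) * `|z| ^+ 4 in
  (forall f : 'rV[CC R]_n -> 'rV[CC R]_n,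
      almost_starlike alpha f -> pure_low_order_terms f -> bounded_by M f)
  /\
  (forall c : R,
      (forall f : 'rV[CC R]_n -> 'rV[CC R]_n,
          almost_starlike alpha f -> pure_low_order_terms f ->
          bounded_by c f) ->
      M <= c).
Proof.
move=> M bounded_by; split=> [f sf pf z _|c Hc]; first exact: upper_bound.
(* The bound [alpha <= 15 / 72] gives [0 < g], so that the exponent [(1 + g) / g] makes sense. *)
have [al2 _] := alpha_bounds halpha1.
pose g := 1 - 2 * alpha.
have g01 : 0 < g <= 1 by rewrite /g; apply/andP; split; lra.
have sk : almost_starlike alpha (@kmap R n g).
  have := kmap_starlike n g01; rewrite (_ : (1 - g) / 2 = alpha) //.
  by rewrite /g; field.
pose k := Ordinal hn.
(* A basis vector shrunk into the open polydisk; by homogeneity both sides carry [(1 / 2) ^+ 4],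
   which cancels. *)
pose z : 'rV[CC R]_n := ofr (1 / 2) *: delta_mx 0 k.
have nz : nrm z = 1 / 2 by rewrite nrmZ nrm_delta mulr1 nrm_ofr ger0_norm.
have zb : polydisk z by apply/polydiskE; rewrite nz; lra.
have := Hc _ sk (kmap_pure g01) z zb.
have f4 : (4`!%:R : CC R) != 0 by rewrite pnatr_eq0 -lt0n fact_gt0.
have f4R : (0 : R) < 4`!%:R by rewrite ltr0n fact_gt0.
rewrite [`|z|]nrmE nz nrmE -(ofr_nat R) -ofrV -ofrM -ofrX -[c%:C]/(ofr c) -ofrM ler_ofr => h.
have e1 : frechet_pow (@kmap R n g) 4 0 z 0 k = 4`!%:R * (kcoef g 4 * ofr (1 / 2) ^+ 4).
  have [||_ ->] := @frechet_entry _ _ _ (@kmap R n g) 1 _ (nseq 4 z) 0.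
  - by move=> x /(kmap_diff g01)[].
  - by rewrite nrm0.
  have <- : z 0 k = ofr (1 / 2) by rewrite !mxE !eqxx mulr1.
  by rewrite -(kmap_htaylor g01 k z (isT : (4 < 5)%N)) /htaylor mulrC divfK.
have nk : nrm (kcoef g 4) = (1 + g) * (1 + 2 * g) * (1 + 3 * g) / 6.
  rewrite nrm_ofr /= mulNr normrN ger0_norm // divr_ge0 //.
  by have /andP[g0 _] := g01; rewrite !mulr_ge0 //; lra.
have n4 : nrm (4`!%:R : CC R) = 4`!%:R by rewrite -[X in nrm X](ofr_nat R) nrm_ofr ger0_norm // ltW.
have nh : nrm (ofr (1 / 2) ^+ 4 : CC R) = (1 / 2) ^+ 4 by rewrite nrmX nrm_ofr ger0_norm.
have := nrm_entry (frechet_pow (@kmap R n g) 4 0 z) k.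
rewrite e1 nrmM (nrmM (kcoef g 4)) nk n4 nh => h'.
rewrite ler_pdivrMr // in h; have := le_trans h' h.
rewrite [leRHS]mulrC ler_pM2l // ler_pM2r ?exprn_gt0 // => h2; apply: le_trans h2.
(* With [g = 1 - 2 * alpha] the three factors are [2 - 2 * alpha], [3 - 4 * alpha] and
   [4 - 6 * alpha], so the two constants coincide. *)
by rewrite le_eqVlt; apply/orP; left; apply/eqP; rewrite /M /g; field.
Qed.
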